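(* Let $V:S^1\to\mathbb{R}$ be of class $C^{k-1,1}(S^1)$ for some $k\ge2$ with $\kappa'(\theta)>0$ for all $\theta$. For each $n$, let $\gamma_{n-1}>0$ be the leading coefficient of the orthonormal polynomial of degree $n-1$ with respect to the weight $\phi(\theta)=e^{-nV(\theta)}$ on the unit circle, and let $V_0=\frac{1}{2\pi}\int_{-\pi}^\pi V(\theta)d\theta$. Then there is a constant $K>0$ such that \[ \left|\gamma_{n-1}^2e^{-nV_0}-1\right|\le\frac{K\log(n)}{n^{2(k-1)}} \] for all sufficiently large $n$.
   Context: $C^{k-1,1}(S^1)$: functions on the circle whose periodic extension has $k-1$ Lipschitz continuous derivatives. For the fixed weight $\phi=e^{-nV}$, orthonormal polynomials $p_j(z)=\gamma_jz^j+\dots$ with $\gamma_j>0$ satisfy $\langle p_i,p_j\rangle_\phi=\delta_{ij}$, where $\langle f,g\rangle_\phi=\frac{1}{2\pi}\int_{-\pi}^{\pi}f(e^{i\theta})\overline{g(e^{i\theta})}\phi(\theta)d\theta$. $V_j$ the Fourier coefficients of $V$, $N(z)=\sum_{j\ge1}V_{-j}z^{-j}$, $\Omega(\theta)=2\,\mathrm{Im}\,N(e^{i\theta})$, $\kappa(\theta)=\theta+\Omega(\theta)$. *)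

(* Defs.v *)
From Stdlib Require Import Reals Lra Lia.
From Coquelicot Require Import Coquelicot.
Open Scope R_scope.

Definition eith (t : R) : C := (cos t, sin t).

Definition CRInt (f : R -> C) (a b : R) : C :=
  (RInt (fun t => Re (f t)) a b, RInt (fun t => Im (f t)) a b).

Definition CmLip (m : nat) (V : R -> R) : Prop :=
  (forall x, V (x + 2 * PI) = V x) /\
  (forall j x, (j <= m)%nat -> ex_derive_n V j x) /\
  (exists L, forall x y, Rabs (Derive_n V m x - Derive_n V m y) <= L * Rabs (x - y)).

Definition fourier (V : R -> R) (j : Z) : C :=
  Cmult (RtoC (/ (2 * PI)))
        (CRInt (fun t => Cmult (RtoC (V t)) (eith (- IZR j * t))) (- PI) PI).

(* Omega(theta) = 2 Im N(e^{i theta}),  N(z) = sum_{j>=1} V_{-j} z^{-j} *)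
Definition Omega (V : R -> R) (t : R) : R :=
  2 * Series (fun j : nat =>
    Im (Cmult (fourier V (- Z.of_nat (S j))) (eith (- INR (S j) * t)))).

Definition kappa (V : R -> R) (t : R) : R := t + Omega V t.

Fixpoint Cpow (z : C) (n : nat) : C :=
  match n with O => RtoC 1 | S m => Cmult z (Cpow z m) end.

Fixpoint peval (c : nat -> C) (d : nat) (z : C) : C :=
  match d with
  | O => c O
  | S m => Cplus (peval c m z) (Cmult (c (S m)) (Cpow z (S m)))
  end.

Definition ip (phi : R -> R) (f g : C -> C) : C :=
  Cmult (RtoC (/ (2 * PI)))
        (CRInt (fun t => Cmult (Cmult (f (eith t)) (Cconj (g (eith t)))) (RtoC (phi t)))
               (- PI) PI).

(* P j is the coefficient sequence of p_j (a polynomial of degree j, evaluated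
   as sum_{i<=j} (P j i) z^i), with leading coefficient gamma_j = P j j real > 0,
   and <p_i, p_j>_phi = delta_ij. *)
Definition orthonormal_system (phi : R -> R) (P : nat -> nat -> C) : Prop :=
  (forall j, Im (P j j) = 0 /\ 0 < Re (P j j)) /\
  (forall i j, ip phi (peval (P i) i) (peval (P j) j) =
               RtoC (if Nat.eqb i j then 1 else 0)).

Definition V0 (V : R -> R) : R := / (2 * PI) * RInt V (- PI) PI.

(* Main.v *)
Require Import Defs.
From Stdlib Require Import Reals Lra Lia Psatz ZArith.
From Coquelicot Require Import Coquelicot.
Open Scope R_scope.

(** Write F(z) = sum_{j>=1} V_j z^j, so that V = V_0 + 2 Re F and kappa = theta - 2 Im F on the circle,
    let p* be the reversed polynomial of p_{n-1}, and put E = 1 - c p* e^{-nF} with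
    c = e^{-n V_0} gamma_{n-1}. Orthonormality gives
    mean E = ||E||^2 = 1 - gamma_{n-1}^2 e^{-n V_0}, and E e^{-n conj F} has no frequencies in [0, n-1].
    Hence E = a + e^{i n kappa} b with a strictly antianalytic and b analytic, so that
    ||E||^2 = mean (e^{i n kappa} b). If the nonpositive frequencies of e^{i n kappa} are small, say of
    L^2 norm at most eps, and the two summands span an angle bounded below, this yields ||E|| <= 2 eps,
    i.e. a defect quadratic in eps.

    To bound those frequencies, truncate the Fourier series of V at frequency n / q. Since
    sum j^(2k) |V_j|^2 < oo, this changes e^{i n kappa} by O(n^{1-k}) in L^2 and by o(1) uniformly. For the
    truncated phase one may shift the contour by eta ~ (log n) / n; because kappa' is bounded below the
    shifted exponential is at most n^{-k}. *)

(** * Means and L^2 norms on the circle *)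

(** The splitting of E rests on one identity: on the circle conj F = F - 2i Im F, so z^n e^{n conj
    F} = e^{i n kappa} e^{nF}. Multiplying E e^{-n conj F} by e^{n conj F} therefore keeps its
    negative frequencies antianalytic and turns its frequencies from n on into e^{i n kappa} times
    an analytic function.

    What shapes the proof is that the phase must be small in two senses, which truncation serves in
    different norms. The angle between the summands is a bilinear form in two L^2 functions, so the
    truncated phase has to be uniformly close; this gives no rate, but a fixed bound 1/2 is enough.
    The rate comes from a linear form, where L^2 closeness suffices. Truncation itself is forced: V
    has only finitely many derivatives and need not continue off the circle. Taking q large keeps
    the growth of the highest retained frequency under the shift below a small power of n.

    No Hardy space is built. The estimates are proved for finite sums and carried to F and e^{nF} by
    uniform approximation. *)

Definition rcont (f : R -> R) : Prop := forall t, continuous f t.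

Lemma rcont_ext f g : (forall t, f t = g t) -> rcont f -> rcont g.
Proof. intros H Hf t. apply (continuous_ext f); auto. Qed.
Lemma rcont_const c : rcont (fun _ => c).
Proof. intro t. apply continuous_const. Qed.
Lemma rcont_id : rcont (fun t => t).
Proof. intro t. apply continuous_id. Qed.
Lemma rcont_plus f g : rcont f -> rcont g -> rcont (fun t => f t + g t).
Proof. intros Hf Hg t. exact (continuous_plus f g t (Hf t) (Hg t)). Qed.
Lemma rcont_minus f g : rcont f -> rcont g -> rcont (fun t => f t - g t).
Proof. intros Hf Hg t. exact (continuous_minus f g t (Hf t) (Hg t)). Qed.
Lemma rcont_opp f : rcont f -> rcont (fun t => - f t).
Proof. intros Hf t. exact (continuous_opp f t (Hf t)). Qed.
Lemma rcont_mult f g : rcont f -> rcont g -> rcont (fun t => f t * g t).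
Proof. intros Hf Hg t. exact (continuous_mult f g t (Hf t) (Hg t)). Qed.
Lemma rcont_comp f g : rcont f -> rcont g -> rcont (fun t => g (f t)).
Proof. intros Hf Hg t. exact (continuous_comp f g t (Hf t) (Hg (f t))). Qed.
Lemma rcont_cos : rcont cos.
Proof. intro t. apply continuous_cos. Qed.
Lemma rcont_sin : rcont sin.
Proof. intro t. apply continuous_sin. Qed.
Lemma rcont_exp : rcont exp.
Proof. intro t. apply continuous_exp. Qed.
Lemma rcont_ex_RInt f a b : rcont f -> ex_RInt f a b.
Proof. intros Hf. apply (@ex_RInt_continuous R_CompleteNormedModule); intros; apply Hf. Qed.


Definition rmean (f : R -> R) : R := / (2 * PI) * RInt f (- PI) PI.

Lemma rmean_ext f g : (forall t, f t = g t) -> rmean f = rmean g.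
Proof. intro H. unfold rmean. f_equal. apply RInt_ext; auto. Qed.
Lemma rmean_plus f g : rcont f -> rcont g ->
  rmean (fun t => f t + g t) = rmean f + rmean g.
Proof.
  intros Hf Hg. unfold rmean. rewrite <- Rmult_plus_distr_l. f_equal.
  exact (RInt_plus f g _ _ (rcont_ex_RInt f _ _ Hf) (rcont_ex_RInt g _ _ Hg)).
Qed.
Lemma rmean_scal c f : rcont f -> rmean (fun t => c * f t) = c * rmean f.
Proof.
  intros Hf. unfold rmean.
  replace (RInt (fun t => c * f t) (- PI) PI) with (c * RInt f (- PI) PI). ring.
  symmetry. exact (RInt_scal f _ _ c (rcont_ex_RInt f _ _ Hf)).
Qed.
Lemma rmean_opp f : rcont f -> rmean (fun t => - f t) = - rmean f.
Proof.
  intros Hf. rewrite (rmean_ext _ (fun t => (-1) * f t)) by (intro; ring).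
  rewrite rmean_scal by auto. ring.
Qed.
Lemma rmean_minus f g : rcont f -> rcont g ->
  rmean (fun t => f t - g t) = rmean f - rmean g.
Proof.
  intros Hf Hg. rewrite (rmean_ext _ (fun t => f t + - g t)) by (intro; ring).
  rewrite rmean_plus by (auto using rcont_opp). rewrite rmean_opp by auto. ring.
Qed.
Lemma rmean_const c : rmean (fun _ => c) = c.
Proof.
  unfold rmean. rewrite RInt_const. unfold scal; simpl; unfold mult; simpl.
  generalize PI_RGT_0; intro. field. lra.
Qed.
Lemma rmean_le f g : rcont f -> rcont g -> (forall t, f t <= g t) -> rmean f <= rmean g.
Proof.
  intros Hf Hg H. unfold rmean. generalize PI_RGT_0; intro.
  apply Rmult_le_compat_l. left; apply Rinv_0_lt_compat; lra.
  apply RInt_le; auto using rcont_ex_RInt. lra.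
Qed.

(** * The complex exponential, and continuity and means of complex functions *)

Definition cexp (s : C) : C := (exp (fst s) * cos (snd s), exp (fst s) * sin (snd s)).

Lemma cexp_plus s t : cexp (s + t) = Cmult (cexp s) (cexp t).
Proof.
  unfold cexp, Cmult, Cplus; simpl. rewrite exp_plus, cos_plus, sin_plus.
  f_equal; ring.
Qed.
Lemma cexp_0 : cexp 0 = 1.
Proof. unfold cexp; simpl. rewrite exp_0, cos_0, sin_0. unfold RtoC. f_equal; ring. Qed.
Lemma cexp_conj s : Cconj (cexp s) = cexp (Cconj s).
Proof. unfold cexp, Cconj; simpl. rewrite cos_neg, sin_neg. f_equal; ring. Qed.
Lemma Cmod_sqr z : Cmod z ^ 2 = Re z * Re z + Im z * Im z.
Proof. rewrite Cmod2_alt. ring. Qed.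
Lemma Cmod_cexp s : Cmod (cexp s) = exp (Re s).
Proof.
  apply Rsqr_inj. apply Cmod_ge_0. left; apply exp_pos.
  rewrite Rsqr_pow2, Cmod_sqr. unfold cexp, Rsqr; simpl.
  generalize (sin2_cos2 (snd s)). unfold Rsqr, Re; intro. 
  transitivity (exp (fst s) * exp (fst s) * (sin (snd s) * sin (snd s) + cos (snd s) * cos (snd s))). ring. rewrite H. ring.
Qed.
Lemma eith_cexp t : eith t = cexp (0, t).
Proof. unfold eith, cexp; simpl. rewrite exp_0. f_equal; ring. Qed.
Lemma cexp_neg_l s : Cmult (cexp (- s)) (cexp s) = 1.
Proof. rewrite <- cexp_plus, Cplus_comm, Cplus_opp_r. apply cexp_0. Qed.

Definition ccont (f : R -> C) : Prop :=
  rcont (fun t => Re (f t)) /\ rcont (fun t => Im (f t)).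

Lemma ccont_ext f g : (forall t, f t = g t) -> ccont f -> ccont g.
Proof. intros H [H1 H2]; split; [eapply rcont_ext, H1|eapply rcont_ext, H2]; intro; simpl; now rewrite H. Qed.
Lemma ccont_pair f g : rcont f -> rcont g -> ccont (fun t => (f t, g t)).
Proof. split; auto. Qed.
Lemma ccont_const c : ccont (fun _ => c).
Proof. split; apply rcont_const. Qed.
Lemma ccont_RtoC f : rcont f -> ccont (fun t => RtoC (f t)).
Proof. split; auto. exact (rcont_const 0). Qed.
Lemma ccont_plus f g : ccont f -> ccont g -> ccont (fun t => Cplus (f t) (g t)).
Proof. intros [] []; split; apply rcont_plus; auto. Qed.
Lemma ccont_opp f : ccont f -> ccont (fun t => Copp (f t)).
Proof. intros []; split; apply rcont_opp; auto. Qed.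
Lemma ccont_minus f g : ccont f -> ccont g -> ccont (fun t => Cminus (f t) (g t)).
Proof. intros. apply ccont_plus; auto using ccont_opp. Qed.
Lemma ccont_mult f g : ccont f -> ccont g -> ccont (fun t => Cmult (f t) (g t)).
Proof.
  intros [] []; split. apply rcont_minus; apply rcont_mult; auto.
  apply rcont_plus; apply rcont_mult; auto.
Qed.
Lemma ccont_conj f : ccont f -> ccont (fun t => Cconj (f t)).
Proof. intros []; split; auto. now apply rcont_opp. Qed.
Lemma ccont_cexp f : ccont f -> ccont (fun t => cexp (f t)).
Proof.
  intros [H1 H2]; split; apply rcont_mult.
  - apply (rcont_comp _ exp); auto using rcont_exp.
  - apply (rcont_comp _ cos); auto using rcont_cos.
  - apply (rcont_comp _ exp); auto using rcont_exp.
  - apply (rcont_comp _ sin); auto using rcont_sin.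
Qed.
Lemma ccont_eith f : rcont f -> ccont (fun t => eith (f t)).
Proof.
  intros H; split. apply (rcont_comp _ cos); auto using rcont_cos.
  apply (rcont_comp _ sin); auto using rcont_sin.
Qed.
Lemma rcont_Cmod2 f : ccont f -> rcont (fun t => Cmod (f t) ^ 2).
Proof.
  intros []. apply (rcont_ext (fun t => Re (f t) * Re (f t) + Im (f t) * Im (f t))).
  intro; now rewrite Cmod_sqr. apply rcont_plus; apply rcont_mult; auto.
Qed.

(** Kept in the shape of [fourier] and [ip], so that both convert to means by computation alone. *)
Definition mean (f : R -> C) : C := Cmult (RtoC (/ (2 * PI))) (CRInt f (- PI) PI).

Lemma mean_pair f : mean f = (rmean (fun t => Re (f t)), rmean (fun t => Im (f t))).
Proof.
  unfold mean, CRInt, rmean, Cmult, RtoC. simpl. f_equal; ring.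
Qed.
Lemma mean_ext f g : (forall t, f t = g t) -> mean f = mean g.
Proof. intro H. rewrite !mean_pair. f_equal; apply rmean_ext; intro; now rewrite H. Qed.
Lemma mean_plus f g : ccont f -> ccont g ->
  mean (fun t => Cplus (f t) (g t)) = Cplus (mean f) (mean g).
Proof. intros [] []. rewrite !mean_pair. unfold Cplus; simpl. f_equal; apply rmean_plus; auto. Qed.
Lemma mean_scal c f : ccont f -> mean (fun t => Cmult c (f t)) = Cmult c (mean f).
Proof.
  intros [H1 H2]. rewrite !mean_pair. unfold Cmult; simpl. f_equal.
  - rewrite rmean_minus by (apply rcont_mult; auto using rcont_const).
    now rewrite !rmean_scal.
  - rewrite rmean_plus by (apply rcont_mult; auto using rcont_const).
    now rewrite !rmean_scal.
Qed.
Lemma mean_conj f : ccont f -> mean (fun t => Cconj (f t)) = Cconj (mean f).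
Proof. intros []. rewrite !mean_pair. unfold Cconj; simpl. f_equal. now apply rmean_opp. Qed.
Lemma mean_const c : mean (fun _ => c) = c.
Proof. rewrite mean_pair, !rmean_const. now destruct c. Qed.
Lemma mean_opp f : ccont f -> mean (fun t => Copp (f t)) = Copp (mean f).
Proof. intros []. rewrite !mean_pair. unfold Copp; simpl. f_equal; now apply rmean_opp. Qed.
Lemma mean_minus f g : ccont f -> ccont g ->
  mean (fun t => Cminus (f t) (g t)) = Cminus (mean f) (mean g).
Proof. intros. unfold Cminus. rewrite mean_plus, mean_opp; auto using ccont_opp. Qed.

Definition nrm2 (f : R -> C) : R := rmean (fun t => Cmod (f t) ^ 2).
Definition nrm (f : R -> C) : R := sqrt (nrm2 f).

Lemma nrm2_pos f : ccont f -> 0 <= nrm2 f.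
Proof.
  intro H. unfold nrm2. rewrite <- (rmean_const 0). apply rmean_le; auto using rcont_const, rcont_Cmod2.
  intro; apply pow2_ge_0.
Qed.
Lemma nrm_pos f : 0 <= nrm f.
Proof. apply sqrt_pos. Qed.
Lemma nrm_sqr f : ccont f -> nrm f ^ 2 = nrm2 f.
Proof. intro H. unfold nrm. rewrite pow2_sqrt; auto using nrm2_pos. Qed.
Lemma nrm2_ext f g : (forall t, f t = g t) -> nrm2 f = nrm2 g.
Proof. intro H; apply rmean_ext; intro; now rewrite H. Qed.
Lemma nrm_ext f g : (forall t, f t = g t) -> nrm f = nrm g.
Proof. intro H. unfold nrm; now rewrite (nrm2_ext f g). Qed.
Lemma nrm2_conj f : nrm2 (fun t => Cconj (f t)) = nrm2 f.
Proof. apply rmean_ext; intro; now rewrite Cmod_conj. Qed.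
Lemma nrm_conj f : nrm (fun t => Cconj (f t)) = nrm f.
Proof. unfold nrm. now rewrite nrm2_conj. Qed.

Lemma nrm2_plus f g : ccont f -> ccont g ->
  nrm2 (fun t => Cplus (f t) (g t)) =
  nrm2 f + nrm2 g + 2 * Re (mean (fun t => Cmult (f t) (Cconj (g t)))).
Proof.
  intros Hf Hg. rewrite mean_pair; simpl.
  rewrite <- rmean_scal by (apply (ccont_mult _ _ Hf (ccont_conj _ Hg))).
  unfold nrm2. rewrite <- !rmean_plus; auto using rcont_plus, rcont_Cmod2.
  - apply rmean_ext; intro. rewrite !Cmod_sqr. simpl. unfold Re, Im. ring.
  - apply rcont_mult; auto using rcont_const. apply (ccont_mult _ _ Hf (ccont_conj _ Hg)).
Qed.
Lemma nrm2_scal c f : ccont f -> nrm2 (fun t => Cmult c (f t)) = Cmod c ^ 2 * nrm2 f.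
Proof.
  intros Hf. unfold nrm2. rewrite <- rmean_scal by now apply rcont_Cmod2.
  apply rmean_ext; intro. rewrite Cmod_mult. ring.
Qed.

(** With [w] the mean, expand the nonnegative quantity ||f - r w conj g||^2 for real [r]. The
    pairing carries no conjugate, since the phase estimates pair two analytic functions. *)
Lemma Cauchy_Schwarz f g : ccont f -> ccont g ->
  Cmod (mean (fun t => Cmult (f t) (g t))) <= nrm f * nrm g.
Proof.
  intros Hf Hg. set (w := mean _).
  assert (H : forall r : R, 0 <= nrm2 f - 2 * r * Cmod w ^ 2 + r ^ 2 * Cmod w ^ 2 * nrm2 g).
  { intro r.
    assert (Hc : ccont (fun t => Cmult (Copp (Cmult r w)) (Cconj (g t)))).
    { apply ccont_mult; auto using ccont_const, ccont_conj. }
    generalize (nrm2_pos _ (ccont_plus _ _ Hf Hc)). rewrite nrm2_plus by auto.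
    rewrite nrm2_scal by auto using ccont_conj. rewrite nrm2_conj.
    rewrite (mean_ext _ (fun t => Cmult (Copp (Cmult r (Cconj w))) (Cmult (f t) (g t)))).
    2:{ intro. rewrite Cmult_conj, Cconj_conj, Copp_conj, Cmult_conj.
        replace (Cconj r) with (RtoC r). ring. unfold Cconj, RtoC; simpl; f_equal; ring. }
    rewrite mean_scal by (apply ccont_mult; auto). fold w.
    rewrite Cmod_opp, Cmod_mult, Cmod_R.
    replace ((Rabs r * Cmod w) ^ 2) with (r ^ 2 * Cmod w ^ 2)
      by (rewrite Rpow_mult_distr, pow2_abs; ring).
    intro H0. eapply Rle_trans. apply H0. rewrite !Cmod_sqr. right. simpl. unfold Re, Im. ring. }
  assert (H2 : Cmod w ^ 2 <= nrm2 f * nrm2 g).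
  { generalize (nrm2_pos _ Hf) (nrm2_pos _ Hg) (pow2_ge_0 (Cmod w)). intros P1 P2 P3.
    destruct P2 as [P2|P2].
    - generalize (H (/ nrm2 g)). intro H1.
      assert (E : nrm2 f - 2 * / nrm2 g * Cmod w ^ 2 + (/ nrm2 g) ^ 2 * Cmod w ^ 2 * nrm2 g
        = nrm2 f - Cmod w ^ 2 / nrm2 g) by (field; lra).
      rewrite E in H1. apply Rmult_le_reg_r with (/ nrm2 g). now apply Rinv_0_lt_compat.
      replace (nrm2 f * nrm2 g * / nrm2 g) with (nrm2 f) by (field; lra).
      unfold Rdiv in H1. lra.
    (* If [g] has norm zero the expression is affine in [r]; the chosen [r] makes it equal to -1
       unless [w] vanishes. *)
    - rewrite <- P2 in *. destruct P3 as [P3|P3]; [|lra].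
      revert H P3. generalize (Cmod w ^ 2). intros q H P3.
      generalize (H ((nrm2 f + 1) / (2 * q))). intro H1. exfalso.
      replace (2 * ((nrm2 f + 1) / (2 * q)) * q) with (nrm2 f + 1) in H1 by (field; lra).
      lra. }
  unfold nrm. rewrite <- sqrt_mult by auto using nrm2_pos.
  rewrite <- (sqrt_pow2 (Cmod w)) by apply Cmod_ge_0. now apply sqrt_le_1_alt.
Qed.

Lemma nrm_le_sup f B : ccont f -> 0 <= B -> (forall t, Cmod (f t) <= B) -> nrm f <= B.
Proof.
  intros Hf HB H. unfold nrm. rewrite <- (sqrt_pow2 B) by auto. apply sqrt_le_1_alt.
  unfold nrm2. rewrite <- (rmean_const (B ^ 2)). apply rmean_le; auto using rcont_const, rcont_Cmod2.
  intro. apply pow_incr. split; auto. apply Cmod_ge_0.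
Qed.
Lemma nrm_mult_le f g B : ccont f -> ccont g -> 0 <= B -> (forall t, Cmod (f t) <= B) ->
  nrm (fun t => Cmult (f t) (g t)) <= B * nrm g.
Proof.
  intros Hf Hg HB H. unfold nrm. rewrite <- (sqrt_pow2 B) by auto.
  rewrite <- sqrt_mult by auto using nrm2_pos, pow2_ge_0. apply sqrt_le_1_alt.
  unfold nrm2. rewrite <- rmean_scal by auto using rcont_Cmod2.
  apply rmean_le; auto using rcont_mult, rcont_const, rcont_Cmod2, ccont_mult.
  intro. rewrite Cmod_mult, Rpow_mult_distr. apply Rmult_le_compat_r. apply pow2_ge_0.
  apply pow_incr. split; auto. apply Cmod_ge_0.
Qed.
Lemma mean_le_nrm f : ccont f -> Cmod (mean f) <= nrm f.
Proof.
  intro Hf. rewrite (mean_ext f (fun t => Cmult (f t) 1)) by (intro; ring).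
  eapply Rle_trans. apply (Cauchy_Schwarz f (fun _ => RtoC 1)); auto using ccont_const.
  rewrite <- (Rmult_1_r (nrm f)) at 2. apply Rmult_le_compat_l. apply nrm_pos.
  apply nrm_le_sup; auto using ccont_const. lra. intro; rewrite Cmod_1; lra.
Qed.
Lemma nrm_triangle f g : ccont f -> ccont g ->
  nrm (fun t => Cplus (f t) (g t)) <= nrm f + nrm g.
Proof.
  intros Hf Hg. unfold nrm at 1.
  rewrite <- (sqrt_pow2 (nrm f + nrm g)) by (generalize (nrm_pos f) (nrm_pos g); lra).
  apply sqrt_le_1_alt. rewrite nrm2_plus by auto.
  generalize (Cauchy_Schwarz f _ Hf (ccont_conj _ Hg)). rewrite nrm_conj. intro H.
  generalize (re_le_Cmod (mean (fun t => Cmult (f t) (Cconj (g t))))). intro H1.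
  generalize (Rle_abs (Re (mean (fun t => Cmult (f t) (Cconj (g t)))))). intro H2.
  rewrite <- !nrm_sqr by auto. nra.
Qed.

(** * Trigonometric polynomials *)

Fixpoint csum (f : nat -> C) (N : nat) : C :=
  match N with O => 0 | S N => Cplus (csum f N) (f N) end.
Fixpoint rsum (f : nat -> R) (N : nat) : R :=
  match N with O => 0 | S N => rsum f N + f N end.

Lemma csum_ext f g N : (forall j, (j < N)%nat -> f j = g j) -> csum f N = csum g N.
Proof. induction N; simpl; intro H; auto. rewrite IHN, H; auto. Qed.
Lemma rsum_ext f g N : (forall j, (j < N)%nat -> f j = g j) -> rsum f N = rsum g N.
Proof. induction N; simpl; intro H; auto. rewrite IHN, H; auto. Qed.
Lemma rsum_le f g N : (forall j, (j < N)%nat -> f j <= g j) -> rsum f N <= rsum g N.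
Proof. induction N; simpl; intro H. lra. apply Rplus_le_compat; auto. Qed.
Lemma rsum_scal c f N : rsum (fun j => c * f j) N = c * rsum f N.
Proof. induction N; simpl; try rewrite IHN; ring. Qed.
Lemma rsum_plus f g N : rsum (fun j => f j + g j) N = rsum f N + rsum g N.
Proof. induction N; simpl; try rewrite IHN; ring. Qed.
Lemma rsum_const c N : rsum (fun _ => c) N = INR N * c.
Proof. induction N. simpl; ring. rewrite S_INR. simpl rsum. rewrite IHN. ring. Qed.
Lemma csum_RtoC g N : csum (fun j => RtoC (g j)) N = RtoC (rsum g N).
Proof. induction N; simpl. reflexivity. now rewrite IHN, RtoC_plus. Qed.
Lemma Cmod_csum f N : Cmod (csum f N) <= rsum (fun j => Cmod (f j)) N.
Proof.
  induction N; simpl. rewrite Cmod_0; lra.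
  eapply Rle_trans. apply Cmod_triangle. lra.
Qed.
Lemma Re_csum f N : Re (csum f N) = rsum (fun j => Re (f j)) N.
Proof. induction N; simpl; auto. rewrite <- IHN; reflexivity. Qed.
Lemma Im_csum f N : Im (csum f N) = rsum (fun j => Im (f j)) N.
Proof. induction N; simpl; auto. rewrite <- IHN; reflexivity. Qed.
Lemma csum_mult_l c f N : csum (fun j => Cmult c (f j)) N = Cmult c (csum f N).
Proof. induction N; simpl; try rewrite IHN; ring. Qed.
Lemma csum_conj f N : csum (fun j => Cconj (f j)) N = Cconj (csum f N).
Proof. induction N; simpl. unfold Cconj, RtoC; simpl; f_equal; ring. now rewrite IHN, Cplus_conj. Qed.
Lemma ccont_csum (f : nat -> R -> C) N : (forall j, (j < N)%nat -> ccont (f j)) ->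
  ccont (fun t => csum (fun j => f j t) N).
Proof.
  induction N; simpl; intro H. apply ccont_const. apply ccont_plus; auto.
Qed.
Lemma mean_csum (f : nat -> R -> C) N : (forall j, (j < N)%nat -> ccont (f j)) ->
  mean (fun t => csum (fun j => f j t) N) = csum (fun j => mean (f j)) N.
Proof.
  induction N; simpl; intro H. apply mean_const. rewrite mean_plus, IHN; auto using ccont_csum.
Qed.
Lemma rsum_pos f N : (forall j, (j < N)%nat -> 0 <= f j) -> 0 <= rsum f N.
Proof. induction N; simpl; intro H. lra. apply Rplus_le_le_0_compat; auto. Qed.
Lemma csum_zero (f : nat -> C) N : (forall j, (j < N)%nat -> f j = RtoC 0) -> csum f N = 0.
Proof. intro H; induction N; simpl; auto. rewrite IHN, H; auto. ring. Qed.

Lemma sin_IZR_PI z : sin (IZR z * PI) = 0.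
Proof. apply sin_eq_0_1. now exists z. Qed.
Lemma mean_eith_nz (z : Z) : z <> 0%Z -> mean (fun t => eith (IZR z * t)) = 0.
Proof.
  intro Hz. assert (Hz' : IZR z <> 0) by now apply not_0_IZR.
  rewrite mean_pair. unfold rmean, RtoC. f_equal; apply Rmult_eq_0_compat_l; simpl.
  - rewrite (is_RInt_unique (fun t => cos (IZR z * t)) (- PI) PI
      (minus (sin (IZR z * PI) / IZR z) (sin (IZR z * - PI) / IZR z))).
    + replace (IZR z * - PI) with (- (IZR z * PI)) by ring.
      rewrite sin_neg, sin_IZR_PI. unfold minus, plus, opp; simpl. field. auto.
    + apply (is_RInt_derive (fun t => sin (IZR z * t) / IZR z)).
      * intros x _. auto_derive; auto. field. auto.
      * intros x _. apply (rcont_comp (fun t => IZR z * t) cos). 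
        apply rcont_mult; auto using rcont_const, rcont_id. apply rcont_cos.
  - rewrite (is_RInt_unique (fun t => sin (IZR z * t)) (- PI) PI
      (minus (- cos (IZR z * PI) / IZR z) (- cos (IZR z * - PI) / IZR z))).
    + replace (IZR z * - PI) with (- (IZR z * PI)) by ring.
      rewrite cos_neg. unfold minus, plus, opp; simpl. field. auto.
    + apply (is_RInt_derive (fun t => - cos (IZR z * t) / IZR z)).
      * intros x _. auto_derive; auto. field. auto.
      * intros x _. apply (rcont_comp (fun t => IZR z * t) sin). 
        apply rcont_mult; auto using rcont_const, rcont_id. apply rcont_sin.
Qed.

Lemma cexp_line x e t : cexp (Cmult (RtoC x) (e, t)) = Cmult (RtoC (exp (x * e))) (eith (x * t)).
Proof.
  unfold cexp, Cmult, RtoC, eith; simpl.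
  replace (x * e - 0 * t) with (x * e) by ring. replace (x * t + 0 * e) with (x * t) by ring.
  f_equal; ring.
Qed.
Lemma cexp_line0 x t : cexp (Cmult (RtoC x) (0, t)) = eith (x * t).
Proof. rewrite cexp_line, Rmult_0_r, exp_0. apply Cmult_1_l. Qed.
Lemma eith_plus s t : eith (s + t) = Cmult (eith s) (eith t).
Proof. unfold eith, Cmult; simpl. rewrite cos_plus, sin_plus. f_equal; ring. Qed.
Lemma eith_conj t : Cconj (eith t) = eith (- t).
Proof. unfold eith, Cconj; simpl. now rewrite cos_neg, sin_neg. Qed.
Lemma eith_0 : eith 0 = 1.
Proof. unfold eith. now rewrite cos_0, sin_0. Qed.
Lemma Cmod_eith t : Cmod (eith t) = 1.
Proof. rewrite eith_cexp, Cmod_cexp. simpl. apply exp_0. Qed.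

(** The variable is a logarithm: [s = (e, t)] is the point of modulus [exp e] and angle [t]. Moving
    the contour then means changing the first coordinate. *)
Definition apoly (b : nat -> C) (N : nat) (s : C) : C :=
  csum (fun j => Cmult (b j) (cexp (Cmult (RtoC (INR j)) s))) N.
(* With [z = cexp s]: polynomials, respectively Laurent polynomials, in [z]. *)
Definition isA (f : C -> C) : Prop := exists N b, forall s, f s = apoly b N s.
Definition isL (f : C -> C) : Prop := exists (K : nat) (g : C -> C), isA g /\
  forall s, f s = Cmult (cexp (Copp (Cmult (RtoC (INR K)) s))) (g s).

Lemma isA_ext f g : (forall s, f s = g s) -> isA f -> isA g.
Proof. intros H (N & b & Hb). exists N, b. intro; now rewrite <- H. Qed.

Lemma apoly_pad b N N' s : (N <= N')%nat ->
  apoly b N s = apoly (fun j => if Nat.ltb j N then b j else 0) N' s.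
Proof.
  intro H. induction H.
  - apply csum_ext. intros j Hj. apply Nat.ltb_lt in Hj. now rewrite Hj.
  - rewrite IHle. unfold apoly; simpl. replace (Nat.ltb m N) with false.
    rewrite Cmult_0_l, Cplus_0_r. reflexivity. symmetry. apply Nat.ltb_ge; auto.
Qed.
Lemma isA_plus f g : isA f -> isA g -> isA (fun s => Cplus (f s) (g s)).
Proof.
  intros (N & b & Hb) (M & c & Hc). exists (max N M), (fun j =>
    Cplus (if Nat.ltb j N then b j else 0) (if Nat.ltb j M then c j else 0)).
  intro s. rewrite Hb, Hc, (apoly_pad b N (max N M)), (apoly_pad c M (max N M)) by lia.
  unfold apoly. induction (max N M); simpl. ring. rewrite <- IHn. ring.
Qed.
Lemma isA_scal c f : isA f -> isA (fun s => Cmult c (f s)).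
Proof.
  intros (N & b & Hb). exists N, (fun j => Cmult c (b j)). intro s. rewrite Hb.
  unfold apoly. rewrite <- csum_mult_l. apply csum_ext. intros; ring.
Qed.
Lemma isA_const c : isA (fun _ => c).
Proof.
  exists 1%nat, (fun _ => c). intro s. unfold apoly; simpl. rewrite Cmult_0_l, cexp_0. ring.
Qed.
Lemma cexp_INR_S k s : cexp (Cmult (RtoC (INR (S k))) s) = Cmult (cexp s) (cexp (Cmult (RtoC (INR k)) s)).
Proof. rewrite <- cexp_plus. f_equal. rewrite S_INR, RtoC_plus. ring. Qed.
Lemma isA_z f : isA f -> isA (fun s => Cmult (cexp s) (f s)).
Proof.
  intros (N & b & Hb). exists (S N), (fun j => match j with O => RtoC 0 | S j => b j end).
  intro s. rewrite Hb. clear f Hb. unfold apoly. induction N.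
  - simpl. ring.
  - simpl csum at 1. rewrite Cmult_plus_distr_l, IHN.
    set (g := fun j : nat => _). change (csum g (S (S N))) with (Cplus (csum g (S N)) (g (S N))).
    f_equal. unfold g. rewrite cexp_INR_S. ring.
Qed.
Lemma isA_zpow k f : isA f -> isA (fun s => Cmult (cexp (Cmult (RtoC (INR k)) s)) (f s)).
Proof.
  intro Hf. induction k.
  - apply (isA_ext f); auto. intro. simpl. rewrite Cmult_0_l, cexp_0. ring.
  - apply (isA_ext _ _ (fun s => eq_sym (f_equal (fun z => Cmult z (f s)) (cexp_INR_S k s)))).
    apply (isA_ext (fun s => Cmult (cexp s) (Cmult (cexp (Cmult (RtoC (INR k)) s)) (f s)))).
    intro; ring. now apply isA_z.
Qed.
Lemma isA_mono k : isA (fun s => cexp (Cmult (RtoC (INR k)) s)).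
Proof. apply (isA_ext _ _ (fun s => Cmult_1_r _)). apply isA_zpow, isA_const. Qed.
Lemma isA_mult f g : isA f -> isA g -> isA (fun s => Cmult (f s) (g s)).
Proof.
  intros (N & b & Hb) Hg. apply (isA_ext (fun s => Cmult (apoly b N s) (g s))).
  intro; now rewrite Hb. clear f Hb. unfold apoly. induction N; simpl.
  - apply (isA_ext (fun _ => RtoC 0)). intro; ring. apply isA_const.
  - apply (isA_ext (fun s => Cplus (Cmult (apoly b N s) (g s))
       (Cmult (b N) (Cmult (cexp (Cmult (RtoC (INR N)) s)) (g s))))).
    intro; unfold apoly; ring. apply isA_plus; auto. apply isA_scal. now apply isA_zpow.
Qed.
Lemma isA_apoly b N : isA (apoly b N).
Proof. exists N, b; auto. Qed.
Lemma isA_cpow f n : isA f -> isA (fun s => Defs.Cpow (f s) n).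
Proof. intro Hf. induction n; simpl. apply isA_const. now apply isA_mult. Qed.

Lemma isL_isA f : isA f -> isL f.
Proof. exists O, f. split; auto. intro s. change (INR 0) with 0. replace (Copp (Cmult 0 s)) with (RtoC 0) by ring. rewrite cexp_0; ring. Qed.
Lemma isL_mult f g : isL f -> isL g -> isL (fun s => Cmult (f s) (g s)).
Proof.
  intros (K & a & Ha & Hf) (M & b & Hb & Hg). exists (K + M)%nat, (fun s => Cmult (a s) (b s)).
  split. now apply isA_mult. intro s. rewrite Hf, Hg, plus_INR, RtoC_plus.
  replace (Copp (Cmult (Cplus (RtoC (INR K)) (RtoC (INR M))) s)) with (Cplus (Copp (Cmult (RtoC (INR K)) s)) (Copp (Cmult (RtoC (INR M)) s))) by ring.
  rewrite cexp_plus. ring.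
Qed.
Lemma isL_plus f g : isL f -> isL g -> isL (fun s => Cplus (f s) (g s)).
Proof.
  intros (K & a & Ha & Hf) (M & b & Hb & Hg). exists (K + M)%nat,
   (fun s => Cplus (Cmult (cexp (Cmult (RtoC (INR M)) s)) (a s)) (Cmult (cexp (Cmult (RtoC (INR K)) s)) (b s))).
  split. apply isA_plus; now apply isA_zpow.
  intro s. rewrite Hf, Hg, plus_INR, RtoC_plus.
  replace (Copp (Cmult (Cplus (RtoC (INR K)) (RtoC (INR M))) s)) with (Cplus (Copp (Cmult (RtoC (INR K)) s)) (Copp (Cmult (RtoC (INR M)) s))) by ring.
  rewrite cexp_plus.
  transitivity (Cplus (Cmult (Cmult (cexp (Copp (Cmult (RtoC (INR M)) s))) (cexp (Cmult (RtoC (INR M)) s))) 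
     (Cmult (cexp (Copp (Cmult (RtoC (INR K)) s))) (a s)))
    (Cmult (Cmult (cexp (Copp (Cmult (RtoC (INR K)) s))) (cexp (Cmult (RtoC (INR K)) s))) 
     (Cmult (cexp (Copp (Cmult (RtoC (INR M)) s))) (b s)))).
  rewrite !cexp_neg_l. ring. ring.
Qed.
Lemma isL_scal c f : isL f -> isL (fun s => Cmult c (f s)).
Proof. intro. apply isL_mult; auto. apply isL_isA, isA_const. Qed.
Lemma isL_cpow f n : isL f -> isL (fun s => Defs.Cpow (f s) n).
Proof. intro Hf. induction n; simpl. apply isL_isA, isA_const. now apply isL_mult. Qed.
Lemma isL_negmono k : isL (fun s => cexp (Copp (Cmult (RtoC (INR k)) s))).
Proof. exists k, (fun _ => RtoC 1). split. apply isA_const. intro; ring. Qed.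
Lemma isL_csum (f : nat -> C -> C) N : (forall j, isL (f j)) -> isL (fun s => csum (fun j => f j s) N).
Proof. intro H. induction N; simpl. apply isL_isA, isA_const. apply isL_plus; auto. Qed.

(** The witness replaces conj z by 1/z and conjugates the coefficients. This is conjugation only on
    the unit circle, hence the restriction to points [(0, t)]. *)
Lemma isA_conj f : isA f -> exists g, isL g /\ forall t, g (0, t) = Cconj (f (0, t)).
Proof.
  intros (N & b & Hb). exists (fun s => csum (fun j => Cmult (Cconj (b j)) (cexp (Copp (Cmult (RtoC (INR j)) s)))) N).
  split. apply isL_csum. intro; apply isL_scal, isL_negmono.
  intro t. rewrite Hb. unfold apoly. rewrite <- csum_conj. apply csum_ext. intros.
  rewrite Cmult_conj, cexp_conj. do 2 f_equal. unfold Cmult, Cconj, Copp, RtoC; simpl. f_equal; ring.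
Qed.

Lemma rcont_lin c : rcont (fun t => c * t).
Proof. apply rcont_mult; [apply rcont_const|apply rcont_id]. Qed.
Lemma ccont_line e : ccont (fun t => (e, t)).
Proof. apply ccont_pair; [apply rcont_const|apply rcont_id]. Qed.
Lemma ccont_isA f e : isA f -> ccont (fun t => f (e, t)).
Proof.
  intros (N & b & Hb). apply (ccont_ext (fun t => apoly b N (e, t))). intro; now rewrite Hb.
  apply (ccont_csum (fun j t => Cmult (b j) (cexp (Cmult (RtoC (INR j)) (e, t))))).
  intros. apply ccont_mult. apply ccont_const. apply ccont_cexp, ccont_mult.
  apply ccont_const. apply ccont_line.
Qed.
Lemma ccont_isL f e : isL f -> ccont (fun t => f (e, t)).
Proof.
  intros (K & g & Hg & H). apply (ccont_ext _ _ (fun t => eq_sym (H (e, t)))).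
  apply ccont_mult. apply ccont_cexp, ccont_opp, ccont_mult.
  apply ccont_const. apply ccont_line. now apply ccont_isA.
Qed.

Lemma mean_laurent_mono K j e :
  mean (fun t => Cmult (cexp (Copp (Cmult (RtoC (INR K)) (e, t)))) (cexp (Cmult (RtoC (INR j)) (e, t)))) =
  if Nat.eqb j K then 1 else 0.
Proof.
  rewrite (mean_ext _ (fun t => Cmult (RtoC (exp (IZR (Z.of_nat j - Z.of_nat K) * e))) (eith (IZR (Z.of_nat j - Z.of_nat K) * t)))).
  2:{ intro t. rewrite <- cexp_plus, <- cexp_line. f_equal. rewrite minus_IZR, <- !INR_IZR_INZ, RtoC_minus. ring. }
  rewrite mean_scal by apply ccont_eith, rcont_lin.
  destruct (Nat.eqb_spec j K).
  - subst. rewrite Z.sub_diag, Rmult_0_l, exp_0.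
    rewrite (mean_ext _ (fun _ => RtoC 1)). rewrite mean_const; ring.
    intro; rewrite Rmult_0_l; apply eith_0.
  - rewrite mean_eith_nz by lia. ring.
Qed.

Lemma mean_laurent K b N e :
  mean (fun t => Cmult (cexp (Copp (Cmult (RtoC (INR K)) (e, t)))) (apoly b N (e, t))) =
  csum (fun j => if Nat.eqb j K then b j else 0) N.
Proof.
  rewrite (mean_ext _ (fun t => csum (fun j => Cmult (b j) (Cmult (cexp (Copp (Cmult (RtoC (INR K)) (e, t)))) (cexp (Cmult (RtoC (INR j)) (e, t))))) N)).
  2:{ intro. unfold apoly. rewrite <- csum_mult_l. apply csum_ext. intros; ring. }
  assert (Hc : forall j, ccont (fun t => Cmult (cexp (Copp (Cmult (RtoC (INR K)) (e, t)))) (cexp (Cmult (RtoC (INR j)) (e, t))))).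
  { intro j. apply (ccont_isL (fun s => Cmult (cexp (Copp (Cmult (RtoC (INR K)) s))) (cexp (Cmult (RtoC (INR j)) s)))).
    apply isL_mult. apply isL_negmono. apply isL_isA, isA_mono. }
  rewrite mean_csum by (intros; apply ccont_mult; auto using ccont_const).
  apply csum_ext. intros j _. rewrite mean_scal, mean_laurent_mono by auto.
  destruct (Nat.eqb j K); ring.
Qed.

(** Cauchy's theorem in finite form: on every circle about the origin the mean of a Laurent
    polynomial is its constant coefficient. *)
Lemma isL_mean_shift f e : isL f -> mean (fun t => f (e, t)) = mean (fun t => f (0, t)).
Proof.
  intros (K & g & (N & b & Hb) & H).
  rewrite (mean_ext _ (fun t => Cmult (cexp (Copp (Cmult (RtoC (INR K)) (e, t)))) (apoly b N (e, t)))).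
  2:{ intro; now rewrite H, Hb. } rewrite mean_laurent.
  rewrite (mean_ext _ (fun t => Cmult (cexp (Copp (Cmult (RtoC (INR K)) (0, t)))) (apoly b N (0, t)))).
  2:{ intro; now rewrite H, Hb. } now rewrite mean_laurent.
Qed.

Lemma isA_mean f N b e : (forall s, f s = apoly b N s) ->
  mean (fun t => f (e, t)) = csum (fun j => if Nat.eqb j 0 then b j else 0) N.
Proof.
  intro H. rewrite <- (mean_laurent 0 b N e). apply mean_ext. intro t. rewrite H. change (INR 0) with 0.
  replace (Copp (Cmult 0 (e, t))) with (RtoC 0) by ring. rewrite cexp_0; ring.
Qed.

Lemma isA_mean_zpow k f : isA f -> (0 < k)%nat ->
  mean (fun t => Cmult (cexp (Cmult (RtoC (INR k)) (0, t))) (f (0, t))) = 0.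
Proof.
  intros (N & b & Hb) Hk.
  rewrite (mean_ext _ (fun t => csum (fun j => Cmult (b j) (eith (IZR (Z.of_nat (k + j)) * t))) N)).
  2:{ intro. rewrite Hb. unfold apoly. rewrite <- csum_mult_l. apply csum_ext. intros.
      rewrite <- INR_IZR_INZ, plus_INR, !cexp_line, !Rmult_0_r, exp_0, Rmult_plus_distr_r, eith_plus. ring. }
  rewrite mean_csum by (intros; apply ccont_mult; auto using ccont_const, ccont_eith, rcont_lin).
  rewrite csum_zero. reflexivity. intros. rewrite mean_scal by auto using ccont_eith, rcont_lin.
  rewrite mean_eith_nz by lia. ring.
Qed.

(** The mean of a polynomial in z is its value at z = 0, and evaluation is multiplicative. *)
Lemma isA_mean_mult f g : isA f -> isA g ->
  mean (fun t => Cmult (f (0, t)) (g (0, t))) = Cmult (mean (fun t => f (0, t))) (mean (fun t => g (0, t))).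
Proof.
  intros (N & b & Hb) Hg.
  rewrite (isA_mean f N b 0 Hb).
  rewrite (mean_ext _ (fun t => csum (fun j => Cmult (b j) (Cmult (cexp (Cmult (RtoC (INR j)) (0, t))) (g (0, t)))) N)).
  2:{ intro. rewrite Hb. unfold apoly. rewrite Cmult_comm, <- csum_mult_l. apply csum_ext. intros; ring. }
  assert (Hc : forall j, ccont (fun t => Cmult (cexp (Cmult (RtoC (INR j)) (0, t))) (g (0, t)))).
  { intro j. apply (ccont_isA (fun s => Cmult (cexp (Cmult (RtoC (INR j)) s)) (g s))). now apply isA_zpow. }
  rewrite mean_csum by (intros; apply ccont_mult; auto using ccont_const).
  rewrite Cmult_comm, <- csum_mult_l. apply csum_ext. intros j _. rewrite mean_scal by auto.
  destruct j; cbn [Nat.eqb].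
  - change (INR 0) with 0. rewrite (mean_ext _ (fun t => g (0, t))). ring.
    intro. rewrite Cmult_0_l, cexp_0; ring.
  - rewrite isA_mean_zpow; auto. ring. lia.
Qed.
Lemma isA_mean_cpow f n : isA f -> mean (fun t => Defs.Cpow (f (0, t)) n) = Defs.Cpow (mean (fun t => f (0, t))) n.
Proof.
  intro Hf. induction n; simpl. apply mean_const.
  rewrite (isA_mean_mult f (fun s => Defs.Cpow (f s) n)); auto using isA_cpow. now rewrite IHn.
Qed.

(** Parseval's identity on the circle of radius [exp e]. *)
Lemma nrm2_apoly b N e :
  nrm2 (fun t => apoly b N (e, t)) = rsum (fun j => Cmod (b j) ^ 2 * exp (2 * (INR j * e))) N.
Proof.
  induction N.
  - simpl. rewrite <- (rmean_const 0). apply rmean_ext. intro. unfold apoly; simpl. rewrite Cmod_0. ring.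
  - change (fun t => apoly b (S N) (e, t)) with (fun t => Cplus (apoly b N (e, t)) (Cmult (b N) (cexp (Cmult (RtoC (INR N)) (e, t))))).
    assert (Hc : ccont (fun t => apoly b N (e, t))) by apply ccont_isA, isA_apoly.
    assert (Hd : ccont (fun t => cexp (Cmult (RtoC (INR N)) (e, t)))) by (apply (ccont_isA _ e (isA_mono N))).
    rewrite nrm2_plus; auto using ccont_mult, ccont_const. rewrite IHN, nrm2_scal by auto. simpl rsum.
    replace (nrm2 (fun t => cexp (Cmult (RtoC (INR N)) (e, t)))) with (exp (2 * (INR N * e))).
    2:{ rewrite <- (rmean_const (exp _)). apply rmean_ext. intro. rewrite Cmod_cexp. simpl.
        rewrite Rmult_1_r, <- exp_plus. f_equal. ring. }
    (* On this circle the conjugate of z^N is z^{-N} times [exp (2 N e)]. The cross term thus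
       contains only the frequencies j - N with j < N, and its mean vanishes. *)
    rewrite (mean_ext _ (fun t => Cmult (Cmult (Cconj (b N)) (exp (2 * INR N * e))) (Cmult (cexp (Copp (Cmult (RtoC (INR N)) (e, t)))) (apoly b N (e, t))))).
    + rewrite mean_scal. rewrite mean_laurent. rewrite csum_zero. rewrite Cmult_0_r. simpl. ring.
      intros j Hj. replace (Nat.eqb j N) with false; auto. symmetry. apply Nat.eqb_neq. lia.
      apply (ccont_isL (fun s => Cmult (cexp (Copp (Cmult (RtoC (INR N)) s))) (apoly b N s))).
      apply isL_mult. apply isL_negmono. apply isL_isA, isA_apoly.
    + intro t. rewrite Cmult_conj, cexp_conj.
      replace (cexp (Cconj (Cmult (RtoC (INR N)) (e, t)))) with (Cmult (exp (2 * INR N * e)) (cexp (Copp (Cmult (RtoC (INR N)) (e, t))))). ring.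
      replace (RtoC (exp (2 * INR N * e))) with (cexp (2 * INR N * e, 0)).
      rewrite <- cexp_plus. f_equal. unfold Cplus, Cmult, Cconj, Copp, RtoC; simpl. f_equal; ring.
      unfold cexp, RtoC; simpl. rewrite cos_0, sin_0. f_equal; ring.
Qed.

(** By Parseval, moving inside the disc multiplies each squared coefficient by [exp (2 j e) <= 1].
    This is what makes a contour shift inwards free of cost for the analytic factors. *)
Lemma isA_nrm_shift f e : isA f -> e <= 0 -> nrm (fun t => f (e, t)) <= nrm (fun t => f (0, t)).
Proof.
  intros (N & b & Hb) He. apply sqrt_le_1_alt.
  rewrite (nrm2_ext _ (fun t => apoly b N (e, t))) by (intro; apply Hb).
  rewrite (nrm2_ext (fun t => f (0, t)) (fun t => apoly b N (0, t))) by (intro; apply Hb).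
  rewrite !nrm2_apoly. apply rsum_le. intros j _. apply Rmult_le_compat_l. apply pow2_ge_0.
  rewrite Rmult_0_r, Rmult_0_r.
  destruct (Rle_lt_or_eq_dec (2 * (INR j * e)) 0) as [H|H].
  generalize (pos_INR j); nra. left; now apply exp_increasing. rewrite H; lra.
Qed.

(** The three summands collect the frequencies below 0, in [0, n-1], and from n on. Pulling out
    [eith t] under the conjugate makes the first one strictly negative, hence of mean zero. *)
Lemma isL_split f n : isL f -> exists al be c, isA al /\ isA be /\
  forall t, f (0, t) = Cplus (Cplus (Cconj (Cmult (eith t) (al (0, t))))
     (csum (fun j => Cmult (c j) (eith (INR j * t))) n)) (Cmult (eith (INR n * t)) (be (0, t))).
Proof.
  intros (K & g & (N & b & Hb) & H).
  assert (H' : forall t, f (0, t) = csum (fun j => Cmult (b j) (eith ((INR j - INR K) * t))) N).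
  { intro t. rewrite H, Hb. unfold apoly. rewrite <- csum_mult_l. apply csum_ext. intros.
    replace (Copp (Cmult (RtoC (INR K)) (0, t))) with (Cmult (RtoC (- INR K)) (0, t)) by (rewrite RtoC_opp; ring).
    rewrite !cexp_line0. replace ((INR j - INR K) * t) with (- INR K * t + INR j * t) by ring.
    rewrite eith_plus. ring. }
  clear g Hb H. revert f H'. induction N; intros f Hf.
  - exists (fun _ => RtoC 0), (fun _ => RtoC 0), (fun _ => RtoC 0). split; [apply isA_const|]. split; [apply isA_const|].
    intro. rewrite Hf. simpl. rewrite (csum_zero (fun j : nat => Cmult 0 _)). 2: intros; ring.
    rewrite !Cmult_0_r. unfold Cconj, Cplus, RtoC; simpl; f_equal; ring.
  - destruct (IHN (fun s => csum (fun j => Cmult (b j) (eith ((INR j - INR K) * snd s))) N)) as (al & be & c & Ha & Hb & Hc).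
    { intro; reflexivity. }
    (* The added monomial has frequency N - K, and the case distinction decides which summand
       receives it. In the negative case the exponent is K - N - 1 because one factor [eith t]
       stands outside [al]. *)
    destruct (Compare_dec.le_lt_dec K N) as [HK|HK]; [destruct (Compare_dec.le_lt_dec (K + n) N) as [HK2|HK2]|].
    + exists al, (fun s => Cplus (be s) (Cmult (b N) (cexp (Cmult (RtoC (INR (N - K - n))) s)))), c.
      split; auto. split. apply isA_plus; auto. apply isA_scal, isA_mono.
      intro t. rewrite Hf. simpl csum at 1. simpl in Hc. rewrite Hc. rewrite cexp_line, Rmult_0_r, exp_0.
      replace (eith ((INR N - INR K) * t)) with (Cmult (eith (INR n * t)) (eith (INR (N - K - n) * t))). ring.
      rewrite <- eith_plus. f_equal. rewrite !minus_INR by lia. ring.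
    + exists al, be, (fun j => Cplus (c j) (if Nat.eqb j (N - K) then b N else 0)).
      split; auto. split; auto.
      intro t. rewrite Hf. simpl csum at 1. simpl in Hc. rewrite Hc.
      assert (E : forall M, csum (fun j => Cmult (Cplus (c j) (if Nat.eqb j (N - K) then b N else 0)) (eith (INR j * t))) M =
         Cplus (csum (fun j => Cmult (c j) (eith (INR j * t))) M) (if Nat.ltb (N - K) M then Cmult (b N) (eith (INR (N - K) * t)) else 0)).
      { induction M; simpl. ring. rewrite IHM.
        destruct (Nat.eqb_spec M (N - K)).
        - subst M. rewrite Nat.ltb_irrefl. replace (Nat.ltb (N - K) (S (N - K))) with true by (symmetry; apply Nat.ltb_lt; lia). ring.
        - replace (Nat.ltb (N - K) (S M)) with (Nat.ltb (N - K) M). ring.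
          destruct (Nat.ltb_spec (N - K) M), (Nat.ltb_spec (N - K) (S M)); auto; lia. }
      rewrite E. replace (Nat.ltb (N - K) n) with true by (symmetry; apply Nat.ltb_lt; lia).
      rewrite minus_INR by lia. ring.
    + exists (fun s => Cplus (al s) (Cmult (Cconj (b N)) (cexp (Cmult (RtoC (INR (K - N - 1))) s)))), be, c.
      split. apply isA_plus; auto. apply isA_scal, isA_mono. split; auto.
      intro t. rewrite Hf. simpl csum at 1. simpl in Hc. rewrite Hc. rewrite cexp_line, Rmult_0_r, exp_0.
      replace (eith ((INR N - INR K) * t)) with (Cmult (Cconj (eith t)) (Cconj (eith (INR (K - N - 1) * t)))).
      rewrite !Cmult_conj, Cplus_conj, !Cmult_conj, Cconj_conj.
      replace (Cconj (RtoC 1)) with (RtoC 1) by (unfold Cconj, RtoC; simpl; f_equal; ring). ring.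
      rewrite !eith_conj, <- eith_plus. f_equal. rewrite !minus_INR by lia. simpl. ring.
Qed.

(** * Exponentials and contour shift *)

Lemma exp_taylor2 x : Rabs x <= 1 / 2 -> Rabs (exp x - 1 - x) <= 2 * x ^ 2.
Proof.
  intro H. apply Rabs_le_between in H. generalize (exp_ineq1_le x) (exp_ineq1_le (- x)). intros H1 H2.
  rewrite exp_Ropp in H2. generalize (exp_pos x); intro Hp.
  assert (H3 : exp x * (1 - x) <= 1).
  { replace 1 with (exp x * / exp x) at 2 by (field; lra). apply Rmult_le_compat_l; lra. }
  apply Rabs_le. nra.
Qed.
Lemma Rabs_sin_le x : Rabs (sin x) <= Rabs x.
Proof.
  destruct (MVT_gen sin 0 x cos) as (c & _ & H).
  - intros; apply is_derive_Reals, derivable_pt_lim_sin.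
  - intros; apply continuity_sin.
  - rewrite sin_0, !Rminus_0_r in H. rewrite H, Rabs_mult.
    rewrite <- (Rmult_1_l (Rabs x)) at 2. apply Rmult_le_compat_r. apply Rabs_pos.
    apply Rabs_le. generalize (COS_bound c); lra.
Qed.
Lemma one_minus_cos x : 1 - cos x <= x ^ 2 / 2.
Proof.
  replace x with (2 * (x / 2)) at 1 by field. rewrite cos_2a_sin.
  generalize (Rabs_sin_le (x / 2)). intro H. apply Rsqr_le_abs_1 in H. unfold Rsqr in H. lra.
Qed.
Lemma sin_taylor2 x : Rabs x <= 1 -> Rabs (sin x - x) <= x ^ 2.
Proof.
  intro Hx. destruct (MVT_gen (fun y => sin y - y) 0 x (fun y => cos y - 1)) as (c & Hc & H).
  - intros; auto_derive; auto; ring.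
  - intros; apply continuity_pt_minus. apply continuity_sin. apply continuity_pt_id.
  - rewrite sin_0, !Rminus_0_r in H. rewrite H, Rabs_mult.
    assert (H1 : Rabs (cos c - 1) <= c ^ 2 / 2).
    { apply Rabs_le. generalize (one_minus_cos c) (COS_bound c) (pow2_ge_0 c); lra. }
    assert (H2 : Rabs c <= Rabs x).
    { revert Hc. unfold Rmin, Rmax, Rabs. repeat destruct Rle_dec; repeat destruct Rcase_abs; lra. }
    rewrite <- (pow2_abs x), <- (pow2_abs c) in *.
    generalize (Rabs_pos x) (Rabs_pos c) (Rabs_pos (cos c - 1)). intros. nra.
Qed.
Lemma Cmod_le_abs (z : C) : Cmod z <= Rabs (Re z) + Rabs (Im z).
Proof.
  apply Rsqr_incr_0_var. 2: generalize (Rabs_pos (Re z)) (Rabs_pos (Im z)); lra.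
  rewrite !Rsqr_pow2, Cmod_sqr. generalize (Rabs_pos (Re z)) (Rabs_pos (Im z)). intros.
  replace (Re z * Re z) with (Rabs (Re z) ^ 2) by (rewrite pow2_abs; ring).
  replace (Im z * Im z) with (Rabs (Im z) ^ 2) by (rewrite pow2_abs; ring). nra.
Qed.
Lemma im_le_Cmod (z : C) : Rabs (Im z) <= Cmod z.
Proof. eapply Rle_trans; [apply Rmax_r|apply Rmax_Cmod]. Qed.
Lemma cexp_taylor2 s : Cmod s <= 1 / 2 -> Cmod (Cminus (Cminus (cexp s) 1) s) <= 9 * Cmod s ^ 2.
Proof.
  destruct s as [x y]. intro H.
  pose proof (re_le_Cmod (x, y)) as Hx. pose proof (im_le_Cmod (x, y)) as Hy.
  change (Re (x, y)) with x in Hx. change (Im (x, y)) with y in Hy.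
  generalize (exp_taylor2 x ltac:(lra)) (sin_taylor2 y ltac:(lra)) (one_minus_cos y) (COS_bound y) (Rabs_sin_le y).
  intros H1 H2 H3 H4 H5. rewrite Cmod_sqr. simpl.
  assert (H6 : Rabs (exp x - 1) <= 2 * Rabs x).
  { replace (exp x - 1) with ((exp x - 1 - x) + x) by ring. eapply Rle_trans. apply Rabs_triang.
    rewrite <- (pow2_abs x) in H1. generalize (Rabs_pos x). nra. }
  eapply Rle_trans. apply Cmod_le_abs. simpl.
  assert (H7 : Rabs (exp x * cos y + - (1) + - x) <= 2 * x ^ 2 + y ^ 2).
  { replace (exp x * cos y + - (1) + - x) with ((exp x - 1 - x) * cos y + (1 + x) * (cos y - 1)) by ring.
    eapply Rle_trans. apply Rabs_triang. rewrite !Rabs_mult. apply Rplus_le_compat.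
    - rewrite <- (Rmult_1_r (2 * x ^ 2)). apply Rmult_le_compat; auto using Rabs_pos. apply Rabs_le; lra.
    - apply Rle_trans with (2 * (y ^ 2 / 2)); [|lra]. apply Rmult_le_compat; auto using Rabs_pos.
      apply Rabs_le. apply Rabs_le_between in Hx. lra. apply Rabs_le. generalize (pow2_ge_0 y); lra. }
  assert (H8 : Rabs (exp x * sin y + - 0 + - y) <= 2 * Rabs x * Rabs y + y ^ 2).
  { replace (exp x * sin y + - 0 + - y) with ((exp x - 1) * sin y + (sin y - y)) by ring.
    eapply Rle_trans. apply Rabs_triang. rewrite Rabs_mult. apply Rplus_le_compat; auto.
    apply Rmult_le_compat; auto using Rabs_pos. }
  rewrite <- (pow2_abs x), <- (pow2_abs y) in *. replace (x * x) with (Rabs x ^ 2) by (rewrite pow2_abs; ring).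
  replace (y * y) with (Rabs y ^ 2) by (rewrite pow2_abs; ring).
  generalize (pow2_ge_0 (Rabs x - Rabs y)) (pow2_ge_0 (Rabs x)) (pow2_ge_0 (Rabs y)). intros. unfold Re, Im in *; simpl in *. lra.
Qed.
Lemma cexp_minus_1 s : Cmod s <= 1 / 2 -> Cmod (Cminus (cexp s) 1) <= 6 * Cmod s.
Proof.
  intro H. replace (Cminus (cexp s) 1) with (Cplus (Cminus (Cminus (cexp s) 1) s) s) by ring.
  eapply Rle_trans. apply Cmod_triangle. generalize (cexp_taylor2 s H) (Cmod_ge_0 s). nra.
Qed.
Lemma cexp_lipschitz u v : Cmod (Cminus u v) <= 1 / 2 ->
  Cmod (Cminus (cexp u) (cexp v)) <= exp (Cmod v) * (6 * Cmod (Cminus u v)).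
Proof.
  intro H. replace (cexp u) with (Cmult (cexp v) (cexp (Cminus u v))).
  2:{ rewrite <- cexp_plus. f_equal. ring. }
  replace (Cminus _ (cexp v)) with (Cmult (cexp v) (Cminus (cexp (Cminus u v)) 1)) by ring.
  rewrite Cmod_mult, Cmod_cexp. apply Rmult_le_compat; auto using Cmod_ge_0.
  left; apply exp_pos. apply Rle_trans with (exp (Rabs (Re v))).
  - destruct (Rle_abs (Re v)) as [h|h]; [left; now apply exp_increasing|rewrite <- h; lra].
  - destruct (re_le_Cmod v) as [h|h]; [left; now apply exp_increasing|rewrite h; lra].
  - now apply cexp_minus_1.
Qed.
Lemma exp_le_le x y : x <= y -> exp x <= exp y.
Proof. intros [h|h]; [left; now apply exp_increasing|subst; lra]. Qed.

Lemma exp_INR_mult n x : exp (INR n * x) = exp x ^ n.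
Proof.
  induction n. simpl. now rewrite Rmult_0_l, exp_0.
  rewrite S_INR, Rmult_plus_distr_r, exp_plus, IHn, Rmult_1_l. simpl. ring.
Qed.
Lemma Cmod_cpow z n : Cmod (Defs.Cpow z n) = Cmod z ^ n.
Proof. induction n; simpl. apply Cmod_1. now rewrite Cmod_mult, IHn. Qed.
Lemma cpow_diff a b M n : 1 <= M -> Cmod a <= M -> Cmod b <= M ->
  Cmod (Cminus (Defs.Cpow a n) (Defs.Cpow b n)) <= INR n * Cmod (Cminus a b) * M ^ n.
Proof.
  intros HM Ha Hb. induction n.
  - simpl. replace (Cminus 1 1) with (RtoC 0) by ring. rewrite Cmod_0. lra.
  - simpl Defs.Cpow. replace (Cminus _ _) with (Cplus (Cmult a (Cminus (Defs.Cpow a n) (Defs.Cpow b n))) (Cmult (Cminus a b) (Defs.Cpow b n))) by ring.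
    eapply Rle_trans. apply Cmod_triangle. rewrite !Cmod_mult, Cmod_cpow, S_INR. simpl pow.
    assert (0 <= M ^ n) by (apply pow_le; lra).
    assert (Cmod b ^ n <= M ^ n) by (apply pow_incr; split; auto using Cmod_ge_0).
    generalize (Cmod_ge_0 (Cminus a b)) (Cmod_ge_0 a) (Cmod_ge_0 (Cminus (Defs.Cpow a n) (Defs.Cpow b n))) (pos_INR n). intros.
    apply Rle_trans with (M * (INR n * Cmod (Cminus a b) * M ^ n) + Cmod (Cminus a b) * (M * M ^ n)).
    + apply Rplus_le_compat. apply Rmult_le_compat; auto. apply Rmult_le_compat_l; auto. nra.
    + lra.
Qed.
Lemma cexp_INR_cpow n w : cexp (Cmult (RtoC (INR n)) w) = Defs.Cpow (cexp w) n.
Proof. induction n. simpl. now rewrite Cmult_0_l, cexp_0. rewrite cexp_INR_S, IHn. reflexivity. Qed.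

(** Euler's approximation (1 + w/N)^N of the exponential. Unlike the exponential it maps polynomials
    to polynomials and Laurent polynomials to Laurent polynomials, and it sends a polynomial
    vanishing at the origin to one with value 1 there. *)
Definition euler_step (N : nat) (w : C) : C := Defs.Cpow (Cplus 1 (Cmult (RtoC (/ INR N)) w)) N.

(** Both sides are N-th powers, of e^{w/N} and of 1 + w/N. The bases differ by at most 9 |w/N|^2 and
    have modulus at most e^{|w|/N}, so telescoping leaves an error of order 1/N. *)
Lemma euler_limit R0 eps : 0 <= R0 -> 0 < eps -> exists N, (1 <= N)%nat /\
  forall w, Cmod w <= R0 -> Cmod (Cminus (cexp w) (euler_step N w)) <= eps.
Proof.
  intros HR He. set (K := 9 * R0 ^ 2 * exp R0).
  assert (HK : 0 <= K) by (unfold K; generalize (exp_pos R0) (pow2_ge_0 R0); nra).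
  (* The term [2 * R0] keeps |w/N| below 1/2, as the Taylor bound requires; [K / eps] brings the
     final error [K / N] below [eps]. *)
  destruct (nfloor_ex (2 * R0 + K / eps) ) as (N0 & _ & HN0).
  { assert (0 <= K / eps). apply Rmult_le_pos; auto. left; now apply Rinv_0_lt_compat. lra. }
  exists (S N0). split. lia. intros w Hw. rewrite <- S_INR in HN0. set (N := S N0) in *.
  assert (HN : 0 < INR N) by (apply lt_0_INR; lia).
  assert (Hi : 0 < / INR N) by now apply Rinv_0_lt_compat.
  assert (HKe : 0 <= K / eps) by (apply Rmult_le_pos; auto; left; now apply Rinv_0_lt_compat).
  set (v := Cmult (RtoC (/ INR N)) w).
  assert (Hv : Cmod v = / INR N * Cmod w).
  { unfold v. rewrite Cmod_mult, Cmod_R, Rabs_right; lra. }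
  assert (Ew : cexp w = Defs.Cpow (cexp v) N).
  { rewrite <- cexp_INR_cpow. f_equal. unfold v. rewrite Cmult_assoc, <- RtoC_mult, Rinv_r by lra. ring. }
  assert (Hv2 : Cmod v <= 1 / 2).
  { rewrite Hv. apply Rmult_le_reg_l with (INR N); auto. rewrite <- Rmult_assoc, Rinv_r by lra. lra. }
  rewrite Ew. unfold euler_step. fold v.
  assert (Hm : Cmod v * INR N = Cmod w) by (rewrite Hv; field; lra).
  eapply Rle_trans. apply (cpow_diff _ _ (exp (Cmod v))).
  - rewrite <- exp_0. apply exp_le_le, Cmod_ge_0.
  - rewrite Cmod_cexp. apply exp_le_le. eapply Rle_trans. apply Rle_abs. apply re_le_Cmod.
  - eapply Rle_trans. apply Cmod_triangle. rewrite Cmod_1. apply exp_ineq1_le.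
  - replace (exp (Cmod v) ^ N) with (exp (Cmod w)).
    2:{ rewrite <- Hm, Rmult_comm. apply exp_INR_mult. }
    replace (Cminus (cexp v) (Cplus 1 v)) with (Cminus (Cminus (cexp v) 1) v) by ring.
    generalize (cexp_taylor2 v Hv2). intro H.
    apply Rle_trans with (INR N * (9 * Cmod v ^ 2) * exp R0).
    { apply Rmult_le_compat. apply Rmult_le_pos; auto using Cmod_ge_0. lra. left; apply exp_pos.
      apply Rmult_le_compat_l; lra. now apply exp_le_le. }
    apply Rle_trans with (K / INR N).
    { rewrite Hv. unfold K. replace (INR N * (9 * (/ INR N * Cmod w) ^ 2) * exp R0) with (9 * Cmod w ^ 2 * exp R0 / INR N) by (field; lra).
      apply Rmult_le_compat_r; [lra|]. apply Rmult_le_compat_r. left; apply exp_pos.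
      apply Rmult_le_compat_l. lra. apply pow_incr. split; auto using Cmod_ge_0. }
    apply Rmult_le_reg_r with (INR N); auto. unfold Rdiv. rewrite Rmult_assoc, Rinv_l, Rmult_1_r by lra.
    apply Rle_trans with (eps * (K / eps)). right; field; lra. apply Rmult_le_compat_l; lra.
Qed.

Definition cbounded (f : R -> C) : Prop := exists B, 0 <= B /\ forall t, Cmod (f t) <= B.

Lemma cbounded_plus f g : cbounded f -> cbounded g -> cbounded (fun t => Cplus (f t) (g t)).
Proof.
  intros (B & HB & Hf) (D & HD & Hg). exists (B + D). split. lra. intro.
  eapply Rle_trans. apply Cmod_triangle. generalize (Hf t) (Hg t); lra.
Qed.
Lemma cbounded_mult f g : cbounded f -> cbounded g -> cbounded (fun t => Cmult (f t) (g t)).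
Proof.
  intros (B & HB & Hf) (D & HD & Hg). exists (B * D). split. nra. intro.
  rewrite Cmod_mult. apply Rmult_le_compat; auto using Cmod_ge_0.
Qed.
Lemma cbounded_const c : cbounded (fun _ => c).
Proof. exists (Cmod c). split. apply Cmod_ge_0. intro; lra. Qed.
Lemma cbounded_conj f : cbounded f -> cbounded (fun t => Cconj (f t)).
Proof. intros (B & HB & Hf). exists B. split; auto. intro; now rewrite Cmod_conj. Qed.
Lemma cbounded_cexp f : cbounded f -> cbounded (fun t => cexp (f t)).
Proof.
  intros (B & HB & Hf). exists (exp B). split. left; apply exp_pos. intro. rewrite Cmod_cexp.
  apply exp_le_le. eapply Rle_trans. apply Rle_abs. eapply Rle_trans. apply re_le_Cmod. auto.
Qed.
Lemma cbounded_ext f g : (forall t, f t = g t) -> cbounded f -> cbounded g.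
Proof. intros H (B & HB & Hf). exists B. split; auto. intro; now rewrite <- H. Qed.
Lemma cbounded_mono x e : cbounded (fun t => cexp (Cmult (RtoC x) (e, t))).
Proof.
  exists (exp (x * e)). split. left; apply exp_pos. intro. rewrite Cmod_cexp. simpl. right. f_equal. ring.
Qed.
Lemma cbounded_isA f e : isA f -> cbounded (fun t => f (e, t)).
Proof.
  intros (N & b & Hb). apply (cbounded_ext (fun t => apoly b N (e, t))). intro; now rewrite Hb.
  unfold apoly. clear. induction N; simpl. apply cbounded_const.
  apply cbounded_plus; auto. apply cbounded_mult. apply cbounded_const. apply cbounded_mono.
Qed.
Lemma cbounded_isL f e : isL f -> cbounded (fun t => f (e, t)).
Proof.
  intros (K & g & Hg & H). apply (cbounded_ext _ _ (fun t => eq_sym (H (e, t)))).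
  apply cbounded_mult. apply (cbounded_ext (fun t => cexp (Cmult (RtoC (- INR K)) (e, t)))).
  intro. f_equal. rewrite RtoC_opp. ring. apply cbounded_mono. now apply cbounded_isA.
Qed.

Lemma Cmod_mean_le f B : ccont f -> 0 <= B -> (forall t, Cmod (f t) <= B) -> Cmod (mean f) <= B.
Proof. intros. eapply Rle_trans. now apply mean_le_nrm. now apply nrm_le_sup. Qed.
Lemma Cminus_eq (a b : C) : Cminus a b = 0 -> a = b.
Proof. intro H. replace a with (Cplus (Cminus a b) b) by ring. rewrite H. ring. Qed.
Lemma Ceq_eps (a b : C) K : (forall eps, 0 < eps -> Cmod (Cminus a b) <= K * eps) -> a = b.
Proof.
  intro H. apply Cminus_eq, Cmod_eq_0. apply Rle_antisym; [|apply Cmod_ge_0].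
  apply le_epsilon. intros e He. rewrite Rplus_0_l.
  set (K' := Rmax K 1). assert (1 <= K') by apply Rmax_r. assert (K <= K') by apply Rmax_l.
  eapply Rle_trans. apply (H (e / K')). apply Rmult_lt_0_compat; auto. apply Rinv_0_lt_compat; lra.
  apply Rle_trans with (K' * (e / K')).
  - apply Rmult_le_compat_r; auto. apply Rmult_le_pos. lra. left; apply Rinv_0_lt_compat; lra.
  - right. field. lra.
Qed.

(* Contour shift: both sides are limits of means of the Laurent polynomials [euler_step N W * f]. *)
Lemma mean_cexp_shift W f e : isL W -> isL f ->
  mean (fun t => Cmult (cexp (W (e, t))) (f (e, t))) = mean (fun t => Cmult (cexp (W (0, t))) (f (0, t))).
Proof.
  intros HW Hf.
  destruct (cbounded_isL _ e HW) as (B1 & HB1 & H1). destruct (cbounded_isL _ 0 HW) as (B2 & HB2 & H2).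
  destruct (cbounded_isL _ e Hf) as (D1 & HD1 & H3). destruct (cbounded_isL _ 0 Hf) as (D2 & HD2 & H4).
  apply (Ceq_eps _ _ (D1 + D2)). intros eps He.
  destruct (euler_limit (Rmax B1 B2) eps) as (N & _ & HN); auto.
  { apply Rle_trans with B1; auto. apply Rmax_l. }
  set (g := fun s => Cmult (euler_step N (W s)) (f s)).
  assert (Hg : isL g).
  { apply isL_mult; auto. apply (isL_cpow (fun s => Cplus 1 (Cmult (RtoC (/ INR N)) (W s)))).
    apply isL_plus. apply isL_isA, isA_const. now apply isL_scal. }
  assert (A : forall x B D, 0 <= D -> B <= Rmax B1 B2 -> (forall t, Cmod (W (x, t)) <= B) -> (forall t, Cmod (f (x, t)) <= D) ->
     Cmod (Cminus (mean (fun t => Cmult (cexp (W (x, t))) (f (x, t)))) (mean (fun t => g (x, t)))) <= eps * D).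
  { intros x B D HD HB HBx HDx.
    assert (C1 : ccont (fun t => Cmult (cexp (W (x, t))) (f (x, t)))).
    { apply ccont_mult. apply ccont_cexp. now apply ccont_isL. now apply ccont_isL. }
    rewrite <- mean_minus; auto using ccont_isL.
    apply Cmod_mean_le. apply ccont_minus; auto using ccont_isL. apply Rmult_le_pos; lra.
    intro t. unfold g. replace (Cminus _ _) with (Cmult (Cminus (cexp (W (x, t))) (euler_step N (W (x, t)))) (f (x, t))) by ring.
    rewrite Cmod_mult. apply Rmult_le_compat; auto using Cmod_ge_0. apply HN. eapply Rle_trans. apply HBx. auto. }
  generalize (A e B1 D1 HD1 (Rmax_l _ _) H1 H3) (A 0 B2 D2 HD2 (Rmax_r _ _) H2 H4). intros A1 A2.
  rewrite (isL_mean_shift g e) in A1 by auto.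
  revert A1 A2. generalize (mean (fun t => g (0, t))) (mean (fun t => Cmult (cexp (W (e, t))) (f (e, t))))
    (mean (fun t => Cmult (cexp (W (0, t))) (f (0, t)))). intros m2 m1 m3 A1 A2.
  replace (Cminus m1 m3) with (Cplus (Cminus m1 m2) (Copp (Cminus m3 m2))) by ring.
  eapply Rle_trans. apply Cmod_triangle. rewrite Cmod_opp. lra.
Qed.

(* Boundary values of the disc algebra that vanish at the origin. *)
Definition disc0 (F : R -> C) : Prop := ccont F /\ cbounded F /\
  forall eps, 0 < eps -> exists G, isA G /\ mean (fun t => G (0, t)) = 0 /\
    forall t, Cmod (Cminus (F t) (G (0, t))) <= eps.

Lemma cpow_1 n : Defs.Cpow 1 n = 1.
Proof. induction n; simpl; auto. rewrite IHn. ring. Qed.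

(** [Q] is an Euler step of [a G], where the polynomial [G] approximates [F]. Since [G] vanishes at
    the origin and means are multiplicative, [Q] has mean exactly 1, with no error from the
    approximation. *)
Lemma disc0_cexp F (a : R) eps : disc0 F -> 0 < eps -> exists Q, isA Q /\
  mean (fun t => Q (0, t)) = 1 /\ forall t, Cmod (Cminus (cexp (Cmult a (F t))) (Q (0, t))) <= eps.
Proof.
  intros (Hc & (B & HB & HFB) & HF) He.
  set (R0 := Rabs a * B + 1). assert (HR0 : 1 <= R0).
  { unfold R0. generalize (Rabs_pos a). nra. }
  generalize (exp_pos R0); intro Hep.
  (* The bound 1/2 allows [cexp_lipschitz] and keeps [a G] within radius [R0]; the other bound makes
     the error [6 d exp R0] of replacing [F] by [G] at most eps/2. *)
  set (d := Rmin (1 / 2) (eps / (12 * exp R0))).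
  assert (Hd : 0 < d). { unfold d. apply Rmin_pos. lra. apply Rmult_lt_0_compat; auto. apply Rinv_0_lt_compat. lra. }
  assert (Hd1 : d <= 1 / 2) by apply Rmin_l. assert (Hd2 : d <= eps / (12 * exp R0)) by apply Rmin_r.
  destruct (HF (d / (Rabs a + 1))) as (G & HG & HG0 & HGF).
  { apply Rmult_lt_0_compat; auto. apply Rinv_0_lt_compat. generalize (Rabs_pos a); lra. }
  destruct (euler_limit R0 (eps / 2)) as (N & HN1 & HN). lra. lra.
  assert (HNp : 0 < INR N) by (apply lt_0_INR; lia).
  exists (fun s => euler_step N (Cmult a (G s))).
  assert (HA : isA (fun s => Cplus 1 (Cmult (RtoC (/ INR N)) (Cmult a (G s))))).
  { apply isA_plus. apply isA_const. apply isA_scal. now apply isA_scal. }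
  split; [|split].
  - exact (isA_cpow _ N HA).
  - unfold euler_step. rewrite (isA_mean_cpow _ N HA).
    rewrite mean_plus, mean_const, mean_scal, mean_scal, HG0; auto using ccont_const, ccont_mult, ccont_isA.
    rewrite !Cmult_0_r, Cplus_0_r. apply cpow_1.
  - intro t.
    assert (H1 : Cmod (Cminus (Cmult a (F t)) (Cmult a (G (0, t)))) <= d).
    { replace (Cminus _ _) with (Cmult a (Cminus (F t) (G (0, t)))) by ring. rewrite Cmod_mult, Cmod_R.
      generalize (Rabs_pos a); intro Ha.
      apply Rle_trans with ((Rabs a + 1) * (d / (Rabs a + 1))).
      apply Rmult_le_compat; auto using Cmod_ge_0. lra. right; field; lra. }
    assert (H2 : Cmod (Cmult a (G (0, t))) <= R0).
    { replace (Cmult a (G (0, t))) with (Cplus (Cmult a (F t)) (Copp (Cminus (Cmult a (F t)) (Cmult a (G (0, t)))))) by ring.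
      eapply Rle_trans. apply Cmod_triangle. rewrite Cmod_opp, Cmod_mult, Cmod_R. unfold R0.
      apply Rplus_le_compat. apply Rmult_le_compat_l; auto. apply Rabs_pos. lra. }
    replace (Cminus (cexp (Cmult a (F t))) (euler_step N (Cmult a (G (0, t))))) with (Cplus (Cminus (cexp (Cmult a (F t))) (cexp (Cmult a (G (0, t)))))
      (Cminus (cexp (Cmult a (G (0, t)))) (euler_step N (Cmult a (G (0, t)))))) by ring.
    eapply Rle_trans. apply Cmod_triangle. replace eps with (eps / 2 + eps / 2) by field.
    apply Rplus_le_compat; [|now apply HN].
    eapply Rle_trans. apply cexp_lipschitz. lra.
    apply Rle_trans with (exp R0 * (6 * d)).
    apply Rmult_le_compat. left; apply exp_pos. generalize (Cmod_ge_0 (Cminus (Cmult a (F t)) (Cmult a (G (0, t))))); lra.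
    now apply exp_le_le. lra.
    apply Rle_trans with (exp R0 * (6 * (eps / (12 * exp R0)))).
    apply Rmult_le_compat_l. lra. lra. right. field. lra.
Qed.

(** * Hardy spaces twisted by a phase *)

Lemma isL_conj f : isL f -> exists g, isL g /\ forall t, g (0, t) = Cconj (f (0, t)).
Proof.
  intros (K & a & Ha & H). destruct (isA_conj a Ha) as (b & Hb & Hab).
  exists (fun s => Cmult (cexp (Cmult (RtoC (INR K)) s)) (b s)). split.
  apply isL_mult; auto. apply isL_isA, isA_mono.
  intro t. rewrite H, Cmult_conj, Hab, cexp_conj. do 2 f_equal.
  unfold Cmult, Cconj, Copp, RtoC; simpl. f_equal; ring.
Qed.

(** The uniform closure of the trigonometric polynomials, that is, the continuous functions of
    period 2 pi. The approximation clause is the form used later, and the explicit bound allows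
    products to be estimated without a compactness argument. *)
Definition trig_limit (f : R -> C) : Prop := ccont f /\ cbounded f /\
  forall eps, 0 < eps -> exists T, isL T /\ forall t, Cmod (Cminus (f t) (T (0, t))) <= eps.

Lemma trig_limit_ext f g : (forall t, f t = g t) -> trig_limit f -> trig_limit g.
Proof.
  intros H (H1 & H2 & H3). split; [|split].
  - now apply (ccont_ext f).
  - now apply (cbounded_ext f).
  - intros eps He. destruct (H3 eps He) as (T & HT & HT'). exists T. split; auto. intro; now rewrite <- H.
Qed.
Lemma trig_limit_isL T f : isL T -> (forall t, f t = T (0, t)) -> trig_limit f.
Proof.
  intros HT H. split; [|split].
  - apply (ccont_ext (fun t => T (0, t))); auto. now apply ccont_isL.
  - apply (cbounded_ext (fun t => T (0, t))); auto. now apply cbounded_isL.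
  - intros eps He. exists T. split; auto. intro. rewrite H. replace (Cminus _ _) with (RtoC 0) by ring. rewrite Cmod_0. lra.
Qed.
Lemma trig_limit_const c : trig_limit (fun _ => c).
Proof. apply (trig_limit_isL (fun _ => c)); auto. apply isL_isA, isA_const. Qed.
Lemma trig_limit_conj f : trig_limit f -> trig_limit (fun t => Cconj (f t)).
Proof.
  intros (H1 & H2 & H3). split; [|split]; auto using ccont_conj, cbounded_conj.
  intros eps He. destruct (H3 eps He) as (T & HT & HT'). destruct (isL_conj T HT) as (S & HS & HS').
  exists S. split; auto. intro. now rewrite HS', <- Cminus_conj, Cmod_conj.
Qed.
Lemma trig_limit_plus f g : trig_limit f -> trig_limit g -> trig_limit (fun t => Cplus (f t) (g t)).
Proof.
  intros (H1 & H2 & H3) (G1 & G2 & G3). split; [|split]; auto using ccont_plus, cbounded_plus.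
  intros eps He. destruct (H3 (eps / 2)) as (T & HT & HT'). lra. destruct (G3 (eps / 2)) as (S & HS & HS'). lra.
  exists (fun s => Cplus (T s) (S s)). split. now apply isL_plus. intro.
  replace (Cminus _ _) with (Cplus (Cminus (f t) (T (0, t))) (Cminus (g t) (S (0, t)))) by ring.
  eapply Rle_trans. apply Cmod_triangle. generalize (HT' t) (HS' t). lra.
Qed.
Lemma trig_limit_mult f g : trig_limit f -> trig_limit g -> trig_limit (fun t => Cmult (f t) (g t)).
Proof.
  intros (H1 & H2 & H3) (G1 & G2 & G3). split; [|split]; auto using ccont_mult, cbounded_mult.
  intros eps He. destruct H2 as (B & HB & HfB). destruct G2 as (D & HD & HgD).
  (* [d <= 1] bounds the approximant of [g] by [D + 1]; the product error is then at most
     [(B + D + 1) * d]. *)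
  set (d := Rmin 1 (eps / (B + D + 1))).
  assert (Hd : 0 < d). { apply Rmin_pos. lra. apply Rmult_lt_0_compat; auto. apply Rinv_0_lt_compat; lra. }
  assert (Hd1 : d <= 1) by apply Rmin_l. assert (Hd2 : d <= eps / (B + D + 1)) by apply Rmin_r.
  destruct (H3 d Hd) as (T & HT & HT'). destruct (G3 d Hd) as (S & HS & HS').
  exists (fun s => Cmult (T s) (S s)). split. now apply isL_mult. intro.
  replace (Cminus _ _) with (Cplus (Cmult (f t) (Cminus (g t) (S (0, t)))) (Cmult (S (0, t)) (Cminus (f t) (T (0, t))))) by ring.
  assert (HSb : Cmod (S (0, t)) <= D + 1).
  { replace (S (0, t)) with (Cplus (g t) (Copp (Cminus (g t) (S (0, t))))) by ring.
    eapply Rle_trans. apply Cmod_triangle. rewrite Cmod_opp. generalize (HgD t) (HS' t). lra. }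
  eapply Rle_trans. apply Cmod_triangle. rewrite !Cmod_mult.
  apply Rle_trans with (B * d + (D + 1) * d).
  - apply Rplus_le_compat; apply Rmult_le_compat; auto using Cmod_ge_0.
  - apply Rle_trans with ((B + D + 1) * (eps / (B + D + 1))). nra. right; field; lra.
Qed.
Lemma trig_limit_eith z : trig_limit (fun t => eith (IZR z * t)).
Proof.
  destruct (ZArith_dec.Z_le_gt_dec 0 z).
  - apply (trig_limit_isL (fun s => cexp (Cmult (RtoC (INR (Z.to_nat z))) s))). apply isL_isA, isA_mono.
    intro. now rewrite cexp_line0, INR_IZR_INZ, Z2Nat.id.
  - apply (trig_limit_isL (fun s => cexp (Copp (Cmult (RtoC (INR (Z.to_nat (- z)))) s)))). apply isL_negmono.
    intro. replace (Copp _) with (Cmult (RtoC (- INR (Z.to_nat (- z)))) (0, t)) by (rewrite RtoC_opp; ring).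
    rewrite cexp_line0, INR_IZR_INZ, Z2Nat.id by lia. rewrite opp_IZR. f_equal. ring.
Qed.
Lemma trig_limit_cexp F (a : R) : disc0 F -> trig_limit (fun t => cexp (Cmult a (F t))).
Proof.
  intro HF. split; [|split].
  - apply ccont_cexp, ccont_mult. apply ccont_const. apply HF.
  - apply cbounded_cexp, cbounded_mult. apply cbounded_const. apply HF.
  - intros eps He. destruct (disc0_cexp F a eps HF He) as (Q & HQ & _ & H). exists Q. split; auto. now apply isL_isA.
Qed.

(** e^{aF} continues analytically into the disc with value 1 at the origin, where the mean
    evaluates. The proof takes the limit in [isA_mean_mult]. *)
Lemma mean_disc_cexp F (a : R) f : disc0 F -> isA f ->
  mean (fun t => Cmult (f (0, t)) (cexp (Cmult a (F t)))) = mean (fun t => f (0, t)).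
Proof.
  intros HF Hf. destruct (cbounded_isA f 0 Hf) as (B & HB & HfB).
  assert (Hc : ccont (fun t => cexp (Cmult a (F t)))) by apply (trig_limit_cexp F a HF).
  apply (Ceq_eps _ _ B). intros eps He.
  destruct (disc0_cexp F a eps HF He) as (Q & HQ & HQ1 & H).
  replace (mean (fun t => f (0, t))) with (mean (fun t => Cmult (f (0, t)) (Q (0, t)))).
  2:{ rewrite isA_mean_mult, HQ1 by auto. ring. }
  rewrite <- mean_minus by auto using ccont_mult, ccont_isA.
  apply Cmod_mean_le. auto using ccont_minus, ccont_mult, ccont_isA. nra.
  intro t. replace (Cminus _ _) with (Cmult (f (0, t)) (Cminus (cexp (Cmult a (F t))) (Q (0, t)))) by ring.
  rewrite Cmod_mult. apply Rmult_le_compat; auto using Cmod_ge_0.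
Qed.

(** The inequality between mean and norm survives uniform limits, because both sides are continuous
    for uniform convergence. It reduces the estimates for functions built from e^{nF} to
    polynomials. *)
Lemma mean_nrm_limit f K : ccont f -> 0 <= K ->
  (forall d, 0 < d -> exists g, ccont g /\ (forall t, Cmod (Cminus (f t) (g t)) <= d) /\ Cmod (mean g) <= K * nrm g) ->
  Cmod (mean f) <= K * nrm f.
Proof.
  intros Hf HK H. apply le_epsilon. intros eps He.
  destruct (H (eps / (K + 1))) as (g & Hg & Hfg & Hm).
  { apply Rmult_lt_0_compat; auto. apply Rinv_0_lt_compat; lra. }
  set (d := eps / (K + 1)) in *.
  assert (Hd : 0 <= d). { eapply Rle_trans. apply Cmod_ge_0. apply (Hfg 0). }
  assert (Hc : ccont (fun t => Cminus (f t) (g t))) by auto using ccont_minus.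
  assert (H1 : Cmod (Cminus (mean f) (mean g)) <= d).
  { rewrite <- mean_minus by auto. apply Cmod_mean_le; auto. }
  assert (H2 : nrm g <= nrm f + d).
  { rewrite (nrm_ext g (fun t => Cplus (f t) (Copp (Cminus (f t) (g t))))) by (intro; ring).
    eapply Rle_trans. apply nrm_triangle; auto using ccont_opp. apply Rplus_le_compat_l.
    apply nrm_le_sup; auto using ccont_opp. intro. rewrite Cmod_opp. auto. }
  replace (mean f) with (Cplus (mean g) (Cminus (mean f) (mean g))) by ring.
  eapply Rle_trans. apply Cmod_triangle.
  apply Rle_trans with (K * (nrm f + d) + d).
  - apply Rplus_le_compat; auto. eapply Rle_trans. apply Hm. now apply Rmult_le_compat_l.
  - apply Rle_trans with (K * nrm f + (K + 1) * d). lra. apply Rplus_le_compat_l. right. unfold d. field. lra.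
Qed.

(* e^{i n kappa}, where kappa = t - 2 Im F. *)
Definition phase (n : nat) (F : R -> C) (t : R) : C := eith (INR n * (t - 2 * Im (F t))).

Lemma ccont_phase n F : ccont F -> ccont (phase n F).
Proof.
  intros [_ H]. apply ccont_eith. apply rcont_mult. apply rcont_const. apply rcont_minus. apply rcont_id.
  apply rcont_mult; auto. apply rcont_const.
Qed.
Lemma nrm_unimodular u f : (forall t, Cmod (u t) = 1) -> nrm (fun t => Cmult (u t) (f t)) = nrm f.
Proof. intro H. unfold nrm. f_equal. apply rmean_ext. intro. rewrite Cmod_mult, H. ring. Qed.

Lemma eith_1 t : eith t = cexp (Cmult (RtoC (INR 1)) (0, t)).
Proof. rewrite cexp_line0. simpl. f_equal. ring. Qed.

(* The angle between the two spaces is bounded below, so [b] is controlled by the sum. *)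
Lemma hardy_sum_mean n F eps al b : ccont F -> 0 <= eps ->
  (forall f g, isA f -> isA g ->
     Cmod (mean (fun t => Cmult (phase n F t) (Cmult (f (0, t)) (g (0, t))))) <=
     / 2 * (nrm (fun t => f (0, t)) * nrm (fun t => g (0, t)))) ->
  (forall f, isA f -> Cmod (mean (fun t => Cmult (phase n F t) (f (0, t)))) <= eps * nrm (fun t => f (0, t))) ->
  isA al -> isA b ->
  let h := fun t => Cplus (Cconj (Cmult (eith t) (al (0, t)))) (Cmult (phase n F t) (b (0, t))) in
  Cmod (mean h) <= 2 * eps * nrm h.
Proof.
  intros HF He H1 H2 Hal Hb h.
  set (za := fun s => Cmult (cexp (Cmult (RtoC (INR 1)) s)) (al s)).
  assert (Hza : isA za) by now apply isA_zpow.
  assert (Hh : forall t, h t = Cplus (Cconj (za (0, t))) (Cmult (phase n F t) (b (0, t)))).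
  { intro. unfold h, za. now rewrite <- eith_1. }
  assert (C1 : ccont (fun t => Cconj (za (0, t)))) by auto using ccont_conj, ccont_isA.
  assert (C2 : ccont (fun t => Cmult (phase n F t) (b (0, t)))) by auto using ccont_mult, ccont_isA, ccont_phase.
  rewrite (mean_ext h _ Hh), (nrm_ext h _ Hh). rewrite mean_plus by auto.
  rewrite mean_conj by auto using ccont_isA. unfold za at 1. rewrite isA_mean_zpow by auto.
  replace (Cconj (RtoC 0)) with (RtoC 0) by (unfold Cconj, RtoC; simpl; f_equal; ring).
  rewrite Cplus_0_l. eapply Rle_trans. now apply H2.
  set (N := nrm (fun t => Cplus _ _)).
  (* With x = ||za|| and y = ||b||, the cross term is at least -xy, so N^2 >= x^2 + y^2 - xy = (x -
     y/2)^2 + 3 y^2 / 4. *)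
  assert (HN : nrm (fun t => b (0, t)) <= 2 * N).
  { assert (E : N ^ 2 = nrm2 (fun t => za (0, t)) + nrm2 (fun t => b (0, t)) +
       2 * Re (mean (fun t => Cmult (Cconj (za (0, t))) (Cconj (Cmult (phase n F t) (b (0, t))))))).
    { unfold N. rewrite nrm_sqr by auto using ccont_plus. rewrite nrm2_plus by auto. rewrite nrm2_conj.
      f_equal. f_equal. rewrite <- nrm_sqr by auto. rewrite nrm_unimodular by (intro; apply Cmod_eith).
      now rewrite nrm_sqr by auto using ccont_isA. }
    (* The inner product of an antianalytic function with [phase * b] is the conjugate of a mean of
       the phase against a product of two analytic functions, which is the form bounded by the first
       hypothesis. *)
    rewrite (mean_ext _ (fun t => Cconj (Cmult (phase n F t) (Cmult (b (0, t)) (za (0, t)))))) in E.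
    2:{ intro. rewrite !Cmult_conj. ring. }
    rewrite mean_conj in E by auto using ccont_mult, ccont_isA, ccont_phase.
    rewrite re_conj in E. generalize (H1 b za Hb Hza). intro H3.
    generalize (re_le_Cmod (mean (fun t => Cmult (phase n F t) (Cmult (b (0, t)) (za (0, t)))))). intro H4.
    apply Rabs_le_between in H4.
    rewrite <- !nrm_sqr in E by auto using ccont_isA.
    assert (P1 : 0 <= nrm (fun t => b (0, t))) by apply nrm_pos. assert (P2 : 0 <= nrm (fun t => za (0, t))) by apply nrm_pos.
    assert (P3 : 0 <= N) by apply nrm_pos.
    apply Rsqr_incr_0_var; [|lra]. unfold Rsqr. 
    generalize (pow2_ge_0 (nrm (fun t => za (0, t)) - / 2 * nrm (fun t => b (0, t)))). nra. }
  generalize (nrm_pos (fun t => b (0, t))). nra.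
Qed.

(** The weight e^{n conj F} is absorbed by both summands: the antianalytic one stays antianalytic,
    and z^n times the weight is [phase] times the analytic e^{nF}. Replacing e^{nF} by a polynomial
    [Q] reduces the claim to [hardy_sum_mean]. *)
Lemma hardy_sum_weighted n F eps al be : disc0 F -> 0 <= eps ->
  (forall f g, isA f -> isA g ->
     Cmod (mean (fun t => Cmult (phase n F t) (Cmult (f (0, t)) (g (0, t))))) <=
     / 2 * (nrm (fun t => f (0, t)) * nrm (fun t => g (0, t)))) ->
  (forall f, isA f -> Cmod (mean (fun t => Cmult (phase n F t) (f (0, t)))) <= eps * nrm (fun t => f (0, t))) ->
  isA al -> isA be ->
  let h := fun t => Cmult (Cconj (cexp (Cmult (RtoC (INR n)) (F t))))
     (Cplus (Cconj (Cmult (eith t) (al (0, t)))) (Cmult (eith (INR n * t)) (be (0, t)))) in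
  Cmod (mean h) <= 2 * eps * nrm h.
Proof.
  intros HF He H1 H2 Hal Hbe h.
  assert (HU : ccont (fun t => cexp (Cmult (RtoC (INR n)) (F t)))) by apply (trig_limit_cexp F (INR n) HF).
  assert (HFc : ccont F) by apply HF.
  assert (Hz : ccont (fun t => eith t)) by (apply ccont_eith, rcont_id).
  apply mean_nrm_limit.
  - unfold h. apply ccont_mult. now apply ccont_conj. apply ccont_plus.
    apply ccont_conj, ccont_mult; auto using ccont_isA.
    apply ccont_mult; auto using ccont_isA, ccont_eith, rcont_lin.
  - lra.
  - intros d Hd. destruct (cbounded_isA al 0 Hal) as (B & HB & HaB). destruct (cbounded_isA be 0 Hbe) as (D & HD & HbD).
    destruct (disc0_cexp F (INR n) (d / (B + D + 1)) HF) as (Q & HQ & _ & HQe).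
    { apply Rmult_lt_0_compat; auto. apply Rinv_0_lt_compat; lra. }
    exists (fun t => Cplus (Cconj (Cmult (eith t) (Cmult (al (0, t)) (Q (0, t))))) (Cmult (phase n F t) (Cmult (be (0, t)) (Q (0, t))))).
    split; [|split].
    + apply ccont_plus; auto 6 using ccont_conj, ccont_mult, ccont_isA, ccont_phase.
    + intro t. unfold h.
      (* This is conj F = F - 2i Im F, exponentiated. *)
      assert (E : Cmult (Cconj (cexp (Cmult (RtoC (INR n)) (F t)))) (eith (INR n * t)) =
        Cmult (phase n F t) (cexp (Cmult (RtoC (INR n)) (F t)))).
      { unfold phase. rewrite !eith_cexp, cexp_conj, <- !cexp_plus. f_equal.
        destruct (F t) as [x y]. unfold Cmult, Cplus, Cconj, RtoC; simpl. f_equal; ring. }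
      rewrite Cmult_plus_distr_l, (Cmult_assoc _ (eith (INR n * t))), E.
      set (X := cexp (Cmult (RtoC (INR n)) (F t))) in *.
      replace (Cminus _ _) with (Cplus (Cmult (Cconj (Cmult (eith t) (al (0, t)))) (Cconj (Cminus X (Q (0, t)))))
        (Cmult (Cmult (phase n F t) (be (0, t))) (Cminus X (Q (0, t))))) by (rewrite Cminus_conj, !Cmult_conj; ring).
      eapply Rle_trans. apply Cmod_triangle. rewrite !Cmod_mult, !Cmod_conj, Cmod_mult.
      unfold phase. rewrite !Cmod_eith, !Rmult_1_l.
      apply Rle_trans with (B * (d / (B + D + 1)) + D * (d / (B + D + 1))).
      * apply Rplus_le_compat; apply Rmult_le_compat; auto using Cmod_ge_0; apply HQe.
      * apply Rle_trans with ((B + D + 1) * (d / (B + D + 1))). 2: right; field; lra.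
        assert (0 <= d / (B + D + 1)) by (eapply Rle_trans; [apply Cmod_ge_0|apply (HQe 0)]). nra.
    + apply (hardy_sum_mean n F eps (fun s => Cmult (al s) (Q s)) (fun s => Cmult (be s) (Q s))); auto using isA_mult.
Qed.

(** A trigonometric polynomial [T] close to [H] need not share its gap. Its coefficients at
    frequencies 0, ..., n-1 are nevertheless as small as the distance from [H], so they can be
    deleted, which leaves a sum covered by [hardy_sum_weighted]. *)
Lemma gap_mean n F eps H : disc0 F -> 0 <= eps ->
  (forall f g, isA f -> isA g ->
     Cmod (mean (fun t => Cmult (phase n F t) (Cmult (f (0, t)) (g (0, t))))) <=
     / 2 * (nrm (fun t => f (0, t)) * nrm (fun t => g (0, t)))) ->
  (forall f, isA f -> Cmod (mean (fun t => Cmult (phase n F t) (f (0, t)))) <= eps * nrm (fun t => f (0, t))) ->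
  trig_limit H ->
  (forall j, (j < n)%nat -> mean (fun t => Cmult (H t) (eith (- INR j * t))) = 0) ->
  let h := fun t => Cmult (Cconj (cexp (Cmult (RtoC (INR n)) (F t)))) (H t) in
  Cmod (mean h) <= 2 * eps * nrm h.
Proof.
  intros HF He H1 H2 HH H0 h.
  destruct (trig_limit_conj _ (trig_limit_cexp F (INR n) HF)) as (HU & (B & HB & HUB) & _).
  assert (Hz : ccont (fun t => eith t)) by (apply ccont_eith, rcont_id).
  assert (HHc : ccont H) by apply HH.
  apply mean_nrm_limit.
  - apply ccont_mult; auto.
  - lra.
  (* The approximation costs [d'] and the n deleted terms cost [d'] each; after multiplication by
     the bound [B] of the weight the total stays below [d]. *)
  - intros d Hd. set (d' := d / ((B + 1) * (INR n + 1))).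
    generalize (pos_INR n); intro Hn.
    assert (Hd' : 0 < d'). { apply Rmult_lt_0_compat; auto. apply Rinv_0_lt_compat. nra. }
    destruct (proj2 (proj2 HH) d' Hd') as (T & HT & HTH).
    destruct (isL_split T n HT) as (al & be & c & Hal & Hbe & HTs).
    assert (CT : ccont (fun t => T (0, t))) by now apply ccont_isL.
    assert (Ce : forall x, ccont (fun t => eith (x * t))) by auto using ccont_eith, rcont_lin.
    assert (Cal : ccont (fun t => Cconj (Cmult (eith t) (al (0, t))))) by auto using ccont_conj, ccont_mult, ccont_isA.
    assert (Cbe : ccont (fun t => Cmult (eith (INR n * t)) (be (0, t)))) by auto using ccont_mult, ccont_isA.
    assert (Csm : ccont (fun t => csum (fun j => Cmult (c j) (eith (INR j * t))) n)).
    { apply (ccont_csum (fun j t => Cmult (c j) (eith (INR j * t)))). intros; auto using ccont_mult, ccont_const. }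
    assert (Hc : forall j, (j < n)%nat -> Cmod (c j) <= d').
    { intros j Hj.
      (* Multiplication by e^{-ijt} with 0 <= j < n keeps the low part strictly negative and the
         high part strictly positive in frequency, so the mean sees only the middle sum and extracts
         [c j]. *)
      assert (E : mean (fun t => Cmult (T (0, t)) (eith (- INR j * t))) = c j).
      { rewrite (mean_ext _ (fun t => Cplus (Cplus (Cconj (Cmult (cexp (Cmult (RtoC (INR (S j))) (0, t))) (al (0, t))))
           (csum (fun i => Cmult (c i) (eith (IZR (Z.of_nat i - Z.of_nat j) * t))) n))
           (Cmult (cexp (Cmult (RtoC (INR (n - j))) (0, t))) (be (0, t))))).
        2:{ intro t. rewrite HTs. rewrite !Cmult_plus_distr_r. f_equal. f_equal.
            - rewrite cexp_line0, !Cmult_conj, !eith_conj, S_INR.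
              replace (- ((INR j + 1) * t)) with (- t + - INR j * t) by ring. rewrite eith_plus. ring.
            - rewrite Cmult_comm, <- csum_mult_l. apply csum_ext. intros i _.
              rewrite minus_IZR, <- !INR_IZR_INZ. replace ((INR i - INR j) * t) with (INR i * t + - INR j * t) by ring.
              rewrite eith_plus. ring.
            - rewrite cexp_line0, minus_INR by lia. replace ((INR n - INR j) * t) with (INR n * t + - INR j * t) by ring.
              rewrite eith_plus. ring. }
        assert (C1 : ccont (fun t => Cmult (cexp (Cmult (RtoC (INR (S j))) (0, t))) (al (0, t)))).
        { apply (ccont_isA (fun s => Cmult (cexp (Cmult (RtoC (INR (S j))) s)) (al s))). now apply isA_zpow. }
        assert (C2 : ccont (fun t => Cmult (cexp (Cmult (RtoC (INR (n - j))) (0, t))) (be (0, t)))).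
        { apply (ccont_isA (fun s => Cmult (cexp (Cmult (RtoC (INR (n - j))) s)) (be s))). now apply isA_zpow. }
        assert (C3 : ccont (fun t => csum (fun i => Cmult (c i) (eith (IZR (Z.of_nat i - Z.of_nat j) * t))) n)).
        { apply (ccont_csum (fun i t => Cmult (c i) (eith (IZR (Z.of_nat i - Z.of_nat j) * t)))). intros; auto using ccont_mult, ccont_const. }
        rewrite !mean_plus; auto using ccont_plus, ccont_conj. rewrite mean_conj by auto.
        rewrite !isA_mean_zpow by (auto; lia).
        replace (Cconj (RtoC 0)) with (RtoC 0) by (unfold Cconj, RtoC; simpl; f_equal; ring).
        rewrite (mean_csum (fun i t => Cmult (c i) (eith (IZR (Z.of_nat i - Z.of_nat j) * t)))) by (intros; auto using ccont_mult, ccont_const).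
        rewrite Cplus_0_l, Cplus_0_r. revert Hj. clear -Ce. induction n; intro Hj. lia. simpl.
        assert (E : forall i, mean (fun t => Cmult (c i) (eith (IZR (Z.of_nat i - Z.of_nat j) * t))) = if Nat.eqb i j then c i else 0).
        { intro i. rewrite mean_scal by auto. destruct (Nat.eqb_spec i j).
          subst. rewrite Z.sub_diag. rewrite (mean_ext _ (fun _ => RtoC 1)). rewrite mean_const. ring.
          intro. rewrite Rmult_0_l. apply eith_0. rewrite mean_eith_nz by lia. ring. }
        destruct (Nat.eq_dec j n).
        - subst. rewrite E, Nat.eqb_refl. rewrite csum_zero. ring. intros i Hi. rewrite E.
          destruct (Nat.eqb_spec i n); auto; lia.
        - rewrite IHn by lia. rewrite E. destruct (Nat.eqb_spec n j); [lia|ring]. }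
      rewrite <- E. replace (mean _) with (Copp (Cminus (mean (fun t => Cmult (H t) (eith (- INR j * t)))) (mean (fun t => Cmult (T (0, t)) (eith (- INR j * t)))))).
      2:{ rewrite H0 by auto. ring. }
      rewrite <- mean_minus by auto using ccont_mult. rewrite Cmod_opp.
      apply Cmod_mean_le; auto using ccont_minus, ccont_mult. lra.
      intro t. replace (Cminus _ _) with (Cmult (Cminus (H t) (T (0, t))) (eith (- INR j * t))) by ring.
      rewrite Cmod_mult, Cmod_eith, Rmult_1_r. apply HTH. }
    exists (fun t => Cmult (Cconj (cexp (Cmult (RtoC (INR n)) (F t))))
     (Cplus (Cconj (Cmult (eith t) (al (0, t)))) (Cmult (eith (INR n * t)) (be (0, t))))).
    split; [|split].
    + apply ccont_mult; auto. apply ccont_plus; auto.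
    + intro t. unfold h. replace (Cminus _ _) with (Cmult (Cconj (cexp (Cmult (RtoC (INR n)) (F t))))
        (Cplus (Cminus (H t) (T (0, t))) (csum (fun j => Cmult (c j) (eith (INR j * t))) n))) by (rewrite HTs; ring).
      rewrite Cmod_mult. apply Rle_trans with (B * (d' + INR n * d')).
      * apply Rmult_le_compat; auto using Cmod_ge_0. eapply Rle_trans. apply Cmod_triangle.
        apply Rplus_le_compat; auto. eapply Rle_trans. apply Cmod_csum.
        apply Rle_trans with (rsum (fun _ => d') n). apply rsum_le. intros. rewrite Cmod_mult, Cmod_eith, Rmult_1_r. auto.
        rewrite rsum_const. lra.
      * apply Rle_trans with ((B + 1) * (INR n + 1) * d'). nra. right. unfold d'. field. split; lra.
    + now apply hardy_sum_weighted.
Qed.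

(** * The leading coefficient *)

Lemma Cpow_eith t j : Defs.Cpow (eith t) j = eith (INR j * t).
Proof.
  induction j. simpl. now rewrite Rmult_0_l, eith_0.
  simpl Defs.Cpow. rewrite IHj, <- eith_plus, S_INR. f_equal. ring.
Qed.
Lemma peval_csum c d t : peval c d (eith t) = csum (fun j => Cmult (c j) (eith (INR j * t))) (S d).
Proof.
  induction d.
  - simpl. rewrite Rmult_0_l, eith_0. ring.
  - change (peval c (S d) (eith t)) with (Cplus (peval c d (eith t)) (Cmult (c (S d)) (Defs.Cpow (eith t) (S d)))).
    now rewrite IHd, Cpow_eith.
Qed.
Lemma ccont_peval c d : ccont (fun t => peval c d (eith t)).
Proof.
  apply (ccont_ext (fun t => csum (fun j => Cmult (c j) (eith (INR j * t))) (S d))).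
  intro; now rewrite peval_csum.
  apply (ccont_csum (fun j t => Cmult (c j) (eith (INR j * t)))).
  intros; auto using ccont_mult, ccont_const, ccont_eith, rcont_lin.
Qed.
Lemma trig_limit_peval c d : trig_limit (fun t => peval c d (eith t)).
Proof.
  apply (trig_limit_isL (apoly c (S d))). apply isL_isA, isA_apoly.
  intro. rewrite peval_csum. unfold apoly. apply csum_ext. intros. now rewrite cexp_line0.
Qed.
Lemma mean_eith_nat j : mean (fun t => eith (INR j * t)) = if Nat.eqb j 0 then 1 else 0.
Proof.
  destruct (Nat.eqb_spec j 0).
  - subst. simpl. rewrite (mean_ext _ (fun _ => RtoC 1)). apply mean_const. intro. now rewrite Rmult_0_l, eith_0.
  - rewrite (mean_ext _ (fun t => eith (IZR (Z.of_nat j) * t))). apply mean_eith_nz. lia. intro; now rewrite INR_IZR_INZ.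
Qed.
Lemma mean_eith_disc F (a : R) j : disc0 F ->
  mean (fun t => Cmult (eith (INR j * t)) (cexp (Cmult a (F t)))) = if Nat.eqb j 0 then 1 else 0.
Proof.
  intro HF. rewrite <- mean_eith_nat.
  rewrite (mean_ext (fun t => eith (INR j * t)) (fun t => cexp (Cmult (RtoC (INR j)) (0, t)))) by (intro; now rewrite cexp_line0).
  rewrite <- (mean_disc_cexp F a (fun s => cexp (Cmult (RtoC (INR j)) s)) HF (isA_mono j)).
  apply mean_ext. intro. now rewrite cexp_line0.
Qed.

(** Triangular inversion: in <p_j, p_d> all monomials below z^j contribute zero by strong induction,
    so gamma_j times the moment of z^j equals delta_{jd}. *)
Lemma orthonormal_monomials phi P d : rcont phi -> orthonormal_system phi P ->
  forall j, (j <= d)%nat ->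
  mean (fun t => Cmult (Cmult (eith (INR j * t)) (Cconj (peval (P d) d (eith t)))) (RtoC (phi t))) =
  if Nat.eqb j d then Cinv (RtoC (Re (P d d))) else 0.
Proof.
  intros Hphi [HP1 HP2].
  set (m := fun j => mean (fun t => Cmult (Cmult (eith (INR j * t)) (Cconj (peval (P d) d (eith t)))) (RtoC (phi t)))).
  assert (Hc : forall j, ccont (fun t => Cmult (Cmult (eith (INR j * t)) (Cconj (peval (P d) d (eith t)))) (RtoC (phi t)))).
  { intro. apply ccont_mult. 2: now apply ccont_RtoC. apply ccont_mult. apply ccont_eith, rcont_lin.
    apply ccont_conj, ccont_peval. }
  assert (E : forall j, Cplus (csum (fun i => Cmult (P j i) (m i)) j) (Cmult (RtoC (Re (P j j))) (m j)) = RtoC (if Nat.eqb j d then 1 else 0)).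
  { intro j. rewrite <- HP2. unfold ip. fold (mean (fun t => Cmult (Cmult (peval (P j) j (eith t)) (Cconj (peval (P d) d (eith t)))) (RtoC (phi t)))).
    rewrite (mean_ext _ (fun t => csum (fun i => Cmult (P j i) (Cmult (Cmult (eith (INR i * t)) (Cconj (peval (P d) d (eith t)))) (RtoC (phi t)))) (S j))).
    rewrite mean_csum by (intros; apply ccont_mult; auto using ccont_const).
    rewrite (csum_ext _ (fun i => Cmult (P j i) (m i)) (S j)). simpl csum. f_equal. f_equal.
    destruct (HP1 j) as [H _]. destruct (P j j); simpl in *. now rewrite H.
    intros. rewrite mean_scal; auto.
    intro t. rewrite (peval_csum (P j)), <- Cmult_assoc, (Cmult_comm (csum _ _)), <- csum_mult_l. apply csum_ext. intros; ring. }
  intros j. change (mean _) with (m j).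
  induction j as [j IH] using (well_founded_induction lt_wf). intro Hj.
  generalize (E j). rewrite csum_zero.
  2:{ intros i Hi. rewrite IH by lia. replace (Nat.eqb i d) with false by (symmetry; apply Nat.eqb_neq; lia). ring. }
  rewrite Cplus_0_l. intro H.
  assert (Hnz : RtoC (Re (P j j)) <> 0). { intro H'. apply RtoC_inj in H'. generalize (proj2 (HP1 j)). lra. }
  replace (m j) with (Cmult (Cinv (RtoC (Re (P j j)))) (Cmult (RtoC (Re (P j j))) (m j))) by (field; auto).
  rewrite H. destruct (Nat.eqb_spec j d). subst; ring. ring.
Qed.

(** Here [q] is the boundary value of p* e^{-nF}, with p* the reversed polynomial. The factor [X] =
    e^{-nF} turns the weight into a constant, as |X|^2 = e^{n v0} phi. *)
Lemma leading_coefficient_defect n V F v0 P eps : (1 <= n)%nat -> disc0 F -> rcont V ->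
  (forall t, V t = v0 + 2 * Re (F t)) ->
  orthonormal_system (fun t => exp (- INR n * V t)) P -> 0 <= eps ->
  (forall f g, isA f -> isA g ->
     Cmod (mean (fun t => Cmult (phase n F t) (Cmult (f (0, t)) (g (0, t))))) <=
     / 2 * (nrm (fun t => f (0, t)) * nrm (fun t => g (0, t)))) ->
  (forall f, isA f -> Cmod (mean (fun t => Cmult (phase n F t) (f (0, t)))) <= eps * nrm (fun t => f (0, t))) ->
  0 <= 1 - Re (P (n - 1)%nat (n - 1)%nat) ^ 2 * exp (- INR n * v0) <= 4 * eps ^ 2.
Proof.
  intros Hn HF HVc HV HP He H1 H2. set (d := (n - 1)%nat). set (g := Re (P d d)).
  set (phi := fun t => exp (- INR n * V t)) in *.
  assert (Hphi : rcont phi).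
  { apply (rcont_comp (fun t => - INR n * V t) exp). apply rcont_mult; auto using rcont_const. apply rcont_exp. }
  assert (Hg : 0 < g) by apply HP.
  assert (HgC : P d d = RtoC g). { generalize (proj1 (proj1 HP d)). unfold g. destruct (P d d); simpl. intros ->; reflexivity. }
  generalize (orthonormal_monomials phi P d Hphi HP). intro Hm.
  set (p := fun t => peval (P d) d (eith t)).
  set (X := fun t => cexp (Cmult (- INR n)%R (F t))).
  set (q := fun t => Cmult (Cmult (eith (INR d * t)) (Cconj (p t))) (X t)).
  assert (TX : trig_limit X) by now apply trig_limit_cexp.
  assert (Te : forall j, trig_limit (fun t => eith (INR j * t))).
  { intro j. apply (trig_limit_ext (fun t => eith (IZR (Z.of_nat j) * t))). intro; now rewrite INR_IZR_INZ. apply trig_limit_eith. }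
  assert (Tp : trig_limit p) by apply trig_limit_peval.
  assert (Tq : trig_limit q).
  { apply (trig_limit_mult (fun t => Cmult (eith (INR d * t)) (Cconj (p t))) X); auto.
    apply (trig_limit_mult (fun t => eith (INR d * t))); auto using trig_limit_conj. }
  assert (CX : ccont X) by apply TX. assert (Cq : ccont q) by apply Tq. assert (Cp : ccont p) by apply Tp.
  assert (Ce : forall x, ccont (fun t => eith (x * t))) by auto using ccont_eith, rcont_lin.
  assert (HX : forall t, Cmod (X t) ^ 2 = exp (INR n * v0) * phi t).
  { intro. unfold X, phi. rewrite Cmod_cexp, HV. simpl. rewrite Rmult_1_r, <- !exp_plus. f_equal.
    unfold Re. ring. }
  assert (HXC : forall t, Cmult (X t) (Cconj (X t)) = Cmult (RtoC (exp (INR n * v0))) (RtoC (phi t))).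
  { intro. now rewrite <- Cmod2_conj, <- RtoC_mult, HX. }
  (* This is <1, q> / ||q||^2, the value minimizing ||1 - c q||. It makes 1 - c q orthogonal to q,
     so its squared norm equals its mean. *)
  set (c := exp (- INR n * v0) * g).
  (* The mean is the value at the origin, where e^{-nF} equals 1 and p* equals the conjugated
     leading coefficient of p: only the term j = d survives. *)
  assert (Eq1 : mean q = g).
  { rewrite (mean_ext q (fun t => csum (fun j => Cmult (Cconj (P d j)) (Cmult (eith (INR (d - j) * t)) (X t))) (S d))).
    2:{ intro. unfold q, p. rewrite peval_csum, <- csum_conj, Cmult_comm, Cmult_assoc, <- csum_mult_l.
        apply csum_ext. intros j Hj. rewrite Cmult_conj, eith_conj, minus_INR by lia.
        replace ((INR d - INR j) * t) with (INR d * t + - (INR j * t)) by ring. rewrite eith_plus. ring. }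
    rewrite mean_csum by (intros; auto using ccont_mult, ccont_const). simpl csum. rewrite csum_zero.
    - rewrite Cplus_0_l, mean_scal by auto using ccont_mult. rewrite Nat.sub_diag.
      unfold X. rewrite (mean_eith_disc F (- INR n) 0 HF). simpl. rewrite HgC. unfold Cconj, RtoC, Cmult; simpl. f_equal; ring.
    - intros j Hj. rewrite mean_scal by auto using ccont_mult. unfold X. rewrite (mean_eith_disc F (- INR n) _ HF).
      destruct (Nat.eqb_spec (d - j) 0). lia. ring. }
  assert (Eq2 : nrm2 q = exp (INR n * v0)).
  { assert (E0 : rmean (fun t => Cmod (p t) ^ 2 * phi t) = 1).
    { transitivity (Re (ip phi (peval (P d) d) (peval (P d) d))).
      2:{ rewrite (proj2 HP d d), Nat.eqb_refl. reflexivity. }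
      change (ip phi (peval (P d) d) (peval (P d) d)) with (mean (fun t => Cmult (Cmult (p t) (Cconj (p t))) (RtoC (phi t)))).
      rewrite mean_pair. apply rmean_ext. intro. rewrite Cmod_sqr. simpl. unfold Re, Im. ring. }
    unfold nrm2. rewrite (rmean_ext _ (fun t => exp (INR n * v0) * (Cmod (p t) ^ 2 * phi t))).
    rewrite rmean_scal, E0. ring. apply rcont_mult; auto. now apply rcont_Cmod2.
    intro. unfold q. rewrite !Cmod_mult, Cmod_eith, Cmod_conj. 
    transitivity (Cmod (p t) ^ 2 * Cmod (X t) ^ 2). ring. rewrite HX. ring. }
  set (E := fun t => Cplus 1 (Cmult (RtoC (- c)) (q t))).
  assert (CE : ccont E) by (apply ccont_plus; auto using ccont_const, ccont_mult).
  assert (Eexp : exp (- INR n * v0) * exp (INR n * v0) = 1).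
  { rewrite <- exp_plus. replace (- INR n * v0 + INR n * v0) with 0 by ring. apply exp_0. }
  assert (ME : mean E = RtoC (1 - g ^ 2 * exp (- INR n * v0))).
  { unfold E. rewrite mean_plus, mean_const, mean_scal, Eq1; auto using ccont_const, ccont_mult.
    rewrite <- RtoC_mult, <- RtoC_plus. f_equal. unfold c. ring. }
  assert (NE : nrm2 E = 1 - g ^ 2 * exp (- INR n * v0)).
  { unfold E. rewrite nrm2_plus; auto using ccont_const, ccont_mult. rewrite nrm2_scal, Eq2 by auto.
    rewrite (mean_ext _ (fun t => Cconj (Cmult (RtoC (- c)) (q t)))) by (intro; ring).
    rewrite mean_conj by auto using ccont_const, ccont_mult. rewrite re_conj.
    rewrite mean_scal, Eq1 by auto. rewrite <- RtoC_mult. simpl Re. rewrite Cmod_R, pow2_abs.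
    unfold nrm2. rewrite (rmean_ext _ (fun _ => 1)), rmean_const.
    2:{ intro. rewrite Cmod_1. ring. }
    unfold c. replace ((- (exp (- INR n * v0) * g)) ^ 2 * exp (INR n * v0)) with (exp (- INR n * v0) * g ^ 2 * (exp (- INR n * v0) * exp (INR n * v0))) by ring.
    rewrite Eexp. ring. }
  assert (TE : trig_limit (fun t => Cmult (E t) (Cconj (X t)))).
  { apply trig_limit_mult. apply trig_limit_plus; auto using trig_limit_const, trig_limit_mult. now apply trig_limit_conj. }
  generalize (gap_mean n F eps (fun t => Cmult (E t) (Cconj (X t))) HF He H1 H2 TE). intro Hgap.
  assert (Hbound : Cmod (mean E) <= 2 * eps * nrm E).
  { assert (Eh : forall t, Cmult (Cconj (cexp (Cmult (RtoC (INR n)) (F t)))) (Cmult (E t) (Cconj (X t))) = E t).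
    { intro. transitivity (Cmult (E t) (Cconj (Cmult (cexp (Cmult (RtoC (INR n)) (F t))) (X t)))).
      rewrite Cmult_conj. ring. unfold X. rewrite <- cexp_plus.
      replace (Cplus _ _) with (RtoC 0) by (rewrite RtoC_opp; ring). rewrite cexp_0.
      replace (Cconj (RtoC 1)) with (RtoC 1) by (unfold Cconj, RtoC; simpl; f_equal; ring). ring. }
    rewrite <- (mean_ext _ _ Eh), <- (nrm_ext _ _ Eh). apply Hgap.
    intros j Hj.
    (* At frequency j the constant 1 of [E] contributes the conjugate of a mean of z^j e^{-nF},
       which is 1 if j = 0 and 0 otherwise. The part with [q] contributes -g times the moment of
       z^{d-j}, which is 1/g if j = 0 and 0 otherwise. They cancel for every j from 0 to d = n -
       1. *)
    rewrite (mean_ext _ (fun t => Cplus (Cconj (Cmult (eith (INR j * t)) (X t)))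
       (Cmult (RtoC (- c * exp (INR n * v0))) (Cmult (Cmult (eith (INR (d - j) * t)) (Cconj (p t))) (RtoC (phi t)))))).
    2:{ intro. unfold E. rewrite Cmult_conj, eith_conj, RtoC_mult.
        transitivity (Cplus (Cmult (eith (- (INR j * t))) (Cconj (X t))) (Cmult (RtoC (- c)) (Cmult (Cmult (Cmult (eith (INR d * t)) (eith (- (INR j * t)))) (Cconj (p t))) (Cmult (X t) (Cconj (X t)))))).
        unfold q. replace (- INR j * t) with (- (INR j * t)) by ring. ring.
        rewrite HXC, <- eith_plus. replace (INR d * t + - (INR j * t)) with (INR (d - j) * t). ring.
        rewrite minus_INR by (unfold d; lia). ring. }
    assert (C1 : ccont (fun t => Cmult (eith (INR j * t)) (X t))) by auto using ccont_mult.
    assert (C2 : ccont (fun t => Cmult (Cmult (eith (INR (d - j) * t)) (Cconj (p t))) (RtoC (phi t)))) by auto using ccont_mult, ccont_conj, ccont_RtoC.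
    rewrite mean_plus, mean_conj, mean_scal; auto using ccont_conj, ccont_mult, ccont_const.
    unfold p. rewrite Hm by lia. unfold X. rewrite (mean_eith_disc F (- INR n) _ HF).
    replace (- c * exp (INR n * v0)) with (- g) by (unfold c; rewrite <- (Rmult_1_r g) at 1; rewrite <- Eexp; ring).
    fold g. assert (RtoC g <> 0) by (intro H'; apply RtoC_inj in H'; lra).
    destruct (Nat.eqb_spec j 0).
    - subst. rewrite Nat.sub_0_r, Nat.eqb_refl. replace (Cconj (RtoC 1)) with (RtoC 1) by (unfold Cconj, RtoC; simpl; f_equal; ring).
      rewrite RtoC_opp. field. auto.
    - replace (Nat.eqb (d - j) d) with false by (symmetry; apply Nat.eqb_neq; lia).
      replace (Cconj (RtoC 0)) with (RtoC 0) by (unfold Cconj, RtoC; simpl; f_equal; ring). ring. }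
  rewrite ME, Cmod_R, <- NE in Hbound. rewrite <- NE. generalize (nrm2_pos E CE). intro Hp. split; auto.
  rewrite Rabs_right in Hbound by lra. rewrite <- nrm_sqr in * by auto. generalize (nrm_pos E). intro Hq.
  (* Here the quadratic gain appears: ||E||^2 <= 2 eps ||E|| is divided by ||E||, and the defect is
     ||E||^2. *)
  assert (nrm E <= 2 * eps). { destruct Hq as [Hq|Hq]. apply Rmult_le_reg_r with (nrm E); auto. nra. rewrite <- Hq. lra. }
  nra.
Qed.

(** * Bounds for the phase *)

(* The strictly analytic part of a Fourier series: frequencies 1, ..., m. *)
Definition apart (a : nat -> C) (m : nat) (s : C) : C :=
  csum (fun j => Cmult (a (S j)) (cexp (Cmult (RtoC (INR (S j))) s))) m.

Lemma isA_csum (f : nat -> C -> C) N : (forall j, isA (f j)) -> isA (fun s => csum (fun j => f j s) N).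
Proof. intro H. induction N; simpl. apply isA_const. apply isA_plus; auto. Qed.
Lemma isA_apart a m : isA (apart a m).
Proof. apply (isA_csum (fun j s => Cmult (a (S j)) (cexp (Cmult (RtoC (INR (S j))) s)))). intro; apply isA_scal, isA_mono. Qed.
Lemma apart_line a m t : apart a m (0, t) = csum (fun j => Cmult (a (S j)) (eith (INR (S j) * t))) m.
Proof. apply csum_ext. intros. now rewrite cexp_line0. Qed.
Lemma mean_apart a m : mean (fun t => apart a m (0, t)) = 0.
Proof.
  rewrite (mean_ext _ _ (apart_line a m)).
  rewrite (mean_csum (fun j t => Cmult (a (S j)) (eith (INR (S j) * t)))) by (intros; auto using ccont_mult, ccont_const, ccont_eith, rcont_lin).
  apply csum_zero. intros. rewrite mean_scal by auto using ccont_eith, rcont_lin.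
  rewrite mean_eith_nat. simpl. ring.
Qed.

(** For a finite series the integrand continues off the circle and the contour moves to radius
    [exp (- eta)]. There [f] and [g] only get smaller in norm, while the modulus of the phase is the
    exponential of -n times the right side of the hypothesis. To first order in [eta] that side is
    [eta] times the derivative of the truncated kappa. *)
Lemma phase_shift_bound a m n eta c f g : 0 <= eta ->
  (forall t, eta * c <= eta - rsum (fun j => (exp (INR (S j) * eta) - exp (- (INR (S j) * eta))) *
     Re (Cmult (a (S j)) (eith (INR (S j) * t)))) m) ->
  isA f -> isA g ->
  Cmod (mean (fun t => Cmult (phase n (fun t => apart a m (0, t)) t) (Cmult (f (0, t)) (g (0, t))))) <=
  exp (- INR n * eta * c) * (nrm (fun t => f (0, t)) * nrm (fun t => g (0, t))).
Proof.
  intros He Hc Hf Hg.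
  (* The Laurent polynomial continuing conj F from the circle. With it the phase is [exp W] times
     z^n on the circle, and both factors make sense at every radius. *)
  set (Fs := fun s => csum (fun j => Cmult (Cconj (a (S j))) (cexp (Copp (Cmult (RtoC (INR (S j))) s)))) m).
  set (W := fun s => Cmult (RtoC (INR n)) (Cplus (Cmult (RtoC (-1)) (apart a m s)) (Fs s))).
  assert (HFs : forall t, Fs (0, t) = Cconj (apart a m (0, t))).
  { intro. unfold Fs, apart. rewrite <- csum_conj. apply csum_ext. intros.
    rewrite Cmult_conj, cexp_conj. do 2 f_equal. unfold Cmult, Cconj, Copp, RtoC; simpl. f_equal; ring. }
  assert (LFs : isL Fs).
  { apply (isL_csum (fun j s => Cmult (Cconj (a (S j))) (cexp (Copp (Cmult (RtoC (INR (S j))) s))))).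
    intro; apply isL_scal, isL_negmono. }
  assert (LW : isL W) by (apply isL_scal, isL_plus; auto; apply isL_scal, isL_isA, isA_apart).
  set (h := fun s => Cmult (cexp (Cmult (RtoC (INR n)) s)) (Cmult (f s) (g s))).
  assert (Lh : isL h) by (apply isL_isA, isA_zpow, isA_mult; auto).
  rewrite (mean_ext _ (fun t => Cmult (cexp (W (0, t))) (h (0, t)))).
  2:{ intro t. unfold h. rewrite !Cmult_assoc. do 2 f_equal. unfold phase. rewrite <- cexp_plus, eith_cexp. f_equal.
      unfold W. rewrite HFs. destruct (apart a m (0, t)) as [x y].
      unfold Cmult, Cplus, Cconj, RtoC; simpl. f_equal; ring. }
  rewrite <- (mean_cexp_shift W h (- eta) LW Lh).
  set (u := fun t => Cmult (cexp (W (- eta, t))) (cexp (Cmult (RtoC (INR n)) (- eta, t)))).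
  assert (Cu : ccont u). { apply ccont_mult. apply ccont_cexp. now apply ccont_isL. apply (ccont_isA _ _ (isA_mono n)). }
  assert (Cf : ccont (fun t => f (- eta, t))) by now apply ccont_isA.
  assert (Cg : ccont (fun t => g (- eta, t))) by now apply ccont_isA.
  rewrite (mean_ext _ (fun t => Cmult (Cmult (u t) (f (- eta, t))) (g (- eta, t)))) by (intro; unfold u, h; ring).
  eapply Rle_trans. apply (Cauchy_Schwarz (fun t => Cmult (u t) (f (- eta, t)))); auto using ccont_mult.
  rewrite <- Rmult_assoc. apply Rmult_le_compat; auto using nrm_pos.
  2: apply isA_nrm_shift; auto; lra.
  eapply Rle_trans. apply (nrm_mult_le u (fun t => f (- eta, t)) (exp (- INR n * eta * c))); auto.
  - left; apply exp_pos.
  - intro t. unfold u. rewrite Cmod_mult, !Cmod_cexp, <- exp_plus. apply exp_le_le.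
    assert (E : Re (W (- eta, t)) = INR n * rsum (fun j => (exp (INR (S j) * eta) - exp (- (INR (S j) * eta))) *
     Re (Cmult (a (S j)) (eith (INR (S j) * t)))) m).
    { unfold W. transitivity (INR n * (- Re (apart a m (- eta, t)) + Re (Fs (- eta, t)))). simpl. unfold Re. ring.
      f_equal. unfold apart, Fs. rewrite !Re_csum. clear. induction m; cbn [rsum]. ring.
      rewrite <- IHm. match goal with |- - (?A + _) + (?B + _) = _ => generalize A B end. intros A B. clear IHm.
      replace (Copp (Cmult (RtoC (INR (S m))) (- eta, t))) with (Cmult (RtoC (- INR (S m))) (- eta, t)) by (rewrite RtoC_opp; ring).
      rewrite !cexp_line. replace (- INR (S m) * - eta) with (INR (S m) * eta) by ring.
      replace (INR (S m) * - eta) with (- (INR (S m) * eta)) by ring.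
      replace (eith (- INR (S m) * t)) with (Cconj (eith (INR (S m) * t))) by (rewrite eith_conj; f_equal; ring).
      destruct (a (S m)) as [x y]. destruct (eith (INR (S m) * t)) as [p q].
      generalize (exp (INR (S m) * eta)) (exp (- (INR (S m) * eta))). intros u v. simpl. ring. }
    rewrite E. replace (Re (Cmult (RtoC (INR n)) (- eta, t))) with (- INR n * eta) by (simpl; ring).
    generalize (pos_INR n) (Hc t). nra.
  - apply Rmult_le_compat_l. left; apply exp_pos. apply isA_nrm_shift; auto; lra.
Qed.

Lemma eith_lipschitz x y : Cmod (Cminus (eith x) (eith y)) <= Rabs (x - y).
Proof.
  apply Rsqr_incr_0_var; [|apply Rabs_pos]. rewrite !Rsqr_pow2, Cmod_sqr, pow2_abs.
  unfold eith; simpl. generalize (one_minus_cos (x - y)). rewrite cos_minus.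
  generalize (sin2_cos2 x) (sin2_cos2 y). unfold Rsqr. intros. nra.
Qed.
Lemma phase_diff n F G t : Cmod (Cminus (phase n F t) (phase n G t)) <= 2 * INR n * Cmod (Cminus (F t) (G t)).
Proof.
  unfold phase. eapply Rle_trans. apply eith_lipschitz.
  replace (_ - _) with (- (2 * INR n * (Im (Cminus (F t) (G t))))) by (simpl; unfold Im; ring).
  rewrite Rabs_Ropp, Rabs_mult, (Rabs_right (2 * INR n)) by (generalize (pos_INR n); lra).
  apply Rmult_le_compat_l. generalize (pos_INR n); lra. apply im_le_Cmod.
Qed.

(** [f * g] is controlled only in L^1, so replacing the phase by its truncation costs the supremum
    of the difference, multiplied by n. This version provides the angle. *)
Lemma phase_bilinear_bound a m n F eta c tau f g : 0 <= eta -> ccont F -> 0 <= tau ->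
  (forall t, eta * c <= eta - rsum (fun j => (exp (INR (S j) * eta) - exp (- (INR (S j) * eta))) *
     Re (Cmult (a (S j)) (eith (INR (S j) * t)))) m) ->
  (forall t, Cmod (Cminus (F t) (apart a m (0, t))) <= tau) ->
  isA f -> isA g ->
  Cmod (mean (fun t => Cmult (phase n F t) (Cmult (f (0, t)) (g (0, t))))) <=
  (exp (- INR n * eta * c) + 2 * INR n * tau) * (nrm (fun t => f (0, t)) * nrm (fun t => g (0, t))).
Proof.
  intros He HF Ht Hc HFa Hf Hg. generalize (phase_shift_bound a m n eta c f g He Hc Hf Hg). intro H.
  set (G := fun t => apart a m (0, t)) in *.
  assert (CG : ccont G) by apply ccont_isA, isA_apart.
  assert (Cf : ccont (fun t => f (0, t))) by now apply ccont_isA.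
  assert (Cg : ccont (fun t => g (0, t))) by now apply ccont_isA.
  assert (CP := ccont_phase n F HF). assert (CQ := ccont_phase n G CG).
  assert (CD : ccont (fun t => Cminus (phase n F t) (phase n G t))) by auto using ccont_minus.
  rewrite (mean_ext _ (fun t => Cplus (Cmult (phase n G t) (Cmult (f (0, t)) (g (0, t))))
     (Cmult (Cmult (Cminus (phase n F t) (phase n G t)) (f (0, t))) (g (0, t))))) by (intro; ring).
  rewrite mean_plus by auto using ccont_mult. eapply Rle_trans. apply Cmod_triangle.
  rewrite Rmult_plus_distr_r. apply Rplus_le_compat; auto.
  eapply Rle_trans. apply (Cauchy_Schwarz (fun t => Cmult (Cminus (phase n F t) (phase n G t)) (f (0, t)))); auto using ccont_mult.
  rewrite <- Rmult_assoc. apply Rmult_le_compat_r. apply nrm_pos.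
  generalize (pos_INR n); intro. apply nrm_mult_le; auto. nra.
  intro t. eapply Rle_trans. apply phase_diff. apply Rmult_le_compat_l. lra. apply HFa.
Qed.

(** With a single factor [f], Cauchy-Schwarz measures the change of phase in L^2. Truncation is much
    more accurate in that norm, and this version provides the rate. *)
Lemma phase_linear_bound a m n F eta c sig f : 0 <= eta -> ccont F ->
  (forall t, eta * c <= eta - rsum (fun j => (exp (INR (S j) * eta) - exp (- (INR (S j) * eta))) *
     Re (Cmult (a (S j)) (eith (INR (S j) * t)))) m) ->
  nrm (fun t => Cminus (F t) (apart a m (0, t))) <= sig ->
  isA f ->
  Cmod (mean (fun t => Cmult (phase n F t) (f (0, t)))) <=
  (exp (- INR n * eta * c) + 2 * INR n * sig) * nrm (fun t => f (0, t)).
Proof.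
  intros He HF Hc HFa Hf.
  generalize (phase_shift_bound a m n eta c f (fun _ => RtoC 1) He Hc Hf (isA_const _)). intro H.
  set (G := fun t => apart a m (0, t)) in *.
  assert (CG : ccont G) by apply ccont_isA, isA_apart.
  assert (Cf : ccont (fun t => f (0, t))) by now apply ccont_isA.
  assert (CP := ccont_phase n F HF). assert (CQ := ccont_phase n G CG).
  assert (CD : ccont (fun t => Cminus (phase n F t) (phase n G t))) by auto using ccont_minus.
  rewrite (mean_ext _ (fun t => Cplus (Cmult (phase n G t) (Cmult (f (0, t)) 1))
     (Cmult (Cminus (phase n F t) (phase n G t)) (f (0, t))))) by (intro; ring).
  rewrite mean_plus by auto using ccont_mult, ccont_const. eapply Rle_trans. apply Cmod_triangle.
  rewrite Rmult_plus_distr_r. apply Rplus_le_compat.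
  - eapply Rle_trans. apply H. apply Rmult_le_compat_l. left; apply exp_pos.
    rewrite <- (Rmult_1_r (nrm (fun t => f (0, t)))) at 2. apply Rmult_le_compat_l. apply nrm_pos.
    apply nrm_le_sup; auto using ccont_const. lra. intro; rewrite Cmod_1; lra.
  - eapply Rle_trans. apply (Cauchy_Schwarz (fun t => Cminus (phase n F t) (phase n G t))); auto.
    apply Rmult_le_compat_r. apply nrm_pos. generalize (pos_INR n); intro.
    apply Rle_trans with (2 * INR n * nrm (fun t => Cminus (F t) (G t))).
    2: apply Rmult_le_compat_l; [lra|exact HFa].
    replace (2 * INR n) with (Cmod (RtoC (2 * INR n))) by (rewrite Cmod_R, Rabs_right; lra).
    unfold nrm. rewrite <- (sqrt_pow2 (Cmod (RtoC (2 * INR n)))) by apply Cmod_ge_0.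
    rewrite <- sqrt_mult by (try apply pow2_ge_0; auto using nrm2_pos, ccont_minus).
    rewrite <- nrm2_scal by auto using ccont_minus. apply sqrt_le_1_alt.
    apply rmean_le; auto using rcont_Cmod2, ccont_mult, ccont_const, ccont_minus.
    intro t. apply pow_incr. split. apply Cmod_ge_0. rewrite Cmod_mult, Cmod_R, Rabs_right by lra. apply phase_diff.
Qed.

(** * Decay of Fourier coefficients *)

Definition coef (f : R -> C) (j : nat) : C := mean (fun t => Cmult (f t) (eith (- INR j * t))).

Lemma Bessel f N : ccont f -> rsum (fun j => Cmod (coef f j) ^ 2) N <= nrm2 f.
Proof.
  intro Hf. set (T := fun t => apoly (coef f) N (0, t)).
  assert (CT : ccont T) by apply ccont_isA, isA_apoly.
  assert (ET : nrm2 T = rsum (fun j => Cmod (coef f j) ^ 2) N).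
  { unfold T. rewrite nrm2_apoly. apply rsum_ext. intros. rewrite Rmult_0_r, Rmult_0_r, exp_0. ring. }
  assert (EM : mean (fun t => Cmult (f t) (Cconj (T t))) = RtoC (rsum (fun j => Cmod (coef f j) ^ 2) N)).
  { rewrite (mean_ext _ (fun t => csum (fun j => Cmult (Cconj (coef f j)) (Cmult (f t) (eith (- INR j * t)))) N)).
    2:{ intro. unfold T, apoly. rewrite <- csum_conj, <- csum_mult_l. apply csum_ext. intros.
        rewrite Cmult_conj, cexp_line0, eith_conj. replace (- (INR j * t)) with (- INR j * t) by ring. ring. }
    assert (C1 : forall j, ccont (fun t => Cmult (f t) (eith (- INR j * t)))) by auto using ccont_mult, ccont_eith, rcont_lin.
    rewrite mean_csum by (intros; auto using ccont_mult, ccont_const).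
    rewrite (csum_ext _ (fun j => RtoC (Cmod (coef f j) ^ 2))).
    { apply csum_RtoC. }
    intros. rewrite mean_scal by auto. fold (coef f j). rewrite Cmod2_conj. ring. }
  assert (H : 0 <= nrm2 (fun t => Cplus (f t) (Cmult (RtoC (-1)) (T t)))).
  { apply nrm2_pos. auto using ccont_plus, ccont_mult, ccont_const. }
  rewrite nrm2_plus, nrm2_scal in H by auto using ccont_mult, ccont_const.
  rewrite (mean_ext _ (fun t => Cmult (RtoC (-1)) (Cmult (f t) (Cconj (T t))))) in H.
  2:{ intro. rewrite Cmult_conj. replace (Cconj (RtoC (-1))) with (RtoC (-1)) by (unfold Cconj, RtoC; simpl; f_equal; ring). ring. }
  rewrite mean_scal, EM, ET, Cmod_R, <- RtoC_mult in H by auto using ccont_mult, ccont_conj.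
  replace (Rabs (-1)) with 1 in H by (unfold Rabs; destruct Rcase_abs; lra).
  revert H. generalize (rsum (fun j => Cmod (coef f j) ^ 2) N). intros S H. simpl in H. lra.
Qed.

Lemma bounded_tail f K : (forall j, 0 <= f j) -> (forall N, rsum f N <= K) ->
  exists th : nat -> R, (forall N M, (N <= M)%nat -> rsum f M - rsum f N <= th N) /\
    (forall N, 0 <= th N) /\
    forall eps, 0 < eps -> exists N0, forall N, (N0 <= N)%nat -> th N <= eps.
Proof.
  intros Hf HK.
  assert (Hinc : forall N, rsum f N <= rsum f (S N)) by (intro; simpl; generalize (Hf N); lra).
  destruct (ex_finite_lim_seq_incr (rsum f) K Hinc HK) as (l & Hl).
  assert (Hle : forall N, rsum f N <= l) by now apply is_lim_seq_incr_compare.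
  exists (fun N => l - rsum f N). split; [|split].
  - intros N M _. generalize (Hle M). lra.
  - intro N. generalize (Hle N). lra.
  - intros eps He. apply is_lim_seq_spec in Hl. destruct (Hl (mkposreal eps He)) as (N0 & HN0).
    exists N0. intros N HN. generalize (HN0 N HN). simpl. intro H. apply Rabs_lt_between in H. lra.
Qed.

(** By Bessel's inequality the squared coefficients are the terms of a convergent series. *)
Lemma Riemann_Lebesgue f : ccont f -> forall eps, 0 < eps -> exists N0, forall N, (N0 <= N)%nat ->
  Cmod (coef f N) <= eps.
Proof.
  intros Hf eps He. destruct (bounded_tail (fun j => Cmod (coef f j) ^ 2) (nrm2 f)) as (th & H1 & _ & H3).
  intro; apply pow2_ge_0. intro; now apply Bessel.
  destruct (H3 (eps ^ 2)) as (N0 & HN0). apply pow_lt; auto.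
  exists N0. intros N HN. apply Rsqr_incr_0_var; [|lra]. rewrite !Rsqr_pow2.
  generalize (HN0 N HN) (H1 N (S N) ltac:(lia)). cbn [rsum]. lra.
Qed.

Lemma rmean_derive g dg : (forall t, is_derive g t (dg t)) -> rcont dg -> g PI = g (- PI) -> rmean dg = 0.
Proof.
  intros H Hc Hp. unfold rmean. rewrite (is_RInt_unique dg (- PI) PI (minus (g PI) (g (- PI)))).
  unfold minus, plus, opp; simpl. rewrite Hp. ring.
  apply (is_RInt_derive g dg). auto. intros; apply Hc.
Qed.

Lemma rcont_cos_lin x : rcont (fun t => cos (x * t)).
Proof. apply (rcont_comp (fun t => x * t) cos); auto using rcont_lin, rcont_cos. Qed.
Lemma rcont_sin_lin x : rcont (fun t => sin (x * t)).
Proof. apply (rcont_comp (fun t => x * t) sin); auto using rcont_lin, rcont_sin. Qed.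
Lemma coef_real g j : rcont g ->
  coef (fun t => RtoC (g t)) j = (rmean (fun t => g t * cos (INR j * t)), - rmean (fun t => g t * sin (INR j * t))).
Proof.
  intros Hg. unfold coef. rewrite mean_pair, <- rmean_opp by auto using rcont_mult, rcont_sin_lin. f_equal; apply rmean_ext; intro t.
  - simpl. rewrite Ropp_mult_distr_l_reverse, cos_neg. ring.
  - simpl. rewrite Ropp_mult_distr_l_reverse, sin_neg. ring.
Qed.

(** Integration by parts, separately against cosine and sine. The boundary terms cancel by
    [f PI = f (- PI)] for the cosine and vanish by sin(j pi) = 0 for the sine; together the two give
    multiplication by i j. *)
Lemma coef_derive f df j : (forall t, is_derive f t (df t)) -> rcont df -> f PI = f (- PI) ->
  Cmod (coef (fun t => RtoC (df t)) j) = INR j * Cmod (coef (fun t => RtoC (f t)) j).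
Proof.
  intros Hd Hc Hp.
  assert (Hf : rcont f). { intro t. apply (ex_derive_continuous f). exists (df t). apply Hd. }
  assert (Hcos : rcont (fun t => cos (INR j * t))) by apply rcont_cos_lin.
  assert (Hsin : rcont (fun t => sin (INR j * t))) by apply rcont_sin_lin.
  assert (A1 : rmean (fun t => df t * cos (INR j * t)) = INR j * rmean (fun t => f t * sin (INR j * t))).
  { apply Rminus_diag_uniq. rewrite <- rmean_scal, <- rmean_minus; auto using rcont_mult, rcont_const.
    apply (rmean_derive (fun t => f t * cos (INR j * t))).
    - intro t. auto_derive. exists (df t); apply Hd.
      rewrite (is_derive_unique (fun x : R => f x) t (df t) (Hd t)). ring.
    - auto using rcont_minus, rcont_mult, rcont_const.
    - cbv beta. replace (INR j * - PI) with (- (INR j * PI)) by ring. rewrite cos_neg, Hp. reflexivity. }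
  assert (A2 : rmean (fun t => df t * sin (INR j * t)) = - (INR j * rmean (fun t => f t * cos (INR j * t)))).
  { apply Rminus_diag_uniq. unfold Rminus. rewrite Ropp_involutive.
    rewrite <- rmean_scal, <- rmean_plus; auto using rcont_mult, rcont_const.
    apply (rmean_derive (fun t => f t * sin (INR j * t))).
    - intro t. auto_derive. exists (df t); apply Hd.
      rewrite (is_derive_unique (fun x : R => f x) t (df t) (Hd t)). ring.
    - auto using rcont_plus, rcont_mult, rcont_const.
    - cbv beta. replace (INR j * - PI) with (- (INR j * PI)) by ring.
      rewrite sin_neg, INR_IZR_INZ, sin_IZR_PI, Ropp_0, !Rmult_0_r. reflexivity. }
  rewrite !coef_real by auto. rewrite A1, A2.
  set (x := rmean _). set (y := rmean _).
  replace (INR j * x, - - (INR j * y)) with (Cmult (RtoC (INR j)) (Cmult (0, 1) (y, - x))).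
  rewrite !Cmod_mult, Cmod_R, Rabs_right by (apply Rle_ge, pos_INR).
  replace (Cmod (0, 1)) with 1. ring. symmetry. apply Cmod_Ci.
  unfold Cmult, RtoC; simpl. f_equal; ring.
Qed.

(** * Periodic functions and coefficients of finite differences *)

Definition periodic (f : R -> R) : Prop := forall x, f (x + 2 * PI) = f x.

Lemma rmean_shift g h : rcont g -> periodic g -> rmean (fun t => g (t + h)) = rmean g.
Proof.
  intros Hg Hp. unfold rmean. f_equal.
  assert (Hs : forall a b v, RInt (fun y => g (y + v)) a b = RInt g (a + v) (b + v)).
  { intros a b v. generalize (RInt_comp_lin g 1 v a b (rcont_ex_RInt g _ _ Hg)).
    rewrite !Rmult_1_l. intro H. rewrite <- H. apply RInt_ext. intros.
    unfold scal; simpl; unfold mult; simpl. rewrite !Rmult_1_l. reflexivity. }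
  rewrite Hs.
  assert (H1 : RInt g PI (PI + h) = RInt g (- PI) (- PI + h)).
  { replace PI with (- PI + 2 * PI) at 1 by ring. replace (PI + h) with (- PI + h + 2 * PI) by ring.
    rewrite <- Hs. apply RInt_ext. intros. apply Hp. }
  assert (CH : forall a b c, RInt g a b + RInt g b c = RInt g a c).
  { intros. apply (RInt_Chasles g); now apply rcont_ex_RInt. }
  generalize (CH (- PI) (- PI + h) (PI + h)) (CH (- PI) PI (PI + h)). lra.
Qed.
Lemma mean_shift f h : ccont f -> (forall t, f (t + 2 * PI) = f t) -> mean (fun t => f (t + h)) = mean f.
Proof.
  intros [H1 H2] Hp. rewrite !mean_pair. f_equal.
  - apply (rmean_shift (fun t => Re (f t))); auto. intro; now rewrite Hp.
  - apply (rmean_shift (fun t => Im (f t))); auto. intro; now rewrite Hp.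
Qed.
Lemma eith_2PI_Z z t : eith (t + 2 * IZR z * PI) = eith t.
Proof.
  rewrite eith_plus. replace (eith (2 * IZR z * PI)) with (RtoC 1). ring.
  unfold eith. rewrite Rmult_assoc, cos_2a_sin, sin_2a, sin_IZR_PI. unfold RtoC. f_equal; ring.
Qed.
Lemma eith_INR_periodic j t : eith (- INR j * (t + 2 * PI)) = eith (- INR j * t).
Proof.
  rewrite <- (eith_2PI_Z (- Z.of_nat j) (- INR j * t)). f_equal. rewrite opp_IZR, <- INR_IZR_INZ. ring.
Qed.

Lemma coef_difference W h j : rcont W -> periodic W ->
  coef (fun t => RtoC (W (t + h) - W t)) j = Cmult (Cminus (eith (INR j * h)) 1) (coef (fun t => RtoC (W t)) j).
Proof.
  intros HW Hp. unfold coef. set (G := fun t => Cmult (RtoC (W t)) (eith (- INR j * t))).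
  assert (CG : ccont G) by (apply ccont_mult; [now apply ccont_RtoC|apply ccont_eith, rcont_lin]).
  assert (CGh : ccont (fun t => G (t + h))).
  { destruct CG as [G1 G2]. assert (Ch : rcont (fun t => t + h)) by (apply rcont_plus; [apply rcont_id|apply rcont_const]).
    split. apply (rcont_comp _ (fun t => Re (G t)) Ch G1). apply (rcont_comp _ (fun t => Im (G t)) Ch G2). }
  rewrite (mean_ext _ (fun t => Cminus (Cmult (eith (INR j * h)) (G (t + h))) (G t))).
  2:{ intro. unfold G. replace (- INR j * t) with (INR j * h + - INR j * (t + h)) at 1 2 by ring.
      rewrite eith_plus, RtoC_minus. ring. }
  rewrite mean_minus, mean_scal, (mean_shift G); auto using ccont_mult, ccont_const. ring.
  intro. unfold G. now rewrite Hp, eith_INR_periodic.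
Qed.

Lemma one_minus_cos_ge x : 0 <= x <= 1 -> x ^ 2 / 8 <= 1 - cos x.
Proof.
  intro H. replace x with (2 * (x / 2)) at 2 by field. rewrite cos_2a_sin.
  assert (H1 : Rabs (x / 2) <= 1) by (apply Rabs_le; lra).
  generalize (sin_taylor2 (x / 2) H1). intro H2. apply Rabs_le_between in H2.
  assert (x / 4 <= sin (x / 2)) by nra. nra.
Qed.

(* Bessel for the increment [W (t + 1/N) - W t], whose j-th coefficient has modulus at least [j / (2 N)] times that of [W]. *)
Lemma lipschitz_coef_sum W L N : periodic W -> (forall x y, Rabs (W x - W y) <= L * Rabs (x - y)) -> rcont W ->
  rsum (fun j => (INR j * Cmod (coef (fun t => RtoC (W t)) j)) ^ 2) N <= 4 * L ^ 2.
Proof.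
  intros Hp HL HW. destruct (Nat.eq_dec N 0) as [->|HN]. simpl. nra.
  assert (HN' : 0 < INR N) by (apply lt_0_INR; lia). set (h := / INR N).
  assert (Hh : 0 < h) by now apply Rinv_0_lt_compat.
  set (f := fun t => RtoC (W (t + h) - W t)).
  assert (Cf : ccont f).
  { apply ccont_RtoC, rcont_minus; auto. apply (rcont_comp (fun t => t + h) W); auto.
    apply rcont_plus; [apply rcont_id|apply rcont_const]. }
  assert (HL0 : 0 <= L).
  { generalize (HL 1 0) (Rabs_pos (W 1 - W 0)). rewrite Rminus_0_r, Rabs_R1. lra. }
  assert (H1 : nrm2 f <= (L * h) ^ 2).
  { rewrite <- nrm_sqr by auto. apply pow_incr. split. apply nrm_pos. apply nrm_le_sup; auto. nra.
    intro t. unfold f. rewrite Cmod_R. eapply Rle_trans. apply HL. replace (t + h - t) with h by ring. rewrite (Rabs_right h); lra. }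
  generalize (Bessel f N Cf). intro H2.
  assert (H3 : h ^ 2 / 4 * rsum (fun j => (INR j * Cmod (coef (fun t => RtoC (W t)) j)) ^ 2) N <= rsum (fun j => Cmod (coef f j) ^ 2) N).
  { rewrite <- rsum_scal. apply rsum_le. intros j Hj. unfold f. rewrite coef_difference by auto.
    rewrite Cmod_mult, !Rpow_mult_distr. rewrite <- Rmult_assoc. apply Rmult_le_compat_r. apply pow2_ge_0.
    rewrite Cmod_sqr. unfold eith; simpl.
    assert (Hx : 0 <= INR j * h <= 1).
    { generalize (pos_INR j). intro. split. nra. apply lt_INR in Hj. apply Rmult_le_reg_r with (INR N); auto.
      unfold h. rewrite Rmult_assoc, Rinv_l by lra. lra. }
    generalize (one_minus_cos_ge _ Hx) (sin2_cos2 (INR j * h)). unfold Rsqr. intros. simpl in *. nra. }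
  assert (0 < h ^ 2) by nra. apply Rmult_le_reg_l with (h ^ 2 / 4); [lra|]. nra.
Qed.

Lemma Derive_n_periodic V i : periodic V -> periodic (Derive_n V i).
Proof. intros Hp x. rewrite <- Derive_n_comp_trans. apply Derive_n_ext. apply Hp. Qed.
Lemma periodic_PI f : periodic f -> f PI = f (- PI).
Proof. intro H. rewrite <- (H (- PI)). f_equal. ring. Qed.

Lemma lipschitz_rcont W L : (forall x y, Rabs (W x - W y) <= L * Rabs (x - y)) -> rcont W.
Proof.
  intros HL x. apply continuity_pt_filterlim. intros eps He.
  assert (HL0 : 0 <= L).
  { generalize (HL 1 0) (Rabs_pos (W 1 - W 0)). rewrite Rminus_0_r, Rabs_R1. lra. }
  exists (eps / (L + 1)). split. apply Rmult_lt_0_compat; auto. apply Rinv_0_lt_compat; lra.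
  intros y [_ Hy]. simpl in *. unfold R_dist, Rdist in *. eapply Rle_lt_trans. apply HL.
  apply Rle_lt_trans with ((L + 1) * Rabs (y - x)). generalize (Rabs_pos (y - x)); nra.
  apply Rlt_le_trans with ((L + 1) * (eps / (L + 1))). apply Rmult_lt_compat_l; lra. right; field; lra.
Qed.

Lemma CmLip_rcont m V i : CmLip m V -> (i <= m)%nat -> rcont (Derive_n V i).
Proof.
  intros (Hp & Hd & L & HL) Hi. destruct (Nat.eq_dec i m) as [->|Hn].
  - now apply (lipschitz_rcont _ L).
  - intro x. apply (ex_derive_continuous (Derive_n V i)). apply (Hd (S i) x). lia.
Qed.

Lemma CmLip_coef m V i j : CmLip m V -> (i <= m)%nat ->
  Cmod (coef (fun t => RtoC (Derive_n V i t)) j) = INR j ^ i * Cmod (coef (fun t => RtoC (V t)) j).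
Proof.
  intros HV. induction i; intro Hi.
  - simpl. ring.
  - rewrite (coef_derive (Derive_n V i) (Derive_n V (S i))). rewrite IHi by lia. simpl. ring.
    + intro t. apply Derive_correct. apply (proj1 (proj2 HV) (S i) t). lia.
    + now apply (CmLip_rcont m).
    + apply periodic_PI, Derive_n_periodic. exact (proj1 HV).
Qed.

(** Integration by parts accounts for j^m. The Lipschitz bound on the last derivative supplies one
    more power through finite differences, so the weight is the one that m + 1 square integrable
    derivatives would give. *)
Lemma CmLip_coef_sum m V : CmLip m V -> exists S, 0 <= S /\ forall N,
  rsum (fun j => (INR j ^ (m + 1) * Cmod (coef (fun t => RtoC (V t)) j)) ^ 2) N <= S.
Proof.
  intro HV. destruct (proj2 (proj2 HV)) as (L & HL). exists (4 * L ^ 2). split. nra.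
  intro N. eapply Rle_trans; [|apply (lipschitz_coef_sum (Derive_n V m) L N)]; auto.
  - right. apply rsum_ext. intros j _. rewrite (CmLip_coef m) by auto. rewrite pow_add, pow_1. ring.
  - apply Derive_n_periodic. exact (proj1 HV).
  - now apply (CmLip_rcont m).
Qed.

(** * Pointwise convergence of Fourier series *)

Definition dirichlet (m : nat) (t : R) : R := 1 + 2 * rsum (fun j => cos (INR (S j) * t)) m.

(** The closed form sin((m + 1/2) t), left expanded so that each term carries an integer frequency
    to which [Riemann_Lebesgue] applies. *)
Lemma dirichlet_sin m t : sin (t / 2) * dirichlet m t = sin (INR m * t) * cos (t / 2) + cos (INR m * t) * sin (t / 2).
Proof.
  unfold dirichlet. induction m.
  - simpl. rewrite Rmult_0_l, sin_0, cos_0. ring.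
  - cbn [rsum]. rewrite S_INR. 
    transitivity (sin (t / 2) * (1 + 2 * rsum (fun j => cos (INR (S j) * t)) m) + 2 * sin (t / 2) * cos ((INR m + 1) * t)). ring.
    rewrite IHm. replace (INR m * t) with ((INR m + 1) * t - 2 * (t / 2)) by field.
    set (A := (INR m + 1) * t). set (B := t / 2). rewrite sin_minus, cos_minus, sin_2a, cos_2a.
    generalize (sin2_cos2 B). unfold Rsqr. intro H.
    replace (cos B * cos B) with (1 - sin B * sin B) by lra. 
    transitivity (sin A * cos B * (1 - 2 * (sin B * sin B)) - cos A * (2 * sin B * (cos B * cos B)) + (cos A * (1 - 2 * (sin B * sin B)) + sin A * (2 * sin B * cos B)) * sin B + 2 * sin B * cos A). ring.
    replace (cos B * cos B) with (1 - sin B * sin B) by lra. ring.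
Qed.
Lemma rcont_rsum (f : nat -> R -> R) N : (forall j, rcont (f j)) -> rcont (fun t => rsum (fun j => f j t) N).
Proof. intro H. induction N; simpl. apply rcont_const. apply rcont_plus; auto. Qed.
Lemma rmean_rsum (f : nat -> R -> R) N : (forall j, rcont (f j)) ->
  rmean (fun t => rsum (fun j => f j t) N) = rsum (fun j => rmean (f j)) N.
Proof. intro H. induction N; simpl. apply rmean_const. rewrite rmean_plus, IHN; auto using rcont_rsum. Qed.
Lemma rcont_dirichlet m : rcont (dirichlet m).
Proof.
  apply rcont_plus. apply rcont_const. apply rcont_mult. apply rcont_const.
  apply (rcont_rsum (fun j t => cos (INR (S j) * t))). intro; apply rcont_cos_lin.
Qed.
Lemma rmean_cos j : rmean (fun t => cos (INR (S j) * t)) = 0.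
Proof.
  generalize (mean_eith_nat (S j)). rewrite mean_pair. intro H. apply (f_equal Re) in H. exact H.
Qed.
Lemma rmean_dirichlet m : rmean (dirichlet m) = 1.
Proof.
  unfold dirichlet. assert (H : rcont (fun t => rsum (fun j => cos (INR (S j) * t)) m)).
  { apply (rcont_rsum (fun j t => cos (INR (S j) * t))). intro; apply rcont_cos_lin. }
  rewrite rmean_plus, rmean_const, rmean_scal; auto using rcont_const, rcont_mult.
  rewrite (rmean_rsum (fun j t => cos (INR (S j) * t))) by (intro; apply rcont_cos_lin).
  rewrite (rsum_ext _ (fun _ => 0)). rewrite rsum_const. ring. intros; apply rmean_cos.
Qed.

Lemma coef_translate W x j : rcont W -> periodic W ->
  coef (fun t => RtoC (W (t + x))) j = Cmult (coef (fun t => RtoC (W t)) j) (eith (INR j * x)).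
Proof.
  intros HW Hp. generalize (coef_difference W x j HW Hp). unfold coef. intro H.
  assert (Cx : rcont (fun t => W (t + x))).
  { apply (rcont_comp (fun t => t + x) W); auto. apply rcont_plus; [apply rcont_id|apply rcont_const]. }
  assert (Ce : ccont (fun t => eith (- INR j * t))) by apply ccont_eith, rcont_lin.
  rewrite (mean_ext _ (fun t => Cminus (Cmult (RtoC (W (t + x))) (eith (- INR j * t))) (Cmult (RtoC (W t)) (eith (- INR j * t))))) in H.
  2:{ intro. rewrite RtoC_minus. ring. }
  rewrite mean_minus in H by (apply ccont_mult; auto using ccont_RtoC).
  replace (mean (fun t => Cmult (RtoC (W (t + x))) (eith (- INR j * t)))) with
    (Cplus (Cminus (mean (fun t => Cmult (RtoC (W (t + x))) (eith (- INR j * t)))) (mean (fun t => Cmult (RtoC (W t)) (eith (- INR j * t))))) (mean (fun t => Cmult (RtoC (W t)) (eith (- INR j * t))))) by ring.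
  rewrite H. ring.
Qed.

Definition quot0 (f : R -> R) (l : R) (t : R) : R := if Req_dec_T t 0 then l else f t / t.

Lemma rcont_quot0 f l : rcont f -> f 0 = 0 -> is_derive f 0 l -> rcont (quot0 f l).
Proof.
  intros Hf H0 Hd t. destruct (Req_dec_T t 0) as [->|Ht].
  - apply continuity_pt_filterlim. intros eps He.
    apply is_derive_Reals in Hd. destruct (Hd eps He) as (del & Hdel).
    exists del. split. apply cond_pos. intros y [[_ Hy1] Hy2]. simpl in *. unfold R_dist, Rdist in *. 
    unfold quot0. destruct (Req_dec_T 0 0) as [_|]; [|lra]. destruct (Req_dec_T y 0) as [Hy|Hy]; [exfalso; auto|].
    rewrite Rminus_0_r in Hy2. generalize (Hdel y Hy Hy2). rewrite Rplus_0_l, H0, Rminus_0_r. auto.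
  - apply (continuous_ext_loc _ (fun t => f t * / t)).
    + assert (Hp : 0 < Rabs t) by now apply Rabs_pos_lt. exists (mkposreal _ Hp). intros y Hy.
      unfold quot0. destruct (Req_dec_T y 0) as [->|]; auto. exfalso.
      change (Rabs (0 - t) < Rabs t) in Hy. rewrite Rminus_0_l, Rabs_Ropp in Hy. lra.
    + apply (continuous_mult f (fun t => / t)). apply Hf. now apply continuous_Rinv.
Qed.

(** The projection of the line onto [-PI, PI]. Functions here must be continuous on the whole line,
    while division by sin(t/2) is harmless only on this interval, once the zero at 0 is removed. *)
Definition clamp (t : R) : R := (Rabs (t + PI) - Rabs (t - PI)) / 2.

Lemma rcont_clamp : rcont clamp.
Proof.
  apply rcont_mult; [|apply rcont_const].
  apply rcont_minus; [apply (rcont_comp (fun t => t + PI) Rabs)|apply (rcont_comp (fun t => t - PI) Rabs)];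
    try (intro; apply continuous_Rabs).
  apply rcont_plus; [apply rcont_id|apply rcont_const]. apply rcont_minus; [apply rcont_id|apply rcont_const].
Qed.
Lemma clamp_bound t : - PI <= clamp t <= PI.
Proof. generalize PI_RGT_0. unfold clamp, Rabs. destruct Rcase_abs, Rcase_abs; lra. Qed.
Lemma clamp_id t : - PI < t < PI -> clamp t = t.
Proof. generalize PI_RGT_0. unfold clamp, Rabs. destruct Rcase_abs, Rcase_abs; lra. Qed.

Lemma sin_half_nz t : t <> 0 -> - PI <= t <= PI -> sin (t / 2) <> 0.
Proof.
  intros Ht H. generalize PI_RGT_0; intro. destruct (Rlt_le_dec 0 t).
  - apply Rgt_not_eq, sin_gt_0; lra.
  - apply Rlt_not_eq. replace (t / 2) with (- (- t / 2)) by field. rewrite sin_neg.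
    assert (0 < sin (- t / 2)) by (apply sin_gt_0; lra). lra.
Qed.

(** [rho] is the quotient of f(t)/t by sin(t/2)/t, each extended continuously to 0 by its derivative
    there and evaluated at the clamped argument. *)
Lemma divide_sin_half f : rcont f -> f 0 = 0 -> ex_derive f 0 ->
  exists rho, rcont rho /\ forall t, - PI < t < PI -> f t = rho t * sin (t / 2).
Proof.
  intros Hf H0 (l & Hl).
  set (s := fun t => sin (t / 2)).
  assert (Hs : rcont s). { apply (rcont_comp (fun t => t / 2) sin). apply rcont_mult; [apply rcont_id|apply rcont_const]. apply rcont_sin. }
  assert (Hs0 : s 0 = 0). { unfold s. replace (0 / 2) with 0 by field. apply sin_0. }
  assert (Hsd : is_derive s 0 (1 / 2)). { unfold s. auto_derive; auto. replace (0 * / 2) with 0 by field. rewrite cos_0. field. }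
  exists (fun t => quot0 f l (clamp t) * / quot0 s (1 / 2) (clamp t)). split.
  - apply rcont_mult. apply (rcont_comp clamp). apply rcont_clamp. now apply rcont_quot0.
    intro t. apply continuous_Rinv_comp. apply (rcont_comp clamp). apply rcont_clamp. now apply rcont_quot0.
    unfold quot0. destruct (Req_dec_T (clamp t) 0) as [H|H]. lra.
    apply Rmult_integral_contrapositive. split. apply sin_half_nz; auto. apply clamp_bound. now apply Rinv_neq_0_compat.
  - intros t Ht. rewrite clamp_id by auto. unfold quot0. destruct (Req_dec_T t 0) as [->|H].
    rewrite H0. replace (0 / 2) with 0 by field. rewrite sin_0. ring.
    unfold s. field. split; auto. apply sin_half_nz; auto. lra.
Qed.

Lemma rmean_ext_in f g : (forall t, - PI < t < PI -> f t = g t) -> rmean f = rmean g.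
Proof.
  intro H. unfold rmean. f_equal. apply RInt_ext. intros x Hx. generalize PI_RGT_0; intro.
  rewrite Rmin_left, Rmax_right in Hx by lra. auto.
Qed.

(** Dirichlet's argument: the error is the mean of V(t+x) - V(x) against the kernel.
    Differentiability at x allows division by sin(t/2), after which the integrand is h sin(mt) + f
    cos(mt) with fixed continuous h and f. *)
Lemma fourier_pointwise V x : rcont V -> periodic V -> ex_derive V x ->
  forall eps, 0 < eps -> exists N0, forall m, (N0 <= m)%nat ->
  Rabs (rmean V + 2 * Re (apart (coef (fun t => RtoC (V t))) m (0, x)) - V x) <= eps.
Proof.
  intros HV Hp Hd eps He.
  set (Vx := fun t => V (t + x)). set (f := fun t => Vx t - V x).
  assert (HVx : rcont Vx).
  { apply (rcont_comp (fun t => t + x) V); auto. apply rcont_plus; [apply rcont_id|apply rcont_const]. }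
  assert (Hf : rcont f) by (apply rcont_minus; auto using rcont_const).
  destruct (divide_sin_half f Hf) as (rho & Hrho & Hr).
  { unfold f, Vx. rewrite Rplus_0_l. ring. }
  { destruct Hd as (l & Hl). exists l. unfold f, Vx. auto_derive. rewrite Rplus_0_l. now exists l.
    rewrite Rplus_0_l. rewrite (is_derive_unique (fun x : R => V x) x l Hl). ring. }
  set (h := fun t => rho t * cos (/ 2 * t)).
  assert (Hh : rcont h) by (apply rcont_mult; auto using rcont_cos_lin).
  destruct (Riemann_Lebesgue _ (ccont_RtoC _ Hf) (eps / 2)) as (N1 & HN1). lra.
  destruct (Riemann_Lebesgue _ (ccont_RtoC _ Hh) (eps / 2)) as (N2 & HN2). lra.
  exists (max N1 N2). intros m Hm.
  assert (E1 : rmean V + 2 * Re (apart (coef (fun t => RtoC (V t))) m (0, x)) = rmean (fun t => Vx t * dirichlet m t)).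
  { rewrite apart_line, Re_csum.
    rewrite (rsum_ext _ (fun j => rmean (fun t => Vx t * cos (INR (S j) * t)))).
    2:{ intros j _. rewrite <- coef_translate by auto. rewrite (coef_real Vx) by auto. reflexivity. }
    rewrite <- (rmean_rsum (fun j t => Vx t * cos (INR (S j) * t))) by (intro; apply rcont_mult; auto using rcont_cos_lin).
    assert (C1 : rcont (fun t => rsum (fun j => Vx t * cos (INR (S j) * t)) m)).
    { apply (rcont_rsum (fun j t => Vx t * cos (INR (S j) * t))). intro; apply rcont_mult; auto using rcont_cos_lin. }
    rewrite <- (rmean_shift V x) by auto. rewrite <- rmean_scal, <- rmean_plus; auto using rcont_mult, rcont_const.
    apply rmean_ext. intro t. unfold dirichlet. rewrite rsum_scal. unfold Vx. ring. }
  rewrite E1.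
  replace (rmean (fun t => Vx t * dirichlet m t) - V x) with (rmean (fun t => f t * dirichlet m t)).
  2:{ rewrite (rmean_ext _ (fun t => Vx t * dirichlet m t - V x * dirichlet m t)) by (intro; unfold f; ring).
      rewrite rmean_minus, rmean_scal, rmean_dirichlet; auto using rcont_mult, rcont_const, rcont_dirichlet. ring. }
  rewrite (rmean_ext_in _ (fun t => h t * sin (INR m * t) + f t * cos (INR m * t))).
  2:{ intros t Ht. unfold h. replace (/ 2 * t) with (t / 2) by field.
      transitivity (rho t * (sin (t / 2) * dirichlet m t)). rewrite (Hr t Ht). ring.
      rewrite dirichlet_sin, (Hr t Ht). ring. }
  rewrite rmean_plus; auto using rcont_mult, rcont_cos_lin, rcont_sin_lin.
  generalize (HN1 m ltac:(lia)) (HN2 m ltac:(lia)). intros B1 B2.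
  generalize (re_le_Cmod (coef (fun t => RtoC (f t)) m)) (im_le_Cmod (coef (fun t => RtoC (h t)) m)).
  rewrite (coef_real f), (coef_real h) in * by auto. cbn [Re Im fst snd]. rewrite Rabs_Ropp. intros.
  eapply Rle_trans. apply Rabs_triang. lra.
Qed.

Lemma cauchy_rate (u e : nat -> R) : (forall N M, (N <= M)%nat -> Rabs (u M - u N) <= e N) ->
  (forall eps, 0 < eps -> exists N0, forall N, (N0 <= N)%nat -> e N <= eps) ->
  exists l : R, is_lim_seq u l /\ forall N, Rabs (u N - l) <= e N.
Proof.
  intros H He.
  assert (Hc : ex_finite_lim_seq u).
  { apply ex_lim_seq_cauchy_corr. intro eps. destruct (He (eps / 3)) as (N0 & HN0). generalize (cond_pos eps); lra.
    exists N0. intros n m Hn Hm. generalize (H N0 n Hn) (H N0 m Hm) (HN0 N0 (le_n _)) (cond_pos eps). intros.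
    replace (u n - u m) with ((u n - u N0) - (u m - u N0)) by ring.
    eapply Rle_lt_trans. apply Rabs_triang. rewrite Rabs_Ropp. lra. }
  destruct Hc as (l & Hl). exists l. split; auto. intro N. rewrite Rabs_minus_sym.
  apply Rabs_le. apply (is_lim_seq_incr_n u N) in Hl. split.
  - assert (Rbar_le (u N - e N) l). { apply (is_lim_seq_le (fun _ => u N - e N) (fun n => u (n + N)%nat)); auto.
      intro n. generalize (H N (n + N)%nat ltac:(lia)). intro H'. apply Rabs_le_between in H'. lra. apply is_lim_seq_const. }
    simpl in H0. lra.
  - assert (Rbar_le l (u N + e N)). { apply (is_lim_seq_le (fun n => u (n + N)%nat) (fun _ => u N + e N)); auto.
      intro n. generalize (H N (n + N)%nat ltac:(lia)). intro H'. apply Rabs_le_between in H'. lra. apply is_lim_seq_const. }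
    simpl in H0. lra.
Qed.

(** Every omitted index is at least m + 1, so |a_j| <= j |a_j| / (m + 1). This division makes the
    uniform error o(1/n) when m is comparable to n, which offsets the factor n in the phase. *)
Lemma apart_diff a th : (forall N M, (N <= M)%nat ->
    rsum (fun j => INR (S j) * Cmod (a (S j))) M - rsum (fun j => INR (S j) * Cmod (a (S j))) N <= th N) ->
  forall m M t, (m <= M)%nat -> Cmod (Cminus (apart a M (0, t)) (apart a m (0, t))) <= th m / INR (S m).
Proof.
  intros H m M t HM. generalize (H m M HM). intro H1.
  assert (Hp : 0 < INR (S m)) by (apply lt_0_INR; lia).
  apply Rle_trans with ((rsum (fun j => INR (S j) * Cmod (a (S j))) M - rsum (fun j => INR (S j) * Cmod (a (S j))) m) / INR (S m)).
  2:{ apply Rmult_le_compat_r; auto. left; now apply Rinv_0_lt_compat. }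
  clear H H1. induction HM.
  - replace (Cminus _ _) with (RtoC 0) by ring. rewrite Cmod_0. unfold Rminus. rewrite Rplus_opp_r. lra.
  - rewrite !apart_line in *. cbn [rsum csum].
    replace (Cminus _ _) with (Cplus (Cminus (csum (fun j => Cmult (a (S j)) (eith (INR (S j) * t))) m0) (csum (fun j => Cmult (a (S j)) (eith (INR (S j) * t))) m)) (Cmult (a (S m0)) (eith (INR (S m0) * t)))) by ring.
    eapply Rle_trans. apply Cmod_triangle. rewrite Cmod_mult, Cmod_eith, Rmult_1_r.
    assert (HH : Cmod (a (S m0)) <= INR (S m0) * Cmod (a (S m0)) / INR (S m)).
    { apply Rmult_le_reg_r with (INR (S m)); auto. unfold Rdiv. rewrite Rmult_assoc, Rinv_l, Rmult_1_r by lra.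
      rewrite Rmult_comm. apply Rmult_le_compat_r. apply Cmod_ge_0. apply le_INR. lia. }
    unfold Rdiv in *. nra.
Qed.

(** * The boundary function and the derivative of kappa *)

Definition rcoef (V : R -> R) : nat -> C := coef (fun t => RtoC (V t)).
(* The boundary function F = sum_{j>=1} V_j z^j, so that V = V0 + 2 Re F and kappa = t - 2 Im F. *)
Definition potential (V : R -> R) (t : R) : C := ((V t - V0 V) / 2, - Omega V t / 2).

Lemma fourier_neg V j : rcont V -> fourier V (- Z.of_nat j) = Cconj (rcoef V j).
Proof.
  intro HV. unfold rcoef, coef. rewrite <- mean_conj.
  2: apply ccont_mult; [now apply ccont_RtoC|apply ccont_eith, rcont_lin].
  change (fourier V (- Z.of_nat j)) with (mean (fun t => Cmult (RtoC (V t)) (eith (- IZR (- Z.of_nat j) * t)))).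
  apply mean_ext. intro t. rewrite Cmult_conj, eith_conj, opp_IZR, <- INR_IZR_INZ. f_equal.
  unfold Cconj, RtoC; simpl; f_equal; ring. f_equal. ring.
Qed.

Lemma rsum_shift g N : rsum g (S N) = g 0%nat + rsum (fun j => g (S j)) N.
Proof. induction N. simpl; ring. change (rsum g (S (S N))) with (rsum g (S N) + g (S N)). rewrite IHN. cbn [rsum]. ring. Qed.

Lemma rsum_inv_sqr N : rsum (fun j => / INR (S j) ^ 2) N <= 2.
Proof.
  assert (H : forall N, rsum (fun j => / INR (S j) ^ 2) (S N) <= 2 - / INR (S N)).
  { clear. induction N. simpl. lra.
    change (rsum (fun j => / INR (S j) ^ 2) (S (S N))) with (rsum (fun j => / INR (S j) ^ 2) (S N) + / INR (S (S N)) ^ 2).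
    assert (Hp : 0 < INR (S N)) by (apply lt_0_INR; lia). rewrite (S_INR (S N)).
    assert (/ (INR (S N) + 1) ^ 2 <= / INR (S N) - / (INR (S N) + 1)); [|lra].
    replace (/ INR (S N) - / (INR (S N) + 1)) with (/ (INR (S N) * (INR (S N) + 1))) by (field; lra).
    apply Rinv_le_contravar; nra. }
  destruct N. simpl; lra. eapply Rle_trans. apply H.
  assert (0 < / INR (S N)) by (apply Rinv_0_lt_compat, lt_0_INR; lia). lra.
Qed.

Lemma weighted_sum_le (a : nat -> C) k A0 : (2 <= k)%nat ->
  (forall N, rsum (fun j => (INR j ^ k * Cmod (a j)) ^ 2) N <= A0) ->
  forall N, rsum (fun j => (INR (S j) ^ 2 * Cmod (a (S j))) ^ 2) N <= A0.
Proof.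
  intros Hk H N. apply Rle_trans with (rsum (fun j => (INR (S j) ^ k * Cmod (a (S j))) ^ 2) N).
  - apply rsum_le. intros j _. apply pow_incr. split. apply Rmult_le_pos. apply pow2_ge_0. apply Cmod_ge_0.
    apply Rmult_le_compat_r. apply Cmod_ge_0. apply Rle_pow; auto. rewrite S_INR. generalize (pos_INR j); lra.
  - eapply Rle_trans; [|apply (H (S N))]. rewrite rsum_shift. generalize (pow2_ge_0 (INR 0 ^ k * Cmod (a 0%nat))). lra.
Qed.
(** j |a_j| is the product of j^2 |a_j| and 1/j, both square summable; this is where [2 <= k]
    enters. *)
Lemma weighted_sum1_le (a : nat -> C) k A0 : (2 <= k)%nat ->
  (forall N, rsum (fun j => (INR j ^ k * Cmod (a j)) ^ 2) N <= A0) ->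
  forall N, rsum (fun j => INR (S j) * Cmod (a (S j))) N <= A0 / 2 + 1.
Proof.
  intros Hk H N.
  apply Rle_trans with (rsum (fun j => / 2 * ((INR (S j) ^ 2 * Cmod (a (S j))) ^ 2 + / INR (S j) ^ 2)) N).
  - apply rsum_le. intros j _. assert (Hp : 0 < INR (S j)) by (apply lt_0_INR; lia).
    generalize (pow2_ge_0 (INR (S j) ^ 2 * Cmod (a (S j)) - / INR (S j))). intro H0.
    replace (INR (S j) * Cmod (a (S j))) with ((INR (S j) ^ 2 * Cmod (a (S j))) * / INR (S j)) by (field; lra).
    replace (/ INR (S j) ^ 2) with (/ INR (S j) * / INR (S j)) by (field; lra). nra.
  - rewrite rsum_scal, rsum_plus. generalize (weighted_sum_le a k A0 Hk H N) (rsum_inv_sqr N). lra.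
Qed.
(** The arithmetic-geometric inequality with a free weight. With [lam] of size sqrt n and at most n
    terms, the sum is O(sqrt n). *)
Lemma weighted_sum2_le (a : nat -> C) k A0 lam : (2 <= k)%nat -> 0 < lam ->
  (forall N, rsum (fun j => (INR j ^ k * Cmod (a j)) ^ 2) N <= A0) ->
  forall N, rsum (fun j => INR (S j) ^ 2 * Cmod (a (S j))) N <= / 2 * (lam * A0 + INR N * / lam).
Proof.
  intros Hk Hl H N.
  apply Rle_trans with (rsum (fun j => / 2 * (lam * (INR (S j) ^ 2 * Cmod (a (S j))) ^ 2 + / lam)) N).
  - apply rsum_le. intros j _. set (x := INR (S j) ^ 2 * Cmod (a (S j))).
    assert (Hi : 0 < / lam) by now apply Rinv_0_lt_compat.
    assert (0 <= / lam * (lam * x - 1) ^ 2) by (apply Rmult_le_pos; [lra|apply pow2_ge_0]).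
    replace (/ lam * (lam * x - 1) ^ 2) with (lam * x ^ 2 - 2 * x + / lam) in H0 by (field; lra). lra.
  - rewrite rsum_scal, rsum_plus, rsum_scal, rsum_const. apply Rmult_le_compat_l. lra. apply Rplus_le_compat_r.
    apply Rmult_le_compat_l. lra. now apply (weighted_sum_le a k).
Qed.

(** The real part of [potential] is given by V and its imaginary part by the series [Omega].
    Pointwise convergence of the Fourier series identifies both with the limit of the truncations,
    and the absolute tails [th] then turn this into a uniform rate. *)
Lemma potential_limit m V : (1 <= m)%nat -> CmLip m V -> exists A0 th, 0 <= A0 /\
  (forall N, rsum (fun j => (INR j ^ (m + 1) * Cmod (rcoef V j)) ^ 2) N <= A0) /\
  (forall N M, (N <= M)%nat -> rsum (fun j => INR (S j) * Cmod (rcoef V (S j))) M -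
     rsum (fun j => INR (S j) * Cmod (rcoef V (S j))) N <= th N) /\
  (forall N, 0 <= th N) /\
  (forall eps, 0 < eps -> exists N0, forall N, (N0 <= N)%nat -> th N <= eps) /\
  forall t M, Cmod (Cminus (potential V t) (apart (rcoef V) M (0, t))) <= th M / INR (S M).
Proof.
  intros Hm HV. assert (HVc : rcont V) by exact (CmLip_rcont m V 0 HV ltac:(lia)).
  destruct (CmLip_coef_sum m V HV) as (A0 & HS & HSum). fold (rcoef V) in HSum.
  destruct (bounded_tail (fun j => INR (S j) * Cmod (rcoef V (S j))) (A0 / 2 + 1)) as (th & H1 & H2 & H3).
  { intro. apply Rmult_le_pos. apply pos_INR. apply Cmod_ge_0. }
  { apply (weighted_sum1_le _ (m + 1)); auto. lia. }
  exists A0, th. do 5 (split; auto).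
  set (a := rcoef V) in *.
  assert (Hdiff := apart_diff a th H1).
  assert (Hinv : forall N, th N / INR (S N) <= th N).
  { intro. rewrite <- (Rmult_1_r (th N)) at 2. apply Rmult_le_compat_l; auto. rewrite <- Rinv_1. apply Rinv_le_contravar. lra.
    rewrite S_INR. generalize (pos_INR N); lra. }
  assert (Hpt : forall t eps, 0 < eps -> exists N0, forall M, (N0 <= M)%nat -> Cmod (Cminus (potential V t) (apart a M (0, t))) <= eps).
  { intros t eps He.
    set (u := fun j => Im (Cmult (fourier V (- Z.of_nat (S j))) (eith (- INR (S j) * t)))).
    assert (Hu : forall M, rsum u M = - Im (apart a M (0, t))).
    { intro M. rewrite apart_line, Im_csum. replace (- rsum (fun j => Im (Cmult (a (S j)) (eith (INR (S j) * t)))) M) with ((-1) * rsum (fun j => Im (Cmult (a (S j)) (eith (INR (S j) * t)))) M) by ring.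
      rewrite <- rsum_scal. apply rsum_ext. intros j _. unfold u. rewrite fourier_neg by auto. fold a.
      replace (- INR (S j) * t) with (- (INR (S j) * t)) by ring. rewrite <- eith_conj, <- Cmult_conj, im_conj. ring. }
    destruct (cauchy_rate (rsum u) (fun N => th N / INR (S N))) as (l & Hl & Hlr).
    { intros N M HNM. rewrite !Hu. replace (- Im (apart a M (0, t)) - - Im (apart a N (0, t))) with (- Im (Cminus (apart a M (0, t)) (apart a N (0, t)))) by (simpl; unfold Im; ring).
      rewrite Rabs_Ropp. eapply Rle_trans. apply im_le_Cmod. now apply Hdiff. }
    { intros e He'. destruct (H3 e He') as (N0 & HN0). exists N0. intros N HN. eapply Rle_trans. apply Hinv. auto. }
    assert (HO : Omega V t = 2 * l).
    { unfold Omega. fold u. f_equal. apply is_series_unique. unfold is_series.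
      (* The partial sums of a series include the term of index n, whereas [rsum u n] stops before
         it. *)
      apply (is_lim_seq_incr_1 (rsum u)) in Hl. eapply filterlim_ext; [|exact Hl].
      intro n. simpl. induction n. simpl. rewrite sum_O. ring. rewrite sum_Sn, <- IHn. reflexivity. }
    destruct (fourier_pointwise V t HVc (proj1 HV) (proj1 (proj2 HV) 1%nat t ltac:(lia)) eps He) as (N1 & HN1).
    change (coef (fun t => RtoC (V t))) with a in HN1.
    destruct (H3 (eps / 2)) as (N2 & HN2). lra.
    exists (max N1 N2). intros M HM. eapply Rle_trans. apply Cmod_le_abs.
    replace (Re (Cminus (potential V t) (apart a M (0, t)))) with (- (/ 2 * (rmean V + 2 * Re (apart a M (0, t)) - V t))) by (change (V0 V) with (rmean V); simpl; unfold Re, V0, rmean; field; apply PI_neq0).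
    replace (Im (Cminus (potential V t) (apart a M (0, t)))) with (rsum u M - l) by (rewrite Hu; simpl; rewrite HO; unfold Im; field).
    rewrite Rabs_Ropp, Rabs_mult, (Rabs_right (/ 2)) by lra.
    apply Rle_trans with (/ 2 * eps + eps / 2); [apply Rplus_le_compat|lra].
    - apply Rmult_le_compat_l; [lra|]. apply HN1. lia.
    - eapply Rle_trans. apply Hlr. eapply Rle_trans. apply Hinv. apply HN2. lia. }
  (* Compare with a far truncation: its distance from the limit is arbitrarily small, and its
     distance from truncation M is bounded uniformly in t. *)
  intros t M. apply le_epsilon. intros eps He. destruct (Hpt t eps He) as (N0 & HN0).
  generalize (HN0 (max N0 M) ltac:(lia)) (Hdiff M (max N0 M) t ltac:(lia)). intros.
  replace (Cminus (potential V t) (apart a M (0, t))) with (Cplus (Cminus (potential V t) (apart a (max N0 M) (0, t))) (Cminus (apart a (max N0 M) (0, t)) (apart a M (0, t)))) by ring.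
  eapply Rle_trans. apply Cmod_triangle. lra.
Qed.

(** By Parseval only the indices j > M remain, and for these 1 <= (j / (M+1))^k. *)
Lemma nrm_apart_diff a k A0 M N : (forall N, rsum (fun j => (INR j ^ k * Cmod (a j)) ^ 2) N <= A0) -> 0 <= A0 -> (M <= N)%nat ->
  nrm (fun t => Cminus (apart a N (0, t)) (apart a M (0, t))) <= sqrt A0 / INR (S M) ^ k.
Proof.
  intros HS HS0 HMN. set (b := fun j => if Nat.leb j M then RtoC 0 else a j).
  assert (E : forall s, Cminus (apart a N s) (apart a M s) = apoly b (S N) s).
  { intro s. induction HMN.
    - unfold apoly. rewrite csum_zero. ring. intros j Hj. unfold b. replace (Nat.leb j M) with true by (symmetry; apply Nat.leb_le; lia). ring.
    - change (apoly b (S (S m)) s) with (Cplus (apoly b (S m) s) (Cmult (b (S m)) (cexp (Cmult (RtoC (INR (S m))) s)))).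
      rewrite <- IHHMN. unfold b. replace (Nat.leb (S m) M) with false by (symmetry; apply Nat.leb_gt; lia).
      unfold apart at 1. cbn [csum]. fold (apart a m s). ring. }
  rewrite (nrm_ext _ (fun t => apoly b (S N) (0, t))) by (intro; apply E).
  assert (Hp : 0 < INR (S M)) by (apply lt_0_INR; lia).
  assert (Hpk : 0 < INR (S M) ^ k) by now apply pow_lt.
  unfold nrm. rewrite <- (sqrt_pow2 (sqrt A0 / INR (S M) ^ k)).
  2:{ apply Rmult_le_pos. apply sqrt_pos. left; now apply Rinv_0_lt_compat. }
  apply sqrt_le_1_alt. rewrite nrm2_apoly. unfold Rdiv. rewrite Rpow_mult_distr, pow2_sqrt by auto.
  apply Rle_trans with (rsum (fun j => (/ INR (S M) ^ k) ^ 2 * (INR j ^ k * Cmod (a j)) ^ 2) (S N)).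
  - apply rsum_le. intros j _. rewrite Rmult_0_r, Rmult_0_r, exp_0, Rmult_1_r. unfold b. destruct (Nat.leb_spec j M).
    + rewrite Cmod_0. rewrite <- Rpow_mult_distr. simpl. rewrite !Rmult_0_l. apply (pow2_ge_0 (/ INR (S M) ^ k * (INR j ^ k * Cmod (a j)))).
    + rewrite <- Rpow_mult_distr. apply pow_incr. split. apply Cmod_ge_0. rewrite <- Rmult_assoc.
      rewrite <- (Rmult_1_l (Cmod (a j))) at 1. apply Rmult_le_compat_r. apply Cmod_ge_0.
      apply Rmult_le_reg_l with (INR (S M) ^ k); auto. rewrite <- Rmult_assoc, Rinv_r, Rmult_1_r, Rmult_1_l by lra.
      apply pow_incr. split. lra. apply le_INR. lia.
  - rewrite rsum_scal, Rmult_comm. apply Rmult_le_compat_r. apply pow2_ge_0. auto.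
Qed.

Lemma nrm_potential_diff V k A0 th M : ccont (potential V) ->
  (forall N, rsum (fun j => (INR j ^ k * Cmod (rcoef V j)) ^ 2) N <= A0) -> 0 <= A0 ->
  (forall eps, 0 < eps -> exists N0, forall N, (N0 <= N)%nat -> th N <= eps) ->
  (forall N, 0 <= th N) ->
  (forall t M, Cmod (Cminus (potential V t) (apart (rcoef V) M (0, t))) <= th M / INR (S M)) ->
  nrm (fun t => Cminus (potential V t) (apart (rcoef V) M (0, t))) <= sqrt A0 / INR (S M) ^ k.
Proof.
  intros HF HS HS0 H3 H2 Hlim. apply le_epsilon. intros eps He. destruct (H3 eps He) as (N0 & HN0).
  set (N := max N0 M). set (a := rcoef V) in *.
  assert (CA : forall m, ccont (fun t => apart a m (0, t))) by (intro; apply ccont_isA, isA_apart).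
  rewrite (nrm_ext _ (fun t => Cplus (Cminus (apart a N (0, t)) (apart a M (0, t))) (Cminus (potential V t) (apart a N (0, t))))) by (intro; ring).
  eapply Rle_trans. apply nrm_triangle; auto using ccont_minus. apply Rplus_le_compat.
  - apply nrm_apart_diff; auto. unfold N; lia.
  - apply nrm_le_sup; auto using ccont_minus. lra. intro t. eapply Rle_trans. apply Hlim.
    apply Rle_trans with (th N); [|apply HN0; unfold N; lia].
    rewrite <- (Rmult_1_r (th N)) at 2. apply Rmult_le_compat_l; auto. rewrite <- Rinv_1. apply Rinv_le_contravar. lra.
    rewrite S_INR. generalize (pos_INR N); lra.
Qed.

Definition kappa_deriv (a : nat -> C) (M : nat) (t : R) : R :=
  1 - 2 * rsum (fun j => INR (S j) * Re (Cmult (a (S j)) (eith (INR (S j) * t)))) M.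

Lemma kappa_deriv_periodic a M t z : kappa_deriv a M (t + 2 * IZR z * PI) = kappa_deriv a M t.
Proof.
  unfold kappa_deriv. do 2 f_equal. apply rsum_ext. intros j _. do 3 f_equal.
  rewrite <- (eith_2PI_Z (Z.of_nat (S j) * z) (INR (S j) * t)). f_equal. rewrite mult_IZR, <- INR_IZR_INZ. ring.
Qed.
Lemma kappa_deriv_correct a M t : is_derive (fun t => t - 2 * Im (apart a M (0, t))) t (kappa_deriv a M t).
Proof.
  apply (is_derive_ext (fun t => t - 2 * rsum (fun j => Im (Cmult (a (S j)) (eith (INR (S j) * t)))) M)).
  { intro. now rewrite apart_line, Im_csum. }
  unfold kappa_deriv. induction M; cbn [rsum].
  - auto_derive; auto. ring.
  - apply (is_derive_ext (fun t => (t - 2 * rsum (fun j => Im (Cmult (a (S j)) (eith (INR (S j) * t)))) M) + -2 * Im (Cmult (a (S M)) (eith (INR (S M) * t))))).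
    { intro. match goal with |- @eq _ ?a ?b => change (@eq R a b) end. ring. }
    replace (1 - _) with ((1 - 2 * rsum (fun j => INR (S j) * Re (Cmult (a (S j)) (eith (INR (S j) * t)))) M) + -2 * (INR (S M) * Re (Cmult (a (S M)) (eith (INR (S M) * t))))) by ring.
    apply (is_derive_plus (fun t => t - 2 * rsum (fun j => Im (Cmult (a (S j)) (eith (INR (S j) * t)))) M)); auto.
    generalize (INR (S M)). intro x. unfold Cmult, eith, Re, Im. cbn [fst snd]. auto_derive; auto. ring.
Qed.
Lemma kappa_deriv_diff a th : (forall N M, (N <= M)%nat ->
    rsum (fun j => INR (S j) * Cmod (a (S j))) M - rsum (fun j => INR (S j) * Cmod (a (S j))) N <= th N) ->
  forall N M t, (N <= M)%nat -> Rabs (kappa_deriv a M t - kappa_deriv a N t) <= 2 * th N.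
Proof.
  intros H N M t HNM. apply Rle_trans with (2 * (rsum (fun j => INR (S j) * Cmod (a (S j))) M - rsum (fun j => INR (S j) * Cmod (a (S j))) N)).
  2: generalize (H N M HNM); lra.
  unfold kappa_deriv. clear H. induction HNM.
  - unfold Rminus. rewrite !Rplus_opp_r, Rabs_R0. lra.
  - set (r := fun j => INR (S j) * Re (Cmult (a (S j)) (eith (INR (S j) * t)))) in *.
    set (w := fun j => INR (S j) * Cmod (a (S j))) in *.
    change (rsum r (S m)) with (rsum r m + r m). change (rsum w (S m)) with (rsum w m + w m).
    replace (1 - 2 * (rsum r m + r m) - (1 - 2 * rsum r N)) with ((1 - 2 * rsum r m - (1 - 2 * rsum r N)) + - (2 * r m)) by ring.
    eapply Rle_trans. apply Rabs_triang. rewrite (Rabs_Ropp (2 * r m)), (Rabs_mult 2 (r m)), (Rabs_right 2) by lra.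
    assert (Rabs (r m) <= w m).
    { unfold r, w. rewrite Rabs_mult, (Rabs_right (INR (S m))) by (apply Rle_ge, pos_INR). apply Rmult_le_compat_l. apply pos_INR.
      eapply Rle_trans. apply re_le_Cmod. rewrite Cmod_mult, Cmod_eith. lra. }
    lra.
Qed.

Lemma rcont_kappa_deriv a M : rcont (kappa_deriv a M).
Proof.
  apply rcont_minus. apply rcont_const. apply rcont_mult. apply rcont_const.
  apply (rcont_rsum (fun j t => INR (S j) * Re (Cmult (a (S j)) (eith (INR (S j) * t))))). intro j.
  apply rcont_mult. apply rcont_const. apply (ccont_mult (fun _ => a (S j)) (fun t => eith (INR (S j) * t))).
  apply ccont_const. apply ccont_eith, rcont_lin.
Qed.

(** The assumption on kappa' is pointwise, but the shift needs a uniform bound. The truncated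
    derivatives converge uniformly, so kappa' is their limit, hence continuous and periodic, and it
    attains a positive minimum; each truncation then loses at most [2 * th M]. *)
Lemma kappa_deriv_lower V th :
  (forall N M, (N <= M)%nat -> rsum (fun j => INR (S j) * Cmod (rcoef V (S j))) M -
     rsum (fun j => INR (S j) * Cmod (rcoef V (S j))) N <= th N) ->
  (forall N, 0 <= th N) ->
  (forall eps, 0 < eps -> exists N0, forall N, (N0 <= N)%nat -> th N <= eps) ->
  (forall t M, Cmod (Cminus (potential V t) (apart (rcoef V) M (0, t))) <= th M / INR (S M)) ->
  (forall t, exists d, is_derive (kappa V) t d /\ 0 < d) ->
  exists c, 0 < c /\ forall M t, c - 2 * th M <= kappa_deriv (rcoef V) M t.
Proof.
  intros H1 H2 H3 Hlim Hk. set (a := rcoef V) in *.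
  set (D := fun M t => kappa_deriv a M t). set (K := fun M t => t - 2 * Im (apart a M (0, t))).
  set (Dinf := fun t => real (Lim_seq (fun M => D M t))).
  assert (HD : forall t, is_lim_seq (fun M => D M t) (Dinf t) /\ forall M, Rabs (D M t - Dinf t) <= 2 * th M).
  { intro t. destruct (cauchy_rate (fun M => D M t) (fun M => 2 * th M)) as (l & Hl & Hr).
    intros; now apply kappa_deriv_diff.
    intros eps He. destruct (H3 (eps / 2)) as (N0 & HN0). lra. exists N0. intros N HN. generalize (HN0 N HN); lra.
    unfold Dinf. rewrite (is_lim_seq_unique _ _ Hl). simpl. split; auto. }
  assert (HKr : forall M t, Rabs (K M t - kappa V t) <= 2 * th M).
  { intros M t. unfold K, kappa. replace (t - 2 * Im (apart a M (0, t)) - (t + Omega V t)) with (2 * Im (Cminus (potential V t) (apart a M (0, t)))) by (simpl; unfold Im; field).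
    rewrite Rabs_mult, Rabs_right by lra. apply Rmult_le_compat_l. lra. eapply Rle_trans. apply im_le_Cmod.
    eapply Rle_trans. apply Hlim. rewrite <- (Rmult_1_r (th M)) at 2. apply Rmult_le_compat_l; auto. rewrite <- Rinv_1. apply Rinv_le_contravar. lra.
    rewrite S_INR. generalize (pos_INR M); lra. }
  assert (HK : forall t, is_lim_seq (fun M => K M t) (kappa V t)).
  { intro t. apply is_lim_seq_spec. intro eps. destruct (H3 (eps / 3)) as (N0 & HN0). generalize (cond_pos eps); lra.
    exists N0. intros M HM. eapply Rle_lt_trans. apply HKr. generalize (HN0 M HM) (cond_pos eps). lra. }
  assert (HDK : forall M t, Derive (K M) t = D M t) by (intros; apply is_derive_unique, kappa_deriv_correct).
  assert (UD : CVU_dom D (fun _ => True)).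
  { intro eps. destruct (H3 (eps / 3)) as (N0 & HN0). generalize (cond_pos eps); lra.
    exists N0. intros M HM t _. fold (Dinf t). eapply Rle_lt_trans. apply HD. generalize (HN0 M HM) (cond_pos eps). lra. }
  assert (UK : CVU_dom K (fun _ => True)).
  { intro eps. destruct (H3 (eps / 3)) as (N0 & HN0). generalize (cond_pos eps); lra.
    exists N0. intros M HM t _. rewrite (is_lim_seq_unique _ _ (HK t)). simpl. eapply Rle_lt_trans. apply HKr. generalize (HN0 M HM) (cond_pos eps). lra. }
  assert (CD : forall M t, continuity_pt (D M) t) by (intros; apply continuity_pt_filterlim, rcont_kappa_deriv).
  (* Uniform convergence of the derivatives lets differentiation pass to the limit; uniqueness of
     the derivative then transfers the assumed positivity to [Dinf]. *)
  assert (Hder : forall t, is_derive (kappa V) t (Dinf t)).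
  { intro t. apply (is_derive_ext (fun y => real (Lim_seq (fun n => K n y)))).
    intro y. now rewrite (is_lim_seq_unique _ _ (HK y)).
    replace (Dinf t) with (real (Lim_seq (fun n => Derive (K n) t))).
    2:{ unfold Dinf. f_equal. apply Lim_seq_ext. intro; apply HDK. }
    apply (CVU_Derive K (fun _ => True)); auto.
    - apply open_true.
    - intros ? ? ? ? ? ?; auto.
    - intros n x _. eexists. apply kappa_deriv_correct.
    - intros n x _. apply (continuity_pt_ext (D n)); auto.
    - intro eps. destruct (UD eps) as (N0 & HN0). exists N0. intros n Hn x Hx. rewrite HDK.
      rewrite (Lim_seq_ext _ (fun M => D M x)) by (intro; apply HDK). now apply HN0. }
  assert (Hpos : forall t, 0 < Dinf t).
  { intro t. destruct (Hk t) as (d & Hd & Hd0). rewrite <- (is_derive_unique _ _ _ (Hder t)), (is_derive_unique _ _ _ Hd). auto. }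
  assert (HC : forall t, continuity_pt Dinf t).
  { intro t. apply (CVU_cont_open D (fun _ => True)); auto. apply open_true. }
  destruct (continuity_ab_min Dinf (- PI) PI) as (x0 & Hx0 & _). generalize PI_RGT_0; lra. auto.
  exists (Dinf x0). split; auto. intros M t.
  (* With this integer, t - 2 pi z lies in [-PI, PI], where the minimum was taken. *)
  set (z := up ((t - PI) / (2 * PI))). destruct (archimed ((t - PI) / (2 * PI))) as [Z1 Z2]. fold z in Z1, Z2.
  generalize PI_RGT_0; intro HPI.
  assert (Z3 : (t - PI) / (2 * PI) * (2 * PI) = t - PI) by (field; lra).
  unfold D. rewrite <- (kappa_deriv_periodic a M t (- z)). set (t' := t + 2 * IZR (- z) * PI).
  assert (Ht' : - PI <= t' <= PI). { unfold t'. rewrite opp_IZR. split; nra. }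
  generalize (Hx0 t' Ht') (proj2 (HD t') M). unfold D. intros A1 A2. apply Rabs_le_between in A2. lra.
Qed.

Lemma sinh_taylor x : 0 <= x -> Rabs (exp x - exp (- x) - 2 * x) <= x ^ 2 * exp x.
Proof.
  intro Hx. generalize (exp_ineq1_le x) (exp_ineq1_le (- x)) (exp_pos x) (exp_pos (- x)). intros H1 H2 H3 H4.
  assert (E : exp x * exp (- x) = 1) by (rewrite <- exp_plus, Rplus_opp_r; apply exp_0).
  assert (A1 : exp x - 1 <= x * exp x) by nra.
  assert (A2 : exp x - 1 - x <= x ^ 2 * exp x) by nra.
  assert (A3 : exp (- x) * (1 + x) <= 1) by nra.
  assert (A4 : exp (- x) <= 1 - x + x ^ 2).
  { assert (0 <= x ^ 3) by (apply pow_le; lra). apply Rmult_le_reg_r with (1 + x). lra. nra. }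
  assert (A5 : x ^ 2 <= x ^ 2 * exp x). { generalize (pow2_ge_0 x). nra. }
  apply Rabs_le. lra.
Qed.

(** Replacing e^{j eta} - e^{-j eta} by 2 j eta turns the shifted phase into [eta] times the
    derivative of the truncated kappa, with an error of at most (j eta)^2 e^{M eta} |a_j| for each
    j. *)
Lemma shifted_phase_lower a M eta t : 0 <= eta ->
  eta * kappa_deriv a M t - eta ^ 2 * exp (INR M * eta) * rsum (fun j => INR (S j) ^ 2 * Cmod (a (S j))) M <=
  eta - rsum (fun j => (exp (INR (S j) * eta) - exp (- (INR (S j) * eta))) * Re (Cmult (a (S j)) (eith (INR (S j) * t)))) M.
Proof.
  intro He. unfold kappa_deriv.
  assert (H : rsum (fun j => (exp (INR (S j) * eta) - exp (- (INR (S j) * eta))) * Re (Cmult (a (S j)) (eith (INR (S j) * t)))) M <=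
    rsum (fun j => 2 * eta * (INR (S j) * Re (Cmult (a (S j)) (eith (INR (S j) * t)))) + eta ^ 2 * exp (INR M * eta) * (INR (S j) ^ 2 * Cmod (a (S j)))) M).
  2:{ rewrite rsum_plus, !rsum_scal in H. lra. }
  apply rsum_le. intros j Hj. set (r := Re _).
  assert (Hr : Rabs r <= Cmod (a (S j))).
  { unfold r. eapply Rle_trans. apply re_le_Cmod. rewrite Cmod_mult, Cmod_eith. lra. }
  set (x := INR (S j) * eta). assert (Hx : 0 <= x) by (apply Rmult_le_pos; auto; apply pos_INR).
  assert (HxM : exp x <= exp (INR M * eta)).
  { apply exp_le_le. apply Rmult_le_compat_r; auto. apply le_INR. lia. }
  replace ((exp x - exp (- x)) * r) with (2 * x * r + (exp x - exp (- x) - 2 * x) * r) by ring.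
  replace (2 * eta * (INR (S j) * r)) with (2 * x * r) by (unfold x; ring). apply Rplus_le_compat_l.
  eapply Rle_trans. apply Rle_abs. rewrite Rabs_mult.
  apply Rle_trans with (x ^ 2 * exp (INR M * eta) * Cmod (a (S j))).
  - apply Rmult_le_compat; auto using Rabs_pos. eapply Rle_trans. now apply sinh_taylor.
    apply Rmult_le_compat_l; auto. apply pow2_ge_0.
  - right. unfold x. ring.
Qed.

Lemma disc0_potential V th : ccont (potential V) -> (forall N, 0 <= th N) ->
  (forall eps, 0 < eps -> exists N0, forall N, (N0 <= N)%nat -> th N <= eps) ->
  (forall t M, Cmod (Cminus (potential V t) (apart (rcoef V) M (0, t))) <= th M / INR (S M)) ->
  disc0 (potential V).
Proof.
  intros HF H2 H3 Hlim. split; [auto|split].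
  (* The empty truncation is zero, so the rate at M = 0 is already a bound for the potential. *)
  - exists (th 0%nat). split; auto. intro t. generalize (Hlim t 0%nat). unfold apart. simpl.
    unfold Rdiv. rewrite Rinv_1, Rmult_1_r. unfold Cminus. replace (Copp 0) with (RtoC 0) by ring. now rewrite Cplus_0_r.
  - intros eps He. destruct (H3 eps He) as (N0 & HN0). exists (apart (rcoef V) N0). split; [apply isA_apart|split].
    + apply mean_apart.
    + intro t. eapply Rle_trans. apply Hlim. eapply Rle_trans; [|apply (HN0 N0 (le_n _))].
      rewrite <- (Rmult_1_r (th N0)) at 2. apply Rmult_le_compat_l; auto. rewrite <- Rinv_1. apply Rinv_le_contravar. lra.
      rewrite S_INR. generalize (pos_INR N0); lra.
Qed.

(** * Numerical bounds and the choice of parameters *)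

Lemma ln_large x : exists N, forall n, (N <= n)%nat -> x <= ln (INR n).
Proof.
  destruct (nfloor_ex (exp x)) as (N & _ & HN). left; apply exp_pos.
  exists (S N). intros n Hn. rewrite <- (ln_exp x). apply Rcomplements.ln_le. apply exp_pos.
  apply le_INR in Hn. rewrite S_INR in Hn. lra.
Qed.

(** For l = ln n the left side is n^{-1/4} ln n, the size of the error of the shifted phase. The
    form 64 / l turns its smallness into a lower bound on ln n. *)
Lemma mult_exp_quarter_le l : 0 < l -> l * exp (- (l / 4)) <= 64 / l.
Proof.
  intro Hl. assert (H : l ^ 2 / 64 <= exp (l / 4)).
  { replace (l / 4) with (l / 8 + l / 8) by field. rewrite exp_plus. generalize (exp_ineq1_le (l / 8)). intro. nra. }
  rewrite exp_Ropp. apply Rmult_le_reg_r with (exp (l / 4)). apply exp_pos.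
  rewrite Rmult_assoc, Rinv_l by (apply Rgt_not_eq, exp_pos). apply Rle_trans with (64 / l * (l ^ 2 / 64)).
  right; field; lra. apply Rmult_le_compat_l; auto. apply Rmult_le_pos. lra. left; now apply Rinv_0_lt_compat.
Qed.

Lemma exp_ln_pow n k : (0 < n)%nat -> exp (- (INR k * ln (INR n))) = / INR n ^ k.
Proof.
  intro Hn. assert (0 < INR n) by now apply lt_0_INR.
  rewrite exp_Ropp, exp_INR_mult, exp_ln; auto.
Qed.

Theorem theorem4p7 (k : nat) (V : R -> R) :
  (2 <= k)%nat ->
  CmLip (k - 1) V ->
  (forall t, exists d, is_derive (kappa V) t d /\ 0 < d) ->
  exists K : R, 0 < K /\
    exists N : nat, forall n : nat, (N <= n)%nat ->
      forall P : nat -> nat -> C,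
        orthonormal_system (fun t => exp (- INR n * V t)) P ->
        Rabs ((Re (P (n - 1)%nat (n - 1)%nat)) ^ 2 * exp (- INR n * V0 V) - 1)
          <= K * ln (INR n) / INR n ^ (2 * (k - 1)).
Proof.
  intros Hk HV Hkap.
  assert (HVc : rcont V) by exact (CmLip_rcont (k - 1) V 0 HV ltac:(lia)).
  destruct (potential_limit (k - 1) V ltac:(lia) HV) as (A0 & th & HS0 & HS & H1 & H2 & H3 & Hlim).
  replace (k - 1 + 1)%nat with k in HS by lia.
  assert (HF : ccont (potential V)).
  { apply ccont_pair.
    - apply rcont_mult; [|apply rcont_const]. apply rcont_minus; auto using rcont_const.
    (* Continuity of [Omega] is read off from differentiability of kappa. *)
    - apply (rcont_ext (fun t => - / 2 * (kappa V t - t))). intro; unfold kappa; field.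
      apply rcont_mult. apply rcont_const. apply rcont_minus; [|apply rcont_id].
      intro t. apply (ex_derive_continuous (kappa V)). destruct (Hkap t) as (d & Hd & _). now exists d. }
  assert (HD0 := disc0_potential V th HF H2 H3 Hlim).
  destruct (kappa_deriv_lower V th H1 H2 H3 Hlim Hkap) as (c & Hc & Hlow).
  set (a := rcoef V) in *.
  assert (HkR : 2 <= INR k) by (apply le_INR in Hk; simpl in Hk; lra).
  (* Truncate at frequency n / q and shift by eta = B ln n / n: the gain is exp (- n eta c / 2) = n^-k,
     and B / q <= 1/4 keeps the factor exp (n eta / q) below n^(1/4). *)
  set (B := 2 * INR k / c).
  assert (HB : 0 < B) by (apply Rmult_lt_0_compat; [lra|now apply Rinv_0_lt_compat]).
  destruct (nfloor_ex (4 * B)) as (q0 & _ & Hq0). lra.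
  set (q := S q0). rewrite <- S_INR in Hq0. fold q in Hq0.
  assert (Hq : 0 < INR q) by lra. assert (Hq1 : (1 <= q)%nat) by (unfold q; lia).
  (* The truncated derivative stays above c - c/4; the Taylor error will take another c/4, which
     still leaves the c/2 used below. *)
  destruct (H3 (c / 8)) as (N1 & HN1). lra.
  (* Since n <= (M+1) q, this makes the uniform phase error 2 n tau at most 1/4; the shifted
     exponential adds at most 1/4, giving the required 1/2. *)
  destruct (H3 (/ (8 * INR q))) as (N2 & HN2). apply Rinv_0_lt_compat; lra.
  (* The large threshold makes B (A0+1)/2 * 64/l at most c/4; the bound 1 serves the last step. *)
  destruct (ln_large (Rmax 1 (128 * B * (A0 + 1) / c))) as (N3 & HN3).
  (* The constant in eps <= C1 / n^{k-1}: the summand 1 comes from the shifted exponential n^{-k},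
     the other from 2 n sig with M + 1 >= n / q. *)
  set (C1 := 1 + 2 * sqrt A0 * INR q ^ k).
  assert (HC1 : 1 <= C1).
  { unfold C1. assert (0 <= sqrt A0 * INR q ^ k) by (apply Rmult_le_pos; [apply sqrt_pos|apply pow_le; lra]). lra. }
  exists (4 * C1 ^ 2). split. nra.
  exists (max (max (q * N1) (q * N2)) (max N3 4)). intros n Hn P HP.
  set (M := (n / q)%nat).
  assert (HM1 : (N1 <= M)%nat) by (apply Nat.div_le_lower_bound; lia).
  assert (HM2 : (N2 <= M)%nat) by (apply Nat.div_le_lower_bound; lia).
  assert (Hn4 : 4 <= INR n) by (change 4 with (INR 4) at 1 || replace 4 with (INR 4) by (simpl; ring); apply le_INR; lia).
  assert (HMn : INR M * INR q <= INR n) by (rewrite <- mult_INR, Nat.mul_comm; apply le_INR, Nat.Div0.mul_div_le).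
  assert (HMn2 : INR n <= INR (S M) * INR q).
  { rewrite <- mult_INR, Nat.mul_comm. apply le_INR. apply Nat.lt_le_incl, Nat.mul_succ_div_gt. lia. }
  set (l := ln (INR n)).
  assert (Hl : Rmax 1 (128 * B * (A0 + 1) / c) <= l) by (apply HN3; lia).
  assert (Hl1 : 1 <= l) by (eapply Rle_trans; [apply Rmax_l|apply Hl]).
  assert (Hl2 : 128 * B * (A0 + 1) / c <= l) by (eapply Rle_trans; [apply Rmax_r|apply Hl]).
  assert (En : exp l = INR n) by (apply exp_ln; lra).
  set (eta := B * l / INR n).
  assert (Heta : 0 < eta).
  { apply Rmult_lt_0_compat. apply Rmult_lt_0_compat; lra. apply Rinv_0_lt_compat; lra. }
  assert (HMeta : INR M * eta <= l / 4).
  { unfold eta. apply Rmult_le_reg_r with (INR n * INR q). apply Rmult_lt_0_compat; lra.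
    replace (INR M * (B * l / INR n) * (INR n * INR q)) with ((INR M * INR q) * (B * l)) by (field; lra).
    apply Rle_trans with (INR n * (B * l)). apply Rmult_le_compat_r; auto. nra.
    replace (l / 4 * (INR n * INR q)) with (INR n * l * (INR q / 4)) by field.
    replace (INR n * (B * l)) with (INR n * l * B) by ring. apply Rmult_le_compat_l. nra. lra. }
  assert (Hbr : forall t, eta * (c / 2) <= eta - rsum (fun j => (exp (INR (S j) * eta) - exp (- (INR (S j) * eta))) *
     Re (Cmult (a (S j)) (eith (INR (S j) * t)))) M).
  { intro t. eapply Rle_trans; [|apply shifted_phase_lower; lra].
    generalize (Hlow M t) (HN1 M HM1). intros L1 L2.
    assert (L3 : eta * exp (INR M * eta) * rsum (fun j => INR (S j) ^ 2 * Cmod (a (S j))) M <= c / 4).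
    (* The weight is exp(l/2) = sqrt n, which balances the two parts of the bound since M <= n. *)
    { generalize (weighted_sum2_le a k A0 (exp (l / 2)) Hk (exp_pos _) HS M). intro W.
      assert (W2 : / 2 * (exp (l / 2) * A0 + INR M * / exp (l / 2)) <= exp (l / 2) * (A0 + 1) / 2).
      { assert (INR M <= INR n). { apply Rle_trans with (INR M * INR q); auto. rewrite <- (Rmult_1_r (INR M)) at 1.
          apply Rmult_le_compat_l. apply pos_INR. apply le_INR in Hq1. simpl in Hq1. auto. }
        assert (INR M * / exp (l / 2) <= exp (l / 2)).
        { apply Rmult_le_reg_r with (exp (l / 2)). apply exp_pos. rewrite Rmult_assoc, Rinv_l by (apply Rgt_not_eq, exp_pos).
          rewrite <- exp_plus. replace (l / 2 + l / 2) with l by field. lra. }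
        lra. }
      assert (W3 : exp (INR M * eta) <= exp (l / 4)) by now apply exp_le_le.
      apply Rle_trans with (eta * exp (l / 4) * (exp (l / 2) * (A0 + 1) / 2)).
      { apply Rmult_le_compat. apply Rmult_le_pos; [lra|left; apply exp_pos].
        apply rsum_pos. intros. apply Rmult_le_pos. apply pow2_ge_0. apply Cmod_ge_0.
        apply Rmult_le_compat_l; lra. lra. }
      (* The powers of n combine as n^{-1} n^{1/4} n^{1/2} = n^{-1/4}, with one factor l from
         [eta]. *)
      assert (Ee : eta * exp (l / 4) * (exp (l / 2) * (A0 + 1) / 2) = B * (A0 + 1) / 2 * (l * exp (- (l / 4)))).
      { unfold eta. rewrite <- En. replace (exp l) with (exp (l / 4) * exp (l / 2) * exp (l / 4)).
        rewrite exp_Ropp. field. split; apply Rgt_not_eq, exp_pos.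
        rewrite <- !exp_plus. f_equal. field. }
      rewrite Ee. generalize (mult_exp_quarter_le l ltac:(lra)). intro W4.
      apply Rle_trans with (B * (A0 + 1) / 2 * (64 / l)). apply Rmult_le_compat_l; auto. nra.
      apply Rmult_le_reg_r with (l * (4 / c)). apply Rmult_lt_0_compat. lra. apply Rmult_lt_0_compat. lra. now apply Rinv_0_lt_compat.
      replace (B * (A0 + 1) / 2 * (64 / l) * (l * (4 / c))) with (128 * B * (A0 + 1) / c) by (field; lra).
      replace (c / 4 * (l * (4 / c))) with l by (field; lra). auto. }
    replace (eta ^ 2 * exp (INR M * eta) * rsum (fun j => INR (S j) ^ 2 * Cmod (a (S j))) M) with
      (eta * (eta * exp (INR M * eta) * rsum (fun j => INR (S j) ^ 2 * Cmod (a (S j))) M)) by ring.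
    rewrite <- Rmult_minus_distr_l. apply Rmult_le_compat_l; lra. }
  assert (Hexp : exp (- INR n * eta * (c / 2)) = / INR n ^ k).
  { rewrite <- exp_ln_pow by (apply INR_lt; simpl; lra). f_equal. fold l. unfold eta, B. field. split; lra. }
  assert (Hnk : 4 <= INR n ^ k).
  { apply Rle_trans with (INR n ^ 1). lra. apply Rle_pow. lra. lia. }
  set (tau := th M / INR (S M)).
  assert (HSM : 0 < INR (S M)) by (apply lt_0_INR; lia).
  assert (Htau0 : 0 <= tau) by (apply Rmult_le_pos; [auto|left; now apply Rinv_0_lt_compat]).
  assert (Htau : 2 * INR n * tau <= / 4).
  { generalize (HN2 M HM2). intro T1. unfold tau.
    apply Rle_trans with (2 * (INR (S M) * INR q) * (/ (8 * INR q) / INR (S M))).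
    - apply Rmult_le_compat; auto. lra. lra. apply Rmult_le_compat_r; auto. left; now apply Rinv_0_lt_compat.
    - right. field. split; lra. }
  set (sig := sqrt A0 / INR (S M) ^ k).
  assert (Hsig : nrm (fun t => Cminus (potential V t) (apart a M (0, t))) <= sig) by now apply (nrm_potential_diff V k A0 th).
  assert (Hsig0 : 0 <= sig) by (eapply Rle_trans; [apply nrm_pos|apply Hsig]).
  set (eps := exp (- INR n * eta * (c / 2)) + 2 * INR n * sig).
  assert (Heps0 : 0 <= eps).
  { assert (0 <= 2 * INR n * sig) by nra. unfold eps. generalize (exp_pos (- INR n * eta * (c / 2))). lra. }
  assert (Heps : eps <= C1 / INR n ^ (k - 1)).
  { assert (Hpk : 0 < INR n ^ k) by lra. assert (Hpk1 : 0 < INR n ^ (k - 1)) by (apply pow_lt; lra).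
    assert (Ek : INR n ^ k = INR n * INR n ^ (k - 1)) by (rewrite tech_pow_Rmult; f_equal; lia).
    assert (Hs : sig <= sqrt A0 * INR q ^ k / INR n ^ k).
    { unfold sig, Rdiv. rewrite Rmult_assoc. apply Rmult_le_compat_l. apply sqrt_pos.
      apply Rmult_le_reg_r with (INR n ^ k * INR (S M) ^ k). apply Rmult_lt_0_compat; auto. now apply pow_lt.
      assert (0 < INR (S M) ^ k) by now apply pow_lt.
      replace (/ INR (S M) ^ k * (INR n ^ k * INR (S M) ^ k)) with (INR n ^ k) by (field; lra).
      replace (INR q ^ k * / INR n ^ k * (INR n ^ k * INR (S M) ^ k)) with ((INR (S M) * INR q) ^ k) by (rewrite Rpow_mult_distr; field; lra).
      apply pow_incr. lra. }
    unfold eps. rewrite Hexp.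
    apply Rle_trans with (INR n / INR n ^ k + 2 * INR n * (sqrt A0 * INR q ^ k / INR n ^ k)).
    - apply Rplus_le_compat. rewrite <- (Rmult_1_l (/ INR n ^ k)). apply Rmult_le_compat_r. left; now apply Rinv_0_lt_compat. lra.
      apply Rmult_le_compat_l; lra.
    - right. unfold C1. rewrite Ek. field. split; lra. }
  assert (HVF : forall t, V t = V0 V + 2 * Re (potential V t)) by (intro; simpl; field).
  destruct (leading_coefficient_defect n V (potential V) (V0 V) P eps ltac:(lia) HD0 HVc HVF HP Heps0) as [D1 D2].
  - intros f g Hf Hg. eapply Rle_trans. apply (phase_bilinear_bound a M n (potential V) eta (c / 2) tau); auto. lra.
    apply Rmult_le_compat_r. apply Rmult_le_pos; apply nrm_pos. rewrite Hexp.
    assert (/ INR n ^ k <= / 4) by (apply Rinv_le_contravar; lra). lra.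
  - intros f Hf. apply (phase_linear_bound a M n (potential V) eta (c / 2) sig); auto. lra.
  - rewrite Rabs_minus_sym, Rabs_right by lra.
    assert (Hpk1 : 0 < INR n ^ (k - 1)) by (apply pow_lt; lra).
    assert (Hpk2 : 0 < INR n ^ (2 * (k - 1))) by (apply pow_lt; lra).
    assert (Ek2 : INR n ^ (2 * (k - 1)) = (INR n ^ (k - 1)) ^ 2) by (rewrite <- pow_mult; f_equal; lia).
    apply Rle_trans with (4 * C1 ^ 2 / INR n ^ (2 * (k - 1))).
    + eapply Rle_trans. apply D2. apply Rle_trans with (4 * (C1 / INR n ^ (k - 1)) ^ 2).
      apply Rmult_le_compat_l. lra. apply pow_incr. lra. rewrite Ek2. right. field. lra.
    (* The estimate obtained so far has no logarithm; the factor ln n is inserted using ln n >=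
       1. *)
    + apply Rmult_le_compat_r. left; now apply Rinv_0_lt_compat. fold l.
      rewrite <- (Rmult_1_r (4 * C1 ^ 2)) at 1. apply Rmult_le_compat_l. nra. auto.
Qed.
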